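(* Let $\Bbbk$ be an algebraically closed field and let $d\ge 1$, $h\ge 1$ be integers. (i) For every $e\in\mathbb{N}$, the image $\mathcal C_{d,h,e}$ of the injective map $$\left(\operatorname{Id}_{\mathbb{A}_\Bbbk^e}\times\psi_{d,h+e(d-2)}\right)\circ\varphi_{d,h,e}:\ \mathcal A(d,h,e)\longrightarrow \mathbb{A}_\Bbbk^e\times\mathcal C_{d,h+e(d-2)}$$ is constructible in $\mathbb{A}_\Bbbk^e\times\mathcal C_{d,h+e(d-2)}$. (ii) Through the maps of (i), the set $\mathcal A(d,h)_0$ can be identified with the constructible set $$\bigcup_{e\le 2dh}\mathcal C_{d,h,e}\subset\mathbb{A}_\Bbbk^{N(d,h)}$$ for some $N(d,h)\in\mathbb{N}$. (iii) The dimension of this constructible set is $dh+d+h-1$.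
   Context: $\mathbb{N}$ contains $0$. $x$ and $T$ are single indeterminates. $\Bbbk\langle x\rangle$ denotes the ring of algebraic power series, i.e. elements of $\Bbbk[[x]]$ algebraic over $\Bbbk[x]$. $\mathbb{A}_\Bbbk^n$ is affine $n$-space over $\Bbbk$ (identified with $\Bbbk^n$). For $f\in\Bbbk\langle x\rangle$, the kernel of $\Bbbk[x,T]\to\Bbbk\langle x\rangle$, $P\mapsto P(x,f)$, is a principal prime ideal; its generator (unique up to multiplication by $\Bbbk^*$) is the minimal polynomial of $f$. The degree of $f$ is the degree in $T$, and the height of $f$ the degree in $x$, of its minimal polynomial. $\mathcal A(d,h)_0$ is the set of $f\in\Bbbk\langle x\rangle$ of degree $\le d$ and height $\le h$ with $f(0)=0$. $\mathcal A(d,h,e)$ is the set of $f\in\mathcal A(d,h)_0$ whose minimal polynomial $P$ satisfies $\operatorname{ord}\left(\frac{\partial P}{\partial T}(x,f)\right)=e$, where $\operatorname{ord}$ is the $x$-adic order. The set $\mathcal A(d,h)_0$ is the disjoint union of the sets $\mathcal A(d,h,e)$, $e\in\mathbb{N}$, and $\mathcal A(d,h,e)=\emptyset$ for $e>2dh$. $\mathcal I(d,h):=\mathcal A(d,h,0)$ is the set of $f\in\mathcal A(d,h)_0$ whose minimal polynomial $P$ satisfies $P(0,0)=0$ and $\frac{\partial P}{\partial T}(0,0)\neq 0$; for a negative integer $H$ we set $\mathcal I(d,H)=\emptyset$. The map $\psi_{d,h}:\mathcal I(d,h)\to\mathbb{A}_\Bbbk^{dh+d+h-1}$ sends $f$ to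 its minimal polynomial normalized so that the coefficient of $x^0T^1$ is $1$; here $\mathbb{A}_\Bbbk^{dh+d+h-1}$ is identified with the set of polynomials $P(x,T)$ with $P(0,0)=0$, $\frac{\partial P}{\partial T}(0,0)=1$, $\deg_xP\le h$, $\deg_TP\le d$. It is injective and its image is denoted $\mathcal C_{d,h}$. The map $\varphi_{d,h,e}:\mathcal A(d,h,e)\to\mathbb{A}_\Bbbk^e\times\mathcal I(d,h+e(d-2))$ is the injective map $f\mapsto(f^{(0)},f^{(1)})$, where $f=f^{(0)}+x^ef^{(1)}$, $f^{(0)}$ is a polynomial in $x$ of degree $\le e$ vanishing at $0$ and $f^{(1)}$ is an algebraic power series vanishing at $0$; the set of polynomials of degree $\le e$ vanishing at $0$ is identified with $\mathbb{A}_\Bbbk^e$ through the coefficients. If $d=1$ and $e\geq 1$, the set $\mathcal A(d,h,e)$ is empty, and so is $\mathcal C_{d,h,e}$; the assertion (i) is then vacuous. In (ii), the identification means: for each $e\le 2dh$ with $\mathcal A(d,h,e)\neq\emptyset$, the space $\mathbb{A}_\Bbbk^e\times\mathbb{A}_\Bbbk^{d(h+e(d-2))+d+(h+e(d-2))-1}$ containing $\mathcal C_{d,h,e}$ is embedded in the common space $\mathbb{A}_\Bbbk^{N(d,h)}$ by a closed (affine-linear) embedding, in such a way that the images of the sets $\mathcal C_{d,h,e}$ for different $e$ are disjoint; the maps of (i) then give together a bijection from $\mathcal A(d,h)_0$ onto the union of these images. *)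

(* Defs.v *)
From HB Require Import structures.
From mathcomp Require Import all_boot all_order all_algebra.
From mathcomp Require Import polyXY.
From mathcomp Require Import boolp classical_sets functions.
From mathcomp Require Import mpoly.

Set Implicit Arguments.
Unset Strict Implicit.
Unset Printing Implicit Defensive.

Import GRing.Theory.
Local Open Scope classical_set_scope.
Local Open Scope ring_scope.

(* A record rather than [nat -> R], whose ring structure in [functions] is
   the pointwise one. *)
Record fps (R : Type) := Fps { fps_coef : nat -> R }.

Lemma fpsP (R : Type) (f g : fps R) : fps_coef f =1 fps_coef g -> f = g.
Proof. by case: f g => [f] [g] /= /funext ->. Qed.

HB.instance Definition _ (R : Type) := gen_eqMixin (fps R).
HB.instance Definition _ (R : Type) := gen_choiceMixin (fps R).

Section FpsRing.
Variable R : comNzRingType.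
Implicit Types f g h : fps R.

Definition fps_zero : fps R := Fps (fun=> 0).
Definition fps_one : fps R := Fps (fun n => (n == 0%N)%:R).
Definition fps_opp f : fps R := Fps (fun n => - fps_coef f n).
Definition fps_add f g : fps R := Fps (fun n => fps_coef f n + fps_coef g n).
Definition fps_mul f g : fps R :=
  Fps (fun n => \sum_(i < n.+1) fps_coef f i * fps_coef g (n - i)).

Definition fps_trunc m f : {poly R} := \poly_(i < m.+1) fps_coef f i.

Lemma coef_fps_trunc m f i : (i <= m)%N -> (fps_trunc m f)`_i = fps_coef f i.
Proof. by rewrite coef_poly ltnS => ->. Qed.

Lemma coef_fps_mul (p q : {poly R}) m f g :
    (forall i, (i <= m)%N -> p`_i = fps_coef f i) ->
    (forall i, (i <= m)%N -> q`_i = fps_coef g i) ->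
  forall i, (i <= m)%N -> (p * q)`_i = fps_coef (fps_mul f g) i.
Proof.
move=> hp hq i le_im; rewrite coefM /=; apply: eq_bigr => j _.
rewrite hp ?hq // (leq_trans _ le_im) ?leq_subr //.
by rewrite -ltnS.
Qed.

Lemma fps_addA : associative fps_add.
Proof. by move=> f g h; apply: fpsP => n /=; rewrite addrA. Qed.
Lemma fps_addC : commutative fps_add.
Proof. by move=> f g; apply: fpsP => n /=; rewrite addrC. Qed.
Lemma fps_add0 : left_id fps_zero fps_add.
Proof. by move=> f; apply: fpsP => n /=; rewrite add0r. Qed.
Lemma fps_addN : left_inverse fps_zero fps_opp fps_add.
Proof. by move=> f; apply: fpsP => n /=; rewrite addNr. Qed.

Lemma fps_mulA : associative fps_mul.
Proof.
move=> f g h; apply: fpsP => n.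
have E k := @coef_fps_trunc n k.
rewrite -(coef_fps_mul (E f) (coef_fps_mul (E g) (E h)) (leqnn n)).
by rewrite mulrA (coef_fps_mul (coef_fps_mul (E f) (E g)) (E h)).
Qed.

Lemma fps_mulC : commutative fps_mul.
Proof.
move=> f g; apply: fpsP => n.
have E k := @coef_fps_trunc n k.
by rewrite -(coef_fps_mul (E f) (E g) (leqnn n)) mulrC (coef_fps_mul (E g) (E f)).
Qed.

Lemma fps_mul1 : left_id fps_one fps_mul.
Proof.
move=> f; apply: fpsP => n /=.
rewrite big_ord_recl /= mul1r subn0 big1 ?addr0 // => i _.
by rewrite mul0r.
Qed.

Lemma fps_mulDl : left_distributive fps_mul fps_add.
Proof.
move=> f g h; apply: fpsP => n /=; rewrite -big_split /=.
by apply: eq_bigr => i _; rewrite mulrDl.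
Qed.

Lemma fps_one_neq0 : fps_one != fps_zero.
Proof.
apply/eqP => /(congr1 (fun f => fps_coef f 0)) /= /eqP.
by rewrite oner_eq0.
Qed.

HB.instance Definition _ := GRing.isZmodule.Build (fps R)
  fps_addA fps_addC fps_add0 fps_addN.
HB.instance Definition _ := GRing.Zmodule_isComNzRing.Build (fps R)
  fps_mulA fps_mulC fps_mul1 fps_mulDl fps_one_neq0.

Definition fps_of_poly (p : {poly R}) : fps R := Fps (fun n => p`_n).

Lemma fps_of_poly_is_additive : zmod_morphism fps_of_poly.
Proof. by move=> p q; apply: fpsP => n /=; rewrite coefB. Qed.
HB.instance Definition _ :=
  GRing.isZmodMorphism.Build {poly R} (fps R) fps_of_poly
    fps_of_poly_is_additive.

Lemma fps_of_poly_is_monoid : monoid_morphism fps_of_poly.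
Proof.
split; first by apply: fpsP => n /=; rewrite coef1.
by move=> p q; apply: fpsP => n /=; rewrite coefM.
Qed.
HB.instance Definition _ :=
  GRing.isMonoidMorphism.Build {poly R} (fps R) fps_of_poly
    fps_of_poly_is_monoid.

End FpsRing.

Section Algebraic.
Variable K : fieldType.
Implicit Types (f g : fps K) (P Q : {poly {poly K}}).

(* Elements of K[x,T] are polynomials in T (outer indeterminate) with
   coefficients in K[x] (inner one): [P`_j`_i] is the coefficient of
   x^i T^j, and [sizeY P] is 1 + deg_x P for nonzero P. *)
Definition subst P f : fps K := (map_poly (@fps_of_poly K) P).[f].

Definition algebraic f := exists2 P, P != 0 & subst P f = 0.

(* The kernel of [subst ^~ f] is the principal ideal (P). *)
Definition is_minpoly f P :=
  forall Q, subst Q f = 0 <-> exists R : {poly {poly K}}, Q = R * P.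

(* Unique only up to a factor in K^*. *)
Definition minpoly f : {poly {poly K}} := xget 0 (is_minpoly f).

Definition adegree f : nat := (size (minpoly f)).-1.
Definition aheight f : nat := (sizeY (minpoly f)).-1.

Definition has_order g (e : nat) :=
  fps_coef g e != 0 /\ forall i, (i < e)%N -> fps_coef g i = 0.

(* The bound on the height is an integer, since h + e(d-2) is negative for
   d = 1 and e > h; the sets below are then empty. *)
Definition algA0 (d : nat) (h : int) : set (fps K) :=
  [set f | [/\ algebraic f, fps_coef f 0 = 0,
               (adegree f <= d)%N & (aheight f)%:Z <= h]].

Definition algA (d : nat) (h : int) (e : nat) : set (fps K) :=
  [set f | algA0 d h f /\ has_order (subst (minpoly f)^`() f) e].

Definition algI (d : nat) (h : int) : set (fps K) := algA d h 0%N.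

End Algebraic.
Arguments algA0 : clear implicits.
Arguments algA : clear implicits.
Arguments algI : clear implicits.

Section Maps.
Variable K : fieldType.
Implicit Types (f : fps K).

Definition dimI (d : nat) (H : int) : nat :=
  if H is Posz n then (d * n + d + n - 1)%N else 0%N.

(* The monomials x^i T^j with i <= H and j <= d are numbered by
   i * (d + 1) + j; the first two, 1 and T (d >= 1), whose coefficients are
   0 and 1, are dropped. *)
Definition poly_coords d H (P : {poly {poly K}}) : 'rV[K]_(dimI d H) :=
  \row_k P`_((k + 2) %% d.+1)`_((k + 2) %/ d.+1).

Definition normal_minpoly f : {poly {poly K}} :=
  ((minpoly f)`_1`_0)^-1%:P *: minpoly f.

Definition psi d H f : 'rV[K]_(dimI d H) := poly_coords d H (normal_minpoly f).

Definition imgI d H : set 'rV[K]_(dimI d H) := psi d H @` algI K d H.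
Arguments imgI : clear implicits.

(* phi_{d,h,e} is f |-> (phi0 e f, phi1 e f). *)
Definition phi0 e f : 'rV[K]_e := \row_i fps_coef f i.+1.
Definition phi1 e f : fps K :=
  Fps (fun n => if n == 0%N then 0 else fps_coef f (n + e)).

Definition poly0_of_coefs e (a : 'rV[K]_e) : {poly K} :=
  \sum_(i < e) a 0 i *: 'X^(i.+1).

Lemma phi_decomp e f : fps_coef f 0 = 0 ->
  f = fps_of_poly (poly0_of_coefs (phi0 e f)) + fps_of_poly 'X^e * phi1 e f.
Proof.
move=> f0; apply: fpsP => n.
have -> : fps_coef (fps_of_poly (poly0_of_coefs (phi0 e f))
                    + fps_of_poly 'X^e * phi1 e f) n =
  (poly0_of_coefs (phi0 e f))`_n
    + \sum_(i < n.+1) ('X^e : {poly K})`_i * fps_coef (phi1 e f) (n - i).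
  by [].
have -> : (poly0_of_coefs (phi0 e f))`_n =
          if (0 < n <= e)%N then fps_coef f n else 0.
  rewrite /poly0_of_coefs coef_sum; case: ifPn => [/andP[n0 ne]|nP].
    have hn : (n.-1 < e)%N by rewrite prednK.
    rewrite (bigD1 (Ordinal hn)) //= coefZ coefXn mxE prednK // eqxx mulr1.
    rewrite big1 ?addr0 // => i ine; rewrite coefZ coefXn.
    case: eqP => [En|]; rewrite ?mulr0 //.
    by case/eqP: ine; apply: val_inj; rewrite /= En.
  rewrite big1 // => i _; rewrite coefZ coefXn.
  case: eqP => [En|]; rewrite ?mulr0 //.
  by move: nP; rewrite En /= ltn_ord.
have [lt_ne|le_en] := ltnP n e.
  rewrite big1 ?addr0 => [|i _]; last first.
    rewrite coefXn (ltn_eqF (leq_ltn_trans _ lt_ne)) ?mul0r //=.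
    by rewrite -ltnS.
  by rewrite (ltnW lt_ne) andbT; case: posnP => [->|].
have hen : (e < n.+1)%N by [].
rewrite (bigD1 (Ordinal hen)) //= coefXn eqxx mul1r big1 ?addr0; last first.
  move=> i ine; rewrite coefXn; case: eqP => [Ei|]; rewrite ?mul0r //.
  by case/eqP: ine; apply: val_inj.
rewrite subn_eq0 subnK //; have [le_ne|_] := leqP n e.
  by rewrite addr0 andbT; case: posnP => [->|].
by rewrite andbF add0r.
Qed.

Lemma phi_decomp_unique e (a : 'rV[K]_e) (g : fps K) : fps_coef g 0 = 0 ->
  let f := fps_of_poly (poly0_of_coefs a) + fps_of_poly 'X^e * g in
  phi0 e f = a /\ phi1 e f = g.
Proof.
move=> g0 f.
have fE n : fps_coef f n = (poly0_of_coefs a)`_n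
    + \sum_(i < n.+1) ('X^e : {poly K})`_i * fps_coef g (n - i) by [].
clearbody f.
have aE (i : 'I_e) : (poly0_of_coefs a)`_i.+1 = a 0 i.
  rewrite /poly0_of_coefs coef_sum (bigD1 i) //= coefZ coefXn eqxx mulr1.
  rewrite big1 ?addr0 // => j ji; rewrite coefZ coefXn eqSS.
  by rewrite eq_sym (negPf (ji : val j != val i)) mulr0.
have a0 n : (e < n)%N -> (poly0_of_coefs a)`_n = 0.
  move=> en; rewrite /poly0_of_coefs coef_sum big1 // => j _.
  rewrite coefZ coefXn; case: eqP => [En|]; rewrite ?mulr0 //.
  by move: en; rewrite En ltnNge ltn_ord.
split.
  apply/rowP => i; rewrite mxE fE aE big1 ?addr0 // => j _; rewrite coefXn.
  case: eqP => [Ej|]; rewrite ?mul0r // mul1r.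
  suff -> : (i.+1 - j = 0)%N by [].
  by apply/eqP; rewrite subn_eq0 Ej ltn_ord.
apply: fpsP => n /=; case: eqP => [->//|/eqP n0].
rewrite fE a0 ?add0r; last by rewrite -[X in (X < _)%N]add0n ltn_add2r lt0n.
have hen : (e < (n + e).+1)%N by rewrite ltnS leq_addl.
rewrite (bigD1 (Ordinal hen)) //= coefXn eqxx mul1r addnK big1 ?addr0 //.
move=> i ine; rewrite coefXn; case: eqP => [Ei|]; rewrite ?mul0r //.
by case/eqP: ine; apply: val_inj.
Qed.

Definition newH (d h e : nat) : int := h%:Z + e%:Z * (d%:Z - 2).

(* A^e x A^(dimI d H) is identified with A^(e + dimI d H). *)
Definition dimA (d h e : nat) : nat := (e + dimI d (newH d h e))%N.

(* (Id x psi_{d,h+e(d-2)}) o phi_{d,h,e} *)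
Definition theta d h e f : 'rV[K]_(dimA d h e) :=
  row_mx (phi0 e f) (psi d (newH d h e) (phi1 e f)).

Definition prodC d h e : set 'rV[K]_(dimA d h e) :=
  [set v | imgI d (newH d h e) (rsubmx v)].

Definition imgA d h e : set 'rV[K]_(dimA d h e) := theta d h e @` algA K d h e.

End Maps.
Arguments imgI : clear implicits.
Arguments prodC : clear implicits.
Arguments imgA : clear implicits.

Section Zariski.
Variables (K : fieldType) (n : nat).
Implicit Types X Y Z : set 'rV[K]_n.

Definition zclosed Z :=
  exists S : set {mpoly K[n]}, Z = [set v | forall p, S p -> p.@[v 0] = 0].

Definition zclosed_in X Z := exists2 F, zclosed F & Z = X `&` F.
Definition zopen_in X Z := exists2 F, zclosed F & Z = X `&` ~` F.

Definition constructible_in X Z :=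
  exists (k : nat) (U F : 'I_k -> set 'rV[K]_n),
    [/\ forall i, zopen_in X (U i), forall i, zclosed_in X (F i) &
        Z = \bigcup_(i in [set: 'I_k]) (U i `&` F i)].

Definition irreducible Z := Z !=set0 /\
  forall F G, zclosed F -> zclosed G ->
    Z `<=` F `|` G -> Z `<=` F \/ Z `<=` G.

Definition irr_chain X (m : nat) := exists Z : nat -> set 'rV[K]_n,
  (forall i, (i <= m)%N -> zclosed_in X (Z i) /\ irreducible (Z i)) /\
  (forall i, (i < m)%N -> Z i `<` Z i.+1).

(* The Krull dimension of X with the topology induced from K^n. *)
Definition has_dim X (m : nat) :=
  irr_chain X m /\ forall m', irr_chain X m' -> (m' <= m)%N.

End Zariski.

(* Injective affine-linear maps: these are closed embeddings. *)
Definition affine_embedding (K : fieldType) (m n : nat)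
    (i : 'rV[K]_m -> 'rV[K]_n) :=
  exists (A : 'M[K]_(m, n)) (b : 'rV[K]_n),
    row_free A /\ forall v, i v = v *m A + b.

(* Main.v *)
Require Import Defs.
From HB Require Import structures.
From mathcomp Require Import all_boot all_order all_algebra.
From mathcomp Require Import polyXY closed_field ring_quotient.
From mathcomp Require Import boolp classical_sets functions filter.
From mathcomp Require Import mpoly zify ring.

(** Let f be in A(d,h,e), with minimal polynomial P, and f = f0 + x^e f1. The
    derivative P_T(x,f) has order e, so Taylor expansion at f0 gives
    P(x, f0 + x^e T) = x^(2e) Q with Q(0,0) = 0 and Q_T(0,0) nonzero
    ([shift_factor]). This Q is the minimal polynomial of f1: a polynomial that
    vanishes at f1 is, up to a power of x, a multiple of Q, and x is a prime
    that does not divide Q ([is_minpoly_shift]). Counting degrees in x bounds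
    the height of Q by h + e(d-2), and Hensel's lemma recovers f1 from Q, so
    that (f0, Q) determines f. The order e is finite because K is perfect
    ([minpoly_separable]), and at most 2dh because the resultant of P and P_T
    is a combination of P and P_T ([minpoly_order_bound]).

    Conversely, (f0, Q) comes from some f in A(d,h,e) exactly when
    P(x, f0 + x^e T) = x^(2e) Q for an irreducible P of degree at most d in T
    and h in x ([imgAP]). Irreducibility quantifies over the coefficients of
    two factors of bounded degree, so this is a first-order condition on the
    coefficients of f0 and Q, and quantifier elimination over the algebraically
    closed field K makes it constructible ([definable_clausal]). The images for
    the various e are put in a common affine space by adding zeros, and are kept
    apart by a last block of coordinates that contains the e-th unit vector.

    For the upper bound on the dimension, a chain Z_0 < ... < Z_m of
    irreducible sets gives polynomials q_i that vanish on Z_i but not on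
    Z_(i+1). An ultrafilter that contains all nonempty open subsets of Z_m
    plays the part of the generic point: in the ultrapower L of K along it, the
    q_i are algebraically independent over K ([chain_seq_free]). One of the
    finitely many strata belongs to the ultrafilter, and on it not only f0 and
    Q but also P are functions with values in K, hence have classes in L. The
    coefficients of a series that is a root of P are algebraic over the ratios
    of the coefficients of P ([root_coef_in]). As P has (d+1)(h+1)
    coefficients, of which P(0,0) is zero and another one can be made 1, these
    ratios amount to dh+d+h-1 elements, and Steinitz' exchange lemma bounds m
    by this number ([dim_bound]).

    For the lower bound, the stratum e = 0 consists of the irreducible P with
    P(0,0) = 0 and P_T(0,0) = 1. A reducible P with this normalization is the
    product of two normalized polynomials whose bidegrees add up to (d,h), and
    these have together fewer than dh+d+h-1 coefficients. By [dim_bound] again,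
    the reducible P are not dense, so some polynomial g that is not identically
    zero vanishes on them ([irred_generic]). The flag of coordinate subspaces
    through a point where g does not vanish cuts the stratum e = 0 in a chain of
    length dh+d+h-1 ([strata_irr_chain]). *)

Set Implicit Arguments.
Unset Strict Implicit.
Unset Printing Implicit Defensive.

Import GRing.Theory.
Local Open Scope classical_set_scope.
Local Open Scope ring_scope.

(** * Formal power series and Hensel's lemma *)

Section FpsRing.
Variable R : comNzRingType.
Implicit Types f g : fps R.

Lemma fps_coefD f g n : fps_coef (f + g) n = fps_coef f n + fps_coef g n.
Proof. by []. Qed.
Lemma fps_coefN f n : fps_coef (- f) n = - fps_coef f n. Proof. by []. Qed.
Lemma fps_coefM f g n :
  fps_coef (f * g) n = \sum_(i < n.+1) fps_coef f i * fps_coef g (n - i).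
Proof. by []. Qed.
Lemma fps_coef_poly (p : {poly R}) n : fps_coef (fps_of_poly p) n = p`_n.
Proof. by []. Qed.

Lemma fps_coef0M f g : fps_coef (f * g) 0 = fps_coef f 0 * fps_coef g 0.
Proof. by rewrite fps_coefM big_ord1. Qed.

Lemma fps_coefXnM e f n :
  fps_coef (fps_of_poly 'X^e * f) n = if (n < e)%N then 0 else fps_coef f (n - e).
Proof.
rewrite fps_coefM; have [lt_ne|le_en] := ltnP n e.
  rewrite big1 // => i _.
  by rewrite fps_coef_poly coefXn (ltn_eqF (leq_ltn_trans _ lt_ne)) ?mul0r -1?ltnS.
have hen : (e < n.+1)%N by [].
rewrite (bigD1 (Ordinal hen)) //= coefXn eqxx mul1r big1 ?addr0 // => i ine.
rewrite coefXn; case: eqP => [Ei|]; rewrite ?mul0r //.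
by case/eqP: ine; apply: val_inj.
Qed.

Lemma fps_coefCM a f n : fps_coef (fps_of_poly a%:P * f) n = a * fps_coef f n.
Proof.
rewrite fps_coefM big_ord_recl big1 ?addr0 => [|i _].
  by rewrite fps_coef_poly coefC subn0.
by rewrite fps_coef_poly coefC mul0r.
Qed.

Lemma fpsXn_inj e f g : fps_of_poly 'X^e * f = fps_of_poly 'X^e * g -> f = g.
Proof.
move=> E; apply: fpsP => n.
have := congr1 (fun h => fps_coef h (n + e)) E.
by rewrite !fps_coefXnM ltnNge leq_addl /= addnK.
Qed.

Lemma fps_divXn e f : (forall i, (i < e)%N -> fps_coef f i = 0) ->
  f = fps_of_poly 'X^e * Fps (fun n => fps_coef f (n + e)).
Proof.
move=> f0; apply: fpsP => n; rewrite fps_coefXnM.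
by case: ltnP => [/f0|/subnK /= ->].
Qed.

Lemma fps_of_poly_inj : injective (@fps_of_poly R).
Proof.
move=> p q E; apply/polyP => i.
exact: (congr1 (fun h => fps_coef h i) E).
Qed.

End FpsRing.

Section FpsDomain.
Variable K : fieldType.
Implicit Types (f g : fps K) (P Q : {poly {poly K}}).

Lemma has_orderM f g a b :
  has_order f a -> has_order g b -> has_order (f * g) (a + b).
Proof.
move=> [fa f0] [gb g0]; split.
  have ha : (a < (a + b).+1)%N by rewrite ltnS leq_addr.
  rewrite fps_coefM (bigD1 (Ordinal ha)) //= addKn big1 ?addr0 ?mulf_neq0 //.
  move=> i ia; case: (ltngtP i a) => [/f0->|lt|E]; rewrite ?mul0r //.
    by rewrite g0 ?mulr0 // ltn_subLR ?ltn_add2r // -ltnS ltn_ord.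
  by case/eqP: ia; apply: val_inj.
move=> n lt_n; rewrite fps_coefM big1 // => i _.
have [/f0->|le_ai] := ltnP i a; rewrite ?mul0r //.
rewrite g0 ?mulr0 // ltn_subLR; last by rewrite -ltnS ltn_ord.
by rewrite (leq_trans lt_n) // leq_add2r.
Qed.

Lemma has_order_ex f : f != 0 -> exists e, has_order f e.
Proof.
move=> f0; have ex : exists n, fps_coef f n != 0.
  apply/not_existsP => H; case/eqP: f0; apply: fpsP => n.
  by apply/eqP/negP => h; apply: (H n); apply/negP.
case: (ex_minnP ex) => e fe he; exists e; split=> //.
move=> i lt_ie; apply/eqP; apply: contraTT lt_ie => h.
by rewrite -leqNgt he.
Qed.

Lemma has_order_neq0 f e : has_order f e -> f != 0.
Proof. by case=> fe _; apply: contraNneq fe => ->. Qed.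

Lemma has_order_uniq f a b : has_order f a -> has_order f b -> a = b.
Proof.
move=> [fa f0] [fb f0']; case: (ltngtP a b) => // [/f0'|/f0] E.
  by rewrite E eqxx in fa.
by rewrite E eqxx in fb.
Qed.

(** Orders add up, so K[[x]] is a domain. *)
Lemma fps_mulf_eq0 f g : f * g = 0 -> f = 0 \/ g = 0.
Proof.
move=> fg; have [->|/has_order_ex [a fa]] := eqVneq f 0; first by left.
have [->|/has_order_ex [b gb]] := eqVneq g 0; first by right.
by case/eqP: (has_order_neq0 (has_orderM fa gb)).
Qed.

Lemma fps_expf_eq0 f n : f ^+ n = 0 -> f = 0.
Proof.
elim: n => [|n IHn]; last by rewrite exprS => /fps_mulf_eq0[].
by rewrite expr0 => /eqP; rewrite oner_eq0.
Qed.

End FpsDomain.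

Section Subst.
Variable K : fieldType.
Implicit Types (f g : fps K) (P Q : {poly {poly K}}).

Definition subst_at f P := subst P f.
Lemma subst_is_additive f : zmod_morphism (subst_at f).
Proof. by move=> P Q; rewrite /subst_at /subst rmorphB hornerD hornerN. Qed.
Lemma subst_is_monoid f : monoid_morphism (subst_at f).
Proof.
split; first by rewrite /subst_at /subst rmorph1 hornerC.
by move=> P Q; rewrite /subst_at /subst rmorphM hornerM.
Qed.
HB.instance Definition _ f := GRing.isZmodMorphism.Build {poly {poly K}} (fps K)
  (subst_at f) (subst_is_additive f).
HB.instance Definition _ f := GRing.isMonoidMorphism.Build {poly {poly K}} (fps K)
  (subst_at f) (subst_is_monoid f).

Lemma substD P Q f : subst (P + Q) f = subst P f + subst Q f.
Proof. exact: (rmorphD (subst_at f)). Qed.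
Lemma substB P Q f : subst (P - Q) f = subst P f - subst Q f.
Proof. exact: (rmorphB (subst_at f)). Qed.
Lemma substM P Q f : subst (P * Q) f = subst P f * subst Q f.
Proof. exact: (rmorphM (subst_at f)). Qed.
Lemma substXn P f n : subst (P ^+ n) f = subst P f ^+ n.
Proof. exact: (rmorphXn (subst_at f)). Qed.
Lemma subst0 f : subst 0 f = 0. Proof. exact: (rmorph0 (subst_at f)). Qed.
Lemma subst1 f : subst 1 f = 1. Proof. exact: (rmorph1 (subst_at f)). Qed.
Lemma substC (p : {poly K}) f : subst p%:P f = fps_of_poly p.
Proof. by rewrite /subst map_polyC hornerC. Qed.
Lemma substX f : subst 'X f = f.
Proof. by rewrite /subst map_polyX hornerX. Qed.
Lemma substZ (p : {poly K}) P f : subst (p *: P) f = fps_of_poly p * subst P f.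
Proof. by rewrite -mul_polyC substM substC. Qed.

Lemma subst_comp P Q f : subst (P \Po Q) f = subst P (subst Q f).
Proof.
elim/poly_ind: P => [|P c IH]; first by rewrite comp_poly0 !subst0.
rewrite comp_polyD comp_polyM comp_polyX comp_polyC.
by rewrite !(substD, substM, substC, substX) IH.
Qed.

Lemma fps_coef0_subst P f :
  fps_coef (subst P f) 0 = (map_poly (horner_eval 0) P).[fps_coef f 0].
Proof.
elim/poly_ind: P => [|P c IH]; first by rewrite subst0 raddf0 horner0.
rewrite substD substM substX substC fps_coefD fps_coef0M IH.
rewrite rmorphD rmorphM /= map_polyX map_polyC hornerD hornerM hornerX hornerC.
by rewrite /= /horner_eval horner_coef0.
Qed.

Lemma subst_coef0 P f : fps_coef f 0 = 0 ->
  fps_coef (subst P f) 0 = P`_0`_0.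
Proof.
move=> f0; rewrite fps_coef0_subst f0 horner_coef0 coef_map /=.
by rewrite /horner_eval horner_coef0.
Qed.

(** Only the two lowest coefficients in T contribute to the difference
    quotient at the origin: this is what makes both existence and uniqueness
    in Hensel's lemma work. *)
Lemma subst_diff P f g : fps_coef f 0 = 0 -> fps_coef g 0 = 0 ->
  exists2 h, subst P f - subst P g = (f - g) * h & fps_coef h 0 = P`_1`_0.
Proof.
move=> f0 g0; elim/poly_ind: P => [|P c [h E h0]].
  by exists 0; rewrite ?subst0 ?subrr ?mulr0 // !coef0.
exists (h * f + subst P g); last first.
  rewrite fps_coefD fps_coef0M f0 mulr0 add0r subst_coef0 //.
  by rewrite coefD coefMX coefC addr0.
rewrite !substD !substM !substX !substC mulrDr mulrA -E.
rewrite mulrBl [in LHS]opprD addrACA subrr addr0 mulrBl.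
by rewrite [f * _]mulrC [g * _]mulrC addrA subrK.
Qed.

Lemma fps_unit_reg h f : fps_coef h 0 != 0 -> f * h = 0 -> f = 0.
Proof. by move=> h0 /fps_mulf_eq0[//|E]; case/eqP: h0; rewrite E. Qed.

Lemma hensel_unique P f g : fps_coef f 0 = 0 -> fps_coef g 0 = 0 ->
  P`_1`_0 != 0 -> subst P f = 0 -> subst P g = 0 -> f = g.
Proof.
move=> f0 g0 P1 Pf Pg; have [h E h0] := subst_diff P f0 g0.
apply/eqP; rewrite -subr_eq0; apply/eqP.
by apply: (@fps_unit_reg h); rewrite ?h0 // -E Pf Pg subrr.
Qed.

(** Newton's iteration T - P(T)/u, with u the value at the origin of the
    derivative, gains one coefficient at each step. *)
Lemma hensel_exists P : P`_0`_0 = 0 -> P`_1`_0 != 0 ->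
  exists2 f, fps_coef f 0 = 0 & subst P f = 0.
Proof.
move=> P0 P1; pose u := (P`_1`_0)^-1.
pose Q : {poly {poly K}} := 'X - u%:P *: P.
have Q0 f : fps_coef f 0 = 0 -> fps_coef (subst Q f) 0 = 0.
  move=> f0; rewrite subst_coef0 // coefB coefX /= coefZ coefB coef0.
  by rewrite coefCM P0 mulr0 subrr.
have Q1 : Q`_1`_0 = 0.
  by rewrite coefB coefX /= coefZ coefB coef1 coefCM mulVf // subrr.
(* Q has no term of degree 1 in T at x = 0, so it contracts the x-adic metric. *)
have contr f g n : fps_coef f 0 = 0 -> fps_coef g 0 = 0 ->
    (forall i, (i < n)%N -> fps_coef f i = fps_coef g i) ->
  forall i, (i < n.+1)%N -> fps_coef (subst Q f) i = fps_coef (subst Q g) i.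
  move=> f0 g0 Efg i lt_in; have [h E h0] := subst_diff Q f0 g0.
  apply/eqP; rewrite -subr_eq0; apply/eqP.
  have -> : fps_coef (subst Q f) i - fps_coef (subst Q g) i =
            fps_coef (subst Q f - subst Q g) i by [].
  rewrite E fps_coefM big1 // => j _.
  have [lt_jn|le_nj] := ltnP j n.
    by rewrite fps_coefD fps_coefN Efg // subrr mul0r.
  have -> : (i - j = 0)%N by apply/eqP; rewrite subn_eq0 (leq_trans _ le_nj).
  by rewrite h0 Q1 mulr0.
pose F n := iter n (subst Q) 0.
have F0 n : fps_coef (F n) 0 = 0 by elim: n => [|n IH] //=; apply: Q0.
have FS n : forall i, (i < n)%N -> fps_coef (F n) i = fps_coef (F n.+1) i.
  by elim: n => [//|n IH]; apply: contr; [exact: (F0 n)|exact: (F0 n.+1)|exact: IH].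
have Fm n m : (n <= m)%N -> forall i, (i < n)%N ->
    fps_coef (F n) i = fps_coef (F m) i.
  elim: m => [|m IH]; first by rewrite leqn0 => /eqP->.
  rewrite leq_eqVlt => /predU1P[->//|]; rewrite ltnS => le_nm i lt_in.
  by rewrite IH // FS // (leq_trans lt_in).
(* the x-adic limit of the iterates *)
pose f : fps K := Fps (fun n => fps_coef (F n.+1) n).
have f0 : fps_coef f 0 = 0 by apply: (F0 1%N).
have fF n i : (i < n)%N -> fps_coef f i = fps_coef (F n) i.
  by move=> lt_in; apply: (Fm i.+1 n).
exists f => //.
have Qf : subst Q f = f.
  apply: fpsP => n; rewrite (@contr f (F n) n) ?ltnSn //.
  by move=> i lt_in; apply: fF.
have : fps_of_poly u%:P * subst P f = 0.
  move: Qf; rewrite substB substX substZ => /eqP.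
  by rewrite -subr_eq0 addrAC subrr add0r oppr_eq0 => /eqP.
move=> /fps_mulf_eq0[|//] /(congr1 (fun h => fps_coef h 0)).
by rewrite fps_coef_poly coefC => /eqP; rewrite invr_eq0 (negPf P1).
Qed.

End Subst.

(** * Minimal polynomials of algebraic series *)

Section SizeY.
Variable R : idomainType.
Implicit Types (P Q : {poly {poly R}}).

Lemma sizeYM P Q : P != 0 -> Q != 0 -> sizeY (P * Q) = (sizeY P + sizeY Q).-1.
Proof. by move=> P0 Q0; rewrite !sizeYE rmorphM size_mul ?swapXY_eq0. Qed.

Lemma sizeY_gt0 P : P != 0 -> (0 < sizeY P)%N.
Proof. by move=> P0; rewrite lt0n sizeY_eq0. Qed.

Lemma sizeY_polyC (c : {poly R}) : sizeY c%:P = size c.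
Proof. by rewrite sizeYE swapXY_polyC size_map_inj_poly //; exact: polyC_inj. Qed.

Lemma sizeY_le P n : (sizeY P <= n)%N <-> forall j, (size (P`_j)%R <= n)%N.
Proof.
split=> [le_n j|H]; first by apply: leq_trans le_n; apply: max_size_coefXY.
by apply/bigmax_leqP => j _; apply: H.
Qed.

(** The factor theorem for the inner variable x, read on [swapXY]. *)
Lemma factor_inner P a :
  map_poly (horner_eval a) P = 0 -> exists Q, P = ('X - a%:P)%:P * Q.
Proof.
move=> E; have /factor_theorem[q Eq] : root (swapXY P) a%:P.
  by rewrite /root horner_swapXY E.
exists (swapXY q); rewrite -[P]swapXYK Eq rmorphM mulrC; congr (_ * _).
by rewrite rmorphB /= swapXY_X swapXY_polyC map_polyC -rmorphB.
Qed.

(** The linear forms in x are prime in R[x][T]. *)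
Lemma cancel_inner a P Q A : map_poly (horner_eval a) P != 0 ->
  ('X - a%:P)%:P * Q = A * P -> exists A', A = ('X - a%:P)%:P * A' /\ Q = A' * P.
Proof.
move=> Pa E; have : map_poly (horner_eval a) (A * P) = 0.
  by rewrite -E rmorphM /= map_polyC /= /horner_eval hornerXsubC subrr mul0r.
rewrite rmorphM => /eqP; rewrite mulf_eq0 (negPf Pa) orbF => /eqP.
move=> /factor_inner[A' EA]; exists A'; split=> //.
apply: (@mulfI _ ('X - a%:P)%:P); first by rewrite polyC_eq0 polyXsubC_eq0.
by rewrite E EA mulrA.
Qed.

Lemma size_dvd_le P Q A : P = A * Q -> P != 0 -> (size Q <= size P)%N.
Proof.
move=> -> /[dup]; rewrite {1}mulf_eq0 => /norP[A0 Q0] _.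
by rewrite size_mul // -ltnS prednK ?addn_gt0 ?lt0n ?size_poly_eq0 ?A0 //
  -[X in (X <= _)%N]add1n leq_add2r lt0n size_poly_eq0.
Qed.

Lemma sizeY_dvd_le P Q A : P = A * Q -> P != 0 -> (sizeY Q <= sizeY P)%N.
Proof.
rewrite !sizeYE -swapXY_eq0 => E; apply: size_dvd_le.
by rewrite E rmorphM.
Qed.

End SizeY.

Section MinPoly.
Variable K : closedFieldType.
Implicit Types (f g : fps K) (P Q A B : {poly {poly K}}).

(** In the kernel choose P of least degree in T and, among these, of least
    degree in x. Pseudo-division by P leaves no remainder, so each Q in the
    kernel satisfies c(x) Q = R P. As K is algebraically closed, c is a product
    of linear factors; none of them divides P, by minimality in x, so all of
    them can be cancelled. *)
Lemma kernel_principal f : algebraic f -> exists P, is_minpoly f P.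
Proof.
move=> [P0 P0n P0f].
pose inker P := P != 0 /\ subst P f = 0.
pose hs n := `[< exists P, inker P /\ size P = n >].
have /ex_minnP[n /asboolP[P1 [kP1 sP1]] min_n] : exists n, hs n.
  by exists (size P0); apply/asboolP; exists P0.
pose hh m := `[< exists P, [/\ inker P, size P = n & sizeY P = m] >].
have /ex_minnP[m /asboolP[P [[Pn Pf] sP sYP]] min_m] : exists m, hh m.
  by exists (sizeY P1); apply/asboolP; exists P1.
have Pa a : map_poly (horner_eval a) P != 0.
  apply/eqP => /factor_inner[Q E].
  have Xa : ('X - a%:P)%:P != 0 :> {poly {poly K}}.
    by rewrite polyC_eq0 polyXsubC_eq0.
  have Qn : Q != 0 by apply: contraNneq Pn => Q0; rewrite E Q0 mulr0.
  have sQ : size Q = n.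
    by rewrite -sP E mul_polyC size_scale // polyXsubC_eq0.
  have := min_m (sizeY Q); rewrite -sYP E sizeYM // sizeY_polyC size_XsubC.
  rewrite ltnn => H; suff : false by []; apply: H; apply/asboolP; exists Q; split=> //.
  split=> //; move: Pf; rewrite E substM substC => /fps_mulf_eq0[|//].
  move=> H; case/eqP: Xa; congr (_%:P).
  by apply: (@fps_of_poly_inj K); rewrite H rmorph0.
have strip c Q R : c != 0 -> c%:P * Q = R * P -> exists R', Q = R' * P.
  have [k] := ubnP (size c); elim: k => // k IH in c R *; rewrite ltnS.
  move=> sc c0 E; have [s1|s1] := eqVneq (size c) 1.
    have [a a0 Ec] : exists2 a, a != 0 & c = a%:P.
      by move/eqP: s1 => /size_poly1P[a a0 Ea]; exists a.
    exists (a^-1%:P%:P * R); rewrite -mulrA -E Ec mulrA -rmorphM -rmorphM /=.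
    by rewrite mulVf // mul1r.
  have /closed_rootP[a /factor_theorem[c' Ec]] := s1.
  have c'0 : c' != 0 by apply: contraNneq c0 => c'0; rewrite Ec c'0 mul0r.
  have E' : ('X - a%:P)%:P * (c'%:P * Q) = R * P.
    by rewrite -E Ec mulrA -polyCM [c' * _]mulrC.
  have [R' [_ ER]] := cancel_inner (Pa a) E'.
  apply: (IH c' R') => //.
  by move: sc; rewrite Ec size_mul ?polyXsubC_eq0 // size_XsubC addn2.
exists P => Q; split=> [Qf|[R ->]]; last by rewrite substM Pf mulr0.
have E := Pdiv.Idomain.divp_eq Q P.
set c := (X in X *: Q) in E.
have c0 : c != 0 by rewrite expf_neq0 // lead_coef_eq0.
have mod0 : Pdiv.Idomain.modp Q P = 0.
  apply/eqP; apply/negPn/negP => m0.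
  have := Pdiv.Idomain.ltn_modp Q P; rewrite Pn sP => lt.
  have := min_n (size (Pdiv.Idomain.modp Q P)); rewrite leqNgt lt => H.
  suff : false by []; apply: H; apply/asboolP; exists (Pdiv.Idomain.modp Q P).
  split=> //; split=> //; have := congr1 (fun A => subst A f) E.
  by rewrite /= substZ Qf mulr0 substD substM Pf mulr0 add0r => <-.
move: E; rewrite mod0 addr0 -mul_polyC.
exact: strip.
Qed.

Lemma minpolyP f : algebraic f -> is_minpoly f (minpoly f).
Proof. by move=> /kernel_principal[P fP]; apply: (xgetPex 0); exists P. Qed.

Lemma is_minpoly_root f P : is_minpoly f P -> subst P f = 0.
Proof. by move=> H; apply/H; exists 1; rewrite mul1r. Qed.

Lemma is_minpoly_neq0 f P : algebraic f -> is_minpoly f P -> P != 0.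
Proof.
move=> [Q Q0 Qf] H; have [R E] := (H Q).1 Qf.
by apply: contraNneq Q0 => P0; rewrite E P0 mulr0.
Qed.

Lemma is_minpoly_algebraic f P : P != 0 -> is_minpoly f P -> algebraic f.
Proof. by move=> P0 /is_minpoly_root; exists P. Qed.

Lemma polyXY_unit A B : A * B = 1 -> exists2 a, a != 0 & A = a%:P%:P.
Proof.
move=> AB; have : A \is a GRing.unit.
  by apply/unitrP; exists B; rewrite mulrC.
rewrite poly_unitE => /andP[/eqP s1]; rewrite poly_unitE => /andP[/eqP s2].
rewrite unitfE => c0.
exists A`_0`_0 => //; rewrite -size1_polyC ?s2 // -size1_polyC ?s1 //.
Qed.

Lemma is_minpoly_scale f P (a : K) : a != 0 -> is_minpoly f P ->
  is_minpoly f (a%:P%:P * P).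
Proof.
move=> a0 H Q; rewrite H; split=> [] [R ->].
  exists (R * a^-1%:P%:P); rewrite -mulrA; congr (_ * _); rewrite mulrA.
  by rewrite -!rmorphM /= mulVf // mul1r.
by exists (R * a%:P%:P); rewrite mulrA.
Qed.

(** Two generators of the kernel divide each other. *)
Lemma is_minpoly_uniq f P Q : algebraic f -> is_minpoly f P ->
  is_minpoly f Q -> exists2 a, a != 0 & Q = a%:P%:P * P.
Proof.
move=> fa fP fQ; have [A EA] := (fQ P).1 (is_minpoly_root fP).
have [B EB] := (fP Q).1 (is_minpoly_root fQ).
have P0 := is_minpoly_neq0 fa fP.
have /polyXY_unit[b b0 Eb] : B * A = 1.
  by apply: (mulIf P0); rewrite mulrAC mul1r -EB mulrC -EA.
by exists b; rewrite // EB Eb.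
Qed.

Definition constXY P := exists c : K, P = c%:P%:P.

(** In a product of bounded degrees the factors have bounded degrees, so that
    this is a first-order condition on the coefficients of P. *)
Definition irred P :=
  [/\ P != 0, ~ constXY P & forall A B, P = A * B -> constXY A \/ constXY B].

Lemma constXY_root_eq0 f (c : K) : subst c%:P%:P f = 0 -> c = 0.
Proof.
rewrite substC => /(congr1 (fun h => fps_coef h 0)).
by rewrite fps_coef_poly coefC.
Qed.

Lemma is_minpoly_irred f P : algebraic f -> is_minpoly f P -> irred P.
Proof.
move=> fa fP; have P0 := is_minpoly_neq0 fa fP.
have Pf := is_minpoly_root fP.
split=> // [[c E]|A B E].
  by move: Pf P0; rewrite E => /constXY_root_eq0 ->; rewrite eqxx.
have cst C D : P = C * D -> subst C f = 0 -> constXY D.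
  move=> ECD /fP[R EC]; have : D * R = 1.
    by apply: (mulIf P0); rewrite -mulrA -EC mul1r mulrC.
  by move=> /polyXY_unit[d _ ->]; exists d.
move: Pf; rewrite E substM => /fps_mulf_eq0[Af|Bf]; first by right; apply: cst Af.
by left; apply: (cst B A); rewrite 1?mulrC.
Qed.

(** An irreducible multiple of the minimal polynomial is associate to it. *)
Lemma irred_is_minpoly f P : irred P -> subst P f = 0 -> is_minpoly f P.
Proof.
move=> [P0 Pc irrP] Pf; have fa : algebraic f by exists P.
have fM := minpolyP fa; have [R E] := (fM P).1 Pf.
case: (irrP _ _ E) => [[c Ec]|[c Ec]]; last first.
  case: (is_minpoly_irred fa fM) => _ H _; case: H; exists c; exact: Ec.
have c0 : c != 0.
  by apply: contraNneq P0 => c0; rewrite E Ec c0 !polyC0 mul0r.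
by rewrite E Ec; apply: is_minpoly_scale.
Qed.

End MinPoly.

(** * Separability and the bound on the order *)

Section Derivation.
Variable K : fieldType.
Implicit Types (f g : fps K) (P : {poly {poly K}}).

Definition fps_deriv f : fps K := Fps (fun n => fps_coef f n.+1 *+ n.+1).

Lemma fps_derivM f g :
  fps_deriv (f * g) = fps_deriv f * g + f * fps_deriv g.
Proof.
apply: fpsP => n; set p := fps_trunc n.+1 f; set q := fps_trunc n.+1 g.
have pE i : (i <= n.+1)%N -> p`_i = fps_coef f i by apply: coef_fps_trunc.
have qE i : (i <= n.+1)%N -> q`_i = fps_coef g i by apply: coef_fps_trunc.
rewrite [LHS](_ : _ = (p * q)^`()`_n); last first.
  by rewrite coef_deriv (coef_fps_mul pE qE).
have p'E i : (i <= n)%N -> p^`()`_i = fps_coef (fps_deriv f) i.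
  by move=> le_in; rewrite coef_deriv pE.
have q'E i : (i <= n)%N -> q^`()`_i = fps_coef (fps_deriv g) i.
  by move=> le_in; rewrite coef_deriv qE.
have pE' i : (i <= n)%N -> p`_i = fps_coef f i by move/leqW; apply: pE.
have qE' i : (i <= n)%N -> q`_i = fps_coef g i by move/leqW; apply: qE.
rewrite derivM coefD fps_coefD.
by congr (_ + _); [apply: (coef_fps_mul p'E qE')|apply: (coef_fps_mul pE' q'E)].
Qed.

Lemma fps_deriv_poly (p : {poly K}) :
  fps_deriv (fps_of_poly p) = fps_of_poly p^`().
Proof. by apply: fpsP => n; rewrite fps_coef_poly coef_deriv. Qed.

Lemma fps_derivD f g : fps_deriv (f + g) = fps_deriv f + fps_deriv g.
Proof. by apply: fpsP => n /=; rewrite mulrnDl. Qed.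

(** The chain rule; [map_poly (@deriv K) P] is the partial derivative in x. *)
Lemma fps_deriv_subst P f :
  fps_deriv (subst P f) =
  subst (map_poly (@deriv K) P) f + subst P^`() f * fps_deriv f.
Proof.
elim/poly_ind: P => [|P c IH].
  rewrite !(subst0, rmorph0, raddf0) mul0r addr0.
  by apply: fpsP => n /=; rewrite mul0rn.
have -> : map_poly (@deriv K) (P * 'X + c%:P) =
          map_poly (@deriv K) P * 'X + (c^`())%:P.
  apply/polyP => i; rewrite coef_map !coefD !coefMX !coefC coef_map /=.
  by case: i => [|i] /=; rewrite ?add0r ?addr0.
rewrite derivD derivM derivX mulr1 derivC addr0 !substD !substM !substX !substC.
rewrite fps_derivD fps_derivM IH fps_deriv_poly !mulrDl -!addrA; congr (_ + _).
by rewrite [RHS]addrC -addrA mulrAC.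
Qed.

End Derivation.

Section Separable.
Variable K : closedFieldType.
Implicit Types (f g : fps K) (P : {poly {poly K}}).

(** The coefficients have p-th roots in K, and Frobenius is additive. *)
Lemma pth_power P p : p \in [pchar K] ->
  (forall i j, P`_j`_i != 0 -> (p %| i)%N && (p %| j)%N) ->
  exists G, P = G ^+ p.
Proof.
move=> pK H; have pr := pcharf_prime pK.
have p0 : (0 < p)%N := prime_gt0 pr.
have pnat2 : [pchar {poly {poly K}}].-nat p.
  by rewrite pnatE // !pchar_poly.
have sum_pth I (r : seq I) (F : I -> {poly {poly K}}) :
    (forall i, exists G, F i = G ^+ p) -> exists G, \sum_(i <- r) F i = G ^+ p.
  move=> HF; elim: r => [|i r [G IH]].
    by exists 0; rewrite big_nil expr0n gtn_eqF.
  have [G' E] := HF i; exists (G' + G).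
  by rewrite big_cons E IH exprDn_pchar.
have -> : P = \sum_(j < size P) \sum_(i < size P`_j)
    ((P`_j`_i)%:P%:P * ('X^i)%:P * 'X^j).
  rewrite -{1}[P]coefK poly_def; apply: eq_bigr => j _.
  rewrite -mul_polyC -mulr_suml; congr (_ * _).
  rewrite -{1}[P`_j]coefK poly_def rmorph_sum /=; apply: eq_bigr => i _.
  by rewrite -mul_polyC rmorphM.
apply: (sum_pth) => j; apply: (sum_pth) => i.
have [->|c0] := eqVneq P`_j`_i 0.
  by exists 0; rewrite !mul0r expr0n gtn_eqF.
have /andP[pi pj] := H _ _ c0.
have [y Ey] : exists y, y ^+ p = P`_j`_i.
  have /closed_rootP[y] : size ('X^p - (P`_j`_i)%:P) != 1 by rewrite size_XnsubC //; case: (p) p0.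
  by rewrite /root !hornerE subr_eq0 => /eqP; exists y.
exists (y%:P%:P * ('X^(i %/ p))%:P * 'X^(j %/ p)).
rewrite !exprMn -!rmorphXn /= Ey -!exprM !divnK //.
Qed.

(** If P_T vanished at f, then P_T = 0 for degree reasons; differentiating
    P(x,f) = 0 would give P_x(x,f) = 0, hence P_x = 0 too. So either P is
    constant, or K has characteristic p > 0 and P is a p-th power G^p; then G
    vanishes at f as well and is a multiple of P, which is absurd. *)
Lemma minpoly_separable f P : algebraic f -> is_minpoly f P ->
  subst P^`() f != 0.
Proof.
move=> fa fP; apply/eqP => P'f.
have P0 := is_minpoly_neq0 fa fP; have Pf := is_minpoly_root fP.
have PT : P^`() = 0.
  have [R E] := (fP _).1 P'f; apply/eqP; apply/negPn/negP => P'0.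
  have := size_dvd_le E P'0; rewrite leqNgt lt_size_deriv //.
have Px : map_poly (@deriv K) P = 0.
  have : subst (map_poly (@deriv K) P) f = 0.
    have := fps_deriv_subst P f; rewrite Pf PT subst0 mul0r addr0 => <-.
    by apply: fpsP => n /=; rewrite mul0rn.
  move=> /fP[R E]; apply/eqP; apply/negPn/negP => P'0.
  have := sizeY_dvd_le E P'0; rewrite leqNgt => /negP; apply.
  have sY := sizeY_gt0 P0; rewrite -(prednK sY) ltnS; apply/sizeY_le => j.
  rewrite coef_map /=; have := (sizeY_le P (sizeY P)).1 (leqnn _) j.
  have [->|Pj0] := eqVneq P`_j 0; first by rewrite deriv0 size_poly0.
  by move=> le; rewrite -ltnS (leq_trans (lt_size_deriv Pj0)) // prednK.
have cj i j : P`_j`_i *+ j = 0.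
  case: j => [|j]; first by rewrite mulr0n.
  by rewrite -coefMn -coef_deriv PT !coef0.
have ci i j : P`_j`_i *+ i = 0.
  case: i => [|i]; first by rewrite mulr0n.
  by rewrite -coef_deriv -coef_map Px !coef0.
have [_ Pc _] := is_minpoly_irred fa fP.
have [p pK] : exists p, p \in [pchar K].
  apply/not_existsP => noK; apply: Pc; exists P`_0`_0.
  have noZ (n : nat) (c : K) : n != 0%N -> c *+ n = 0 -> c = 0.
    rewrite -lt0n -mulr_natr => n0 /eqP; rewrite mulf_eq0 => /orP[/eqP//|].
    by move/(natf0_pchar n0) => [p /noK].
  apply/polyP => j; apply/polyP => i; rewrite !coefC.
  case: eqP => [->|/eqP j0]; rewrite !(coefC, coef0); last by rewrite (noZ j _ j0 (cj i j)) if_same.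
  by case: eqP => [->//|/eqP i0]; exact: (noZ i _ i0 (ci i 0%N)).
have [G E] : exists G, P = G ^+ p.
  apply: (pth_power pK) => i j c0; rewrite !(dvdn_pcharf pK).
  have := cj i j; have := ci i j.
  rewrite -!(mulr_natr P`_j`_i) => /eqP + /eqP.
  by rewrite !mulf_eq0 (negPf c0) /= => -> ->.
have [p' Ep] : exists p', p = p'.+2.
  by exists p.-2; case: (p) (prime_gt1 (pcharf_prime pK)) => [|[]].
have : subst G f = 0 by apply: (@fps_expf_eq0 _ _ p); rewrite -substXn -E.
move=> /fP[R EG]; have G0 : G != 0.
  by apply: contraNneq P0 => G0; rewrite E G0 expr0n Ep.
have : G * (R * G ^+ p') = 1.
  apply: (mulfI G0); rewrite mulr1 [RHS]EG E Ep !exprS.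
  by rewrite [G * (R * _)]mulrCA; exact: mulrCA.
move=> /polyXY_unit[a a0 Ea]; apply: Pc; exists (a ^+ p).
by rewrite E Ea -!rmorphXn.
Qed.

Lemma size_det_le n h (A : 'M[{poly K}]_n) :
  (forall i j, (size (A i j) <= h.+1)%N) -> (size (\det A) <= (n * h).+1)%N.
Proof.
move=> sA; apply: (leq_trans (size_sum _ _ _)); apply/bigmax_leqP => s _.
rewrite size_Msign.
have sP (I : Type) (r : seq I) (F : I -> {poly K}) :
    (forall i, (size (F i) <= h.+1)%N) ->
    (size (\prod_(i <- r) F i)%R <= (size r * h).+1)%N.
  move=> sF; elim: r => [|i r IH]; first by rewrite big_nil size_poly1.
  rewrite big_cons (leq_trans (size_polyMleq _ _)) //.
  rewrite -subn1 leq_subLR mulSn add1n -addnS -addSn.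
  exact: leq_add (sF i) IH.
apply: (leq_trans (sP _ _ _ _)) => [i|]; first exact: sA.
by rewrite /index_enum -enumT size_enum_ord.
Qed.

Lemma minpoly_size_gt1 f P : algebraic f -> is_minpoly f P -> (1 < size P)%N.
Proof.
move=> fa fP; have P0 := is_minpoly_neq0 fa fP; rewrite ltnNge; apply/negP => s1.
have := is_minpoly_root fP; rewrite (size1_polyC s1) substC.
move=> E; case/eqP: P0; rewrite (size1_polyC s1); congr (_%:P).
by apply: (@fps_of_poly_inj K); rewrite E rmorph0.
Qed.

(** The resultant of P and P_T is V P_T at T = f for some V, so that its order
    bounds e; it is a determinant of size at most 2d with entries of degree at
    most h. It is not zero: a common factor of P and P_T cannot vanish at f by
    separability, so its cofactor in P would, but it has too small a degree. *)
Lemma minpoly_order_bound f P d h e : algebraic f -> is_minpoly f P ->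
  (size P <= d.+1)%N -> (sizeY P <= h.+1)%N -> has_order (subst P^`() f) e ->
  (e <= 2 * d * h)%N.
Proof.
move=> fa fP sP sYP oe; have P0 := is_minpoly_neq0 fa fP.
have s1 := minpoly_size_gt1 fa fP; have Pf := is_minpoly_root fP.
have d0 : (0 < d)%N by rewrite -ltnS (leq_trans s1).
have cP j : (size (P`_j)%R <= h.+1)%N by apply: (sizeY_le P h.+1).1.
have cP' j : (size (P^`()`_j)%R <= h.+1)%N.
  rewrite coef_deriv (leq_trans _ (cP j.+1)) // -scaler_nat size_scale_leq //.
have bound (p : {poly K}) B : subst B f * subst P^`() f = fps_of_poly p ->
    p != 0 -> (size p <= (2 * d * h).+1)%N -> (e <= 2 * d * h)%N.
  move=> E p0 sp; have [B0|/has_order_ex[b ob]] := eqVneq (subst B f) 0.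
    move: E p0; rewrite B0 mul0r -(rmorph0 (@fps_of_poly K)).
    by move=> /fps_of_poly_inj <-; rewrite eqxx.
  have [] := has_orderM ob oe; rewrite E fps_coef_poly => nz _.
  rewrite -ltnS (leq_trans _ sp) // (leq_ltn_trans (leq_addl b e)) //.
  by rewrite ltnNge; apply: contra nz => /(nth_default 0) ->.
have P'0 : P^`() != 0.
  by apply/eqP => E; have [] := oe; rewrite E subst0 eqxx.
(* The resultant is only used when P_T depends on T. *)
have [s1'|s1'] := leqP (size P^`()) 1.
  apply: (bound (P^`()`_0) 1).
  - by rewrite subst1 mul1r {1}(size1_polyC s1') substC.
  - by rewrite -polyC_eq0 -size1_polyC.
  - by rewrite (leq_trans (cP' 0%N)) // ltnS leq_pmull // muln_gt0.
have [[U V] _ /= E] := resultant_in_ideal s1 s1'.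
apply: (bound (resultant P P^`()) V).
- have := congr1 (fun A => subst A f) E.
  by rewrite /= substC substD !substM Pf mulr0 add0r.
- rewrite resultant_eq0 -leqNgt leqNgt; apply/negP => sG.
  set G := Pdiv.Idomain.gcdp _ _ in sG.
  have /Pdiv.Idomain.dvdpP[[c R] /= c0 EG] := Pdiv.Idomain.dvdp_gcdl P P^`().
  have /Pdiv.Idomain.dvdpP[[c' R'] /= c'0 EG'] := Pdiv.Idomain.dvdp_gcdr P P^`().
  have cn (a : {poly K}) : a != 0 -> fps_of_poly a <> 0.
    by move=> a0 /esym; rewrite -(rmorph0 (@fps_of_poly K)) => /fps_of_poly_inj E0; rewrite E0 eqxx in a0.
  have : subst R f * subst G f = 0 by rewrite -substM -EG substZ Pf mulr0.
  case/fps_mulf_eq0 => [Rf|Gf]; last first.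
    have : fps_of_poly c' * subst P^`() f = 0 by rewrite -substZ EG' substM Gf mulr0.
    case/fps_mulf_eq0 => [/(cn _ c'0)//|E']; have := minpoly_separable fa fP.
    by rewrite E' eqxx.
  have [S ES] := (fP R).1 Rf.
  have R0 : R != 0.
    apply: contraNneq P0 => R0; move: EG; rewrite R0 mul0r => /eqP.
    by rewrite scale_poly_eq0 (negPf c0).
  have G0 : G != 0 by rewrite -size_poly_gt0 (leq_trans _ sG).
  have := size_dvd_le ES R0; rewrite leqNgt -(size_scale P c0) EG size_mul //.
  by rewrite -subn1 -addnBA ?(ltnW sG) // -[X in (X < _)%N]addn0 ltn_add2l subn_gt0 sG.
- apply: (leq_trans (size_det_le (h := h) _)) => [i j|].
    rewrite Sylvester_mxE.
    by case: (fintype.split i) => k; case: (k <= j)%N; rewrite ?mulr1n ?mulr0n ?size_poly0.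
  rewrite ltnS leq_mul2r mul2n -addnn; apply/orP; right.
  have sP1 : ((size P).-1 <= d)%N by rewrite -ltnS prednK // (ltn_trans _ s1).
  rewrite leq_add // (leq_trans _ sP1) // -!subn1 leq_sub2r //.
  exact: ltnW (lt_size_deriv P0).
Qed.

End Separable.

(** * Coordinates on spaces of polynomials in x and T *)

Lemma rVpoly_default (R : nzRingType) n (v : 'rV[R]_n) k :
  (n <= k)%N -> (rVpoly v)`_k = 0.
Proof. by move=> le; rewrite coef_rVpoly; case: insubP => // i; rewrite ltnNge le. Qed.

Section Coordinates.
Variable R : comNzRingType.

Definition low_poly e (a : 'rV[R]_e) : {poly R} := \sum_(i < e) a 0 i *: 'X^(i.+1).

(** The polynomial f0 + x^e T, where f0 has the coefficients a. *)
Definition shift e (a : 'rV[R]_e) : {poly {poly R}} :=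
  (low_poly a)%:P + ('X^e)%:P * 'X.

Definition num_bip d h := (d.+1 * h.+1)%N.

(** Polynomials of degree at most d in T and h in x, numbered as in
    [poly_coords] but keeping all monomials. *)
Definition bipoly d h (p : 'rV[R]_(num_bip d h)) : {poly {poly R}} :=
  \poly_(j < d.+1) \poly_(i < h.+1) (rVpoly p)`_(i * d.+1 + j).

Definition bicoords d h (P : {poly {poly R}}) : 'rV[R]_(num_bip d h) :=
  \row_k P`_(k %% d.+1)`_(k %/ d.+1).

(** The polynomial with coordinates c in the sense of [poly_coords]: the
    monomials 1 and T, of numbers 0 and 1, get the coefficients 0 and 1. *)
Definition nform d n (c : 'rV[R]_(dimI d (Posz n))) : {poly {poly R}} :=
  \poly_(j < d.+1) \poly_(i < n.+1)
    let k := (i * d.+1 + j)%N in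
    if k == 0%N then 0 else if k == 1%N then 1 else (rVpoly c)`_(k - 2).

(** The equation that relates, for w = (f0, f1), the polynomial P of f and
    the normal form of f1. *)
Definition reparam_eq d h e n (p : 'rV[R]_(num_bip d h))
    (w : 'rV[R]_(e + dimI d (Posz n))) : {poly {poly R}} :=
  bipoly p \Po shift (lsubmx w) - ('X^(2 * e))%:P * nform (rsubmx w).

Lemma coef_bipoly d h p i j : (@bipoly d h p)`_j`_i =
  if (j < d.+1)%N && (i < h.+1)%N then (rVpoly p)`_(i * d.+1 + j) else 0.
Proof.
by rewrite coef_poly; case: ltnP => _ /=; rewrite ?coef0 // coef_poly.
Qed.

Lemma coef_nform d n c i j : (@nform d n c)`_j`_i =
  if (j < d.+1)%N && (i < n.+1)%N then
    let k := (i * d.+1 + j)%N in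
    if k == 0%N then 0 else if k == 1%N then 1 else (rVpoly c)`_(k - 2)
  else 0.
Proof.
by rewrite coef_poly; case: ltnP => _ /=; rewrite ?coef0 // coef_poly.
Qed.

Lemma size_bipoly d h p : (size (@bipoly d h p) <= d.+1)%N.
Proof. exact: size_poly. Qed.

Lemma size_nform d n c : (size (@nform d n c) <= d.+1)%N.
Proof. exact: size_poly. Qed.

Lemma coef_bicoords d h (P : {poly {poly R}}) i j : (j < d.+1)%N -> (i < h.+1)%N ->
  (rVpoly (bicoords d h P))`_(i * d.+1 + j) = P`_j`_i.
Proof.
move=> ltj lti; have lt : (i * d.+1 + j < num_bip d h)%N.
  by rewrite /num_bip; nia.
rewrite -[(i * _ + j)%N]/(val (Ordinal lt)) coef_rVpoly_ord mxE /=.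
by rewrite divnMDl // modnMDl divn_small // addn0 modn_small.
Qed.

Lemma poly2P (P Q : {poly {poly R}}) : (forall i j, P`_j`_i = Q`_j`_i) -> P = Q.
Proof. by move=> E; apply/polyP => j; apply/polyP => i. Qed.

Lemma bicoordsK d h (P : {poly {poly R}}) :
  (size P <= d.+1)%N -> (sizeY P <= h.+1)%N -> bipoly (bicoords d h P) = P.
Proof.
move=> sP sYP; apply: poly2P => i j; rewrite coef_bipoly.
have [ltj|lej] := ltnP j d.+1; last first.
  by rewrite [P`_j]nth_default ?coef0 // (leq_trans sP).
have [lti|lei] := ltnP i h.+1; first by rewrite coef_bicoords.
rewrite /= [RHS]nth_default // (leq_trans _ lei) // (leq_trans _ sYP) //.
exact: max_size_coefXY.
Qed.

End Coordinates.

Section MapCoordinates.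
Variables (R S : comNzRingType) (phi : {rmorphism R -> S}).

Lemma coef_map_rVpoly n (p : 'rV[R]_n) k :
  (rVpoly (map_mx phi p))`_k = phi (rVpoly p)`_k.
Proof. by rewrite -map_rVpoly coef_map. Qed.

Lemma map_low_poly e (a : 'rV[R]_e) :
  map_poly phi (low_poly a) = low_poly (map_mx phi a).
Proof.
rewrite rmorph_sum /=; apply: eq_bigr => i _.
by rewrite map_polyZ map_polyXn mxE.
Qed.

Lemma map_shift e (a : 'rV[R]_e) :
  map_poly (map_poly phi) (shift a) = shift (map_mx phi a).
Proof.
rewrite rmorphD rmorphM /= !map_polyC /= map_polyX.
by rewrite map_low_poly map_polyXn.
Qed.

Lemma map_bipoly d h (p : 'rV[R]_(num_bip d h)) :
  map_poly (map_poly phi) (bipoly p) = bipoly (map_mx phi p).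
Proof.
apply: poly2P => i j; rewrite !coef_map /= !coef_bipoly coef_map_rVpoly.
by case: ifP; rewrite ?rmorph0.
Qed.

Lemma map_nform d n (c : 'rV[R]_(dimI d (Posz n))) :
  map_poly (map_poly phi) (nform c) = nform (map_mx phi c).
Proof.
apply: poly2P => i j; rewrite !coef_map /= !coef_nform /= coef_map_rVpoly.
by do 3 (case: ifP; rewrite ?rmorph0 ?rmorph1 //).
Qed.

Lemma map_reparam_eq d h e n (p : 'rV[R]_(num_bip d h))
    (w : 'rV[R]_(e + dimI d (Posz n))) :
  map_poly (map_poly phi) (reparam_eq p w) = reparam_eq (map_mx phi p) (map_mx phi w).
Proof.
rewrite /reparam_eq rmorphB rmorphM /= map_comp_poly map_bipoly map_shift map_nform.
by rewrite map_polyC /= map_polyXn map_lsubmx map_rsubmx.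
Qed.

End MapCoordinates.

Section NormalForm.
Variable K : fieldType.
Implicit Types (P Q A B : {poly {poly K}}).

Lemma sizeY_bipoly d h p : (sizeY (@bipoly K d h p) <= h.+1)%N.
Proof.
apply/sizeY_le => j; rewrite coef_poly; case: ltnP => _; rewrite ?size_poly0 //.
Qed.

Lemma sizeY_nform d n c : (sizeY (@nform K d n c) <= n.+1)%N.
Proof.
apply/sizeY_le => j; rewrite coef_poly; case: ltnP => _; rewrite ?size_poly0 //.
Qed.

Lemma nform00 d n c : (@nform K d n c)`_0`_0 = 0.
Proof. by rewrite coef_nform mul0n addn0. Qed.

Lemma nform10 d n c : (0 < d)%N -> (@nform K d n c)`_1`_0 = 1.
Proof. by move=> d0; rewrite coef_nform mul0n add0n ltnS d0. Qed.

Lemma dimI_ltn d n i j : (0 < d)%N -> (j < d.+1)%N -> (i < n.+1)%N ->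
  (1 < i * d.+1 + j)%N -> (i * d.+1 + j - 2 < dimI d (Posz n))%N.
Proof.
move=> d0 ltj lti lt1; rewrite /dimI.
nia.
Qed.

Lemma nform_coords d n P : (0 < d)%N ->
  (size P <= d.+1)%N -> (sizeY P <= n.+1)%N -> P`_0`_0 = 0 -> P`_1`_0 = 1 ->
  nform (poly_coords d (Posz n) P) = P.
Proof.
move=> d0 sP sYP P0 P1; apply: poly2P => i j; rewrite coef_nform.
have [ltj|lej] := ltnP j d.+1; last first.
  by rewrite [P`_j]nth_default ?coef0 // (leq_trans sP).
have [lti|lei] := ltnP i n.+1; last first.
  rewrite /= [RHS]nth_default // (leq_trans _ lei) // (leq_trans _ sYP) //.
  exact: max_size_coefXY.
rewrite /=; have [E|k0] := eqVneq (i * d.+1 + j)%N 0%N.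
  by move/eqP: E; rewrite addn_eq0 muln_eq0 orbF => /andP[/eqP-> /eqP->].
have [E|k1] := eqVneq (i * d.+1 + j)%N 1%N.
  case: i E {lti k0} => [|i]; first by rewrite add0n => ->.
  by rewrite mulSn; case: (d) d0.
have lt1 : (1 < i * d.+1 + j)%N by case: (i * _ + j)%N k0 k1 => [|[]].
have lt := dimI_ltn d0 ltj lti lt1.
rewrite -[X in _`_X]/(val (Ordinal lt)) coef_rVpoly_ord mxE /= subnK //.
by rewrite divnMDl // modnMDl divn_small // addn0 modn_small.
Qed.

Lemma poly_coords_nform d n c : (0 < d)%N ->
  poly_coords d (Posz n) (@nform K d n c) = c.
Proof.
move=> d0; apply/rowP => k; rewrite mxE coef_nform ltn_pmod // -divn_eq.
rewrite addn2 /= subn2 /= -[in RHS](coef_rVpoly_ord c) ltn_divLR //.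
suff -> : (k.+2 < n.+1 * d.+1)%N by [].
by have := ltn_ord k; rewrite /dimI; nia.
Qed.

End NormalForm.

(** * The substitution T := f0 + x^e T *)

Section Taylor.
Variable R : comNzRingType.

Lemma taylor1 (P : {poly R}) (a : R) : exists S, P = P.[a]%:P + ('X - a%:P) * S.
Proof.
elim/poly_ind: P => [|P c [S E]]; first by exists 0; rewrite horner0 mulr0 addr0.
exists (P.[a]%:P + S * 'X); rewrite {1}E hornerD hornerM hornerX hornerC.
by rewrite polyCD polyCM; ring.
Qed.

(** The second order Taylor formula, with a polynomial remainder. *)
Lemma taylor2 (P : {poly R}) (a : R) : exists S,
  P = P.[a]%:P + P^`().[a]%:P * ('X - a%:P) + ('X - a%:P) ^+ 2 * S.
Proof.
have [S E] := taylor1 P a; have [S' E'] := taylor1 S a.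
exists S'; suff <- : S.[a] = P^`().[a] by rewrite {1}E {1}E'; ring.
by rewrite E derivD derivC add0r derivM derivXsubC mul1r !hornerE subrr mul0r addr0.
Qed.

End Taylor.

Section Shift.
Variable K : fieldType.
Implicit Types (f : fps K) (P Q A B : {poly {poly K}}).

Lemma low_polyE e (a : 'rV[K]_e) : poly0_of_coefs a = low_poly a. Proof. by []. Qed.

Lemma coef0_low_poly e (a : 'rV[K]_e) : (low_poly a)`_0 = 0.
Proof. by rewrite coef_sum big1 // => i _; rewrite coefZ coefXn mulr0. Qed.

Lemma size_low_poly e (a : 'rV[K]_e) : (size (low_poly a) <= e.+1)%N.
Proof.
apply: (leq_trans (size_sum _ _ _)); apply/bigmax_leqP => i _.
by rewrite (leq_trans (size_scale_leq _ _)) // size_polyXn ltnS ltn_ord.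
Qed.

Lemma subst_shift e (a : 'rV[K]_e) f :
  subst (shift a) f = fps_of_poly (low_poly a) + fps_of_poly 'X^e * f.
Proof. by rewrite substD substM !substC substX. Qed.

Lemma size_linear (g : {poly K}) e : size (g%:P + ('X^e)%:P * 'X) = 2.
Proof.
have X0 : ('X^e : {poly K}) != 0 by rewrite monic_neq0 ?monicXn.
rewrite addrC size_polyDl mul_polyC size_scale ?size_polyX //.
by rewrite size_polyC; case: eqP.
Qed.

Lemma size_shift e (a : 'rV[K]_e) : size (shift a) = 2.
Proof. exact: size_linear. Qed.

Lemma sizeYD_le P Q n : (sizeY P <= n)%N -> (sizeY Q <= n)%N ->
  (sizeY (P + Q)%R <= n)%N.
Proof.
rewrite !sizeYE rmorphD /= => sP sQ; apply: (leq_trans (size_polyD _ _)).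
by rewrite geq_max sP.
Qed.

Lemma sizeYM_le P Q m n : (sizeY P <= m.+1)%N -> (sizeY Q <= n.+1)%N ->
  (sizeY (P * Q)%R <= (m + n).+1)%N.
Proof.
rewrite !sizeYE rmorphM /= => sP sQ; apply: (leq_trans (size_polyMleq _ _)).
by rewrite -subn1 leq_subLR add1n -addnS -addSn leq_add.
Qed.

Lemma sizeY_shift e (a : 'rV[K]_e) : (sizeY (shift a) <= e.+1)%N.
Proof.
apply: sizeYD_le; first by rewrite sizeY_polyC size_low_poly.
by rewrite sizeY_mulX sizeY_polyC size_polyXn.
Qed.

Lemma sizeY_comp_shift e (a : 'rV[K]_e) P d h :
  (size P <= d.+1)%N -> (sizeY P <= h.+1)%N ->
  (sizeY (P \Po shift a) <= (h + e * d).+1)%N.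
Proof.
move=> sP sYP; rewrite comp_polyE.
have sYn n : (sizeY (shift a ^+ n)%R <= (e * n).+1)%N.
  elim: n => [|n IH]; first by rewrite expr0 sizeYE rmorph1 size_poly1.
  by rewrite exprS mulnS sizeYM_le // sizeY_shift.
apply: (big_ind (fun A => (sizeY A <= (h + e * d).+1)%N)) => [|A B|j _].
- by rewrite sizeYE rmorph0 size_poly0.
- exact: sizeYD_le.
rewrite -mul_polyC; have := @sizeYM_le (P`_j)%:P (shift a ^+ j) h (e * j).
rewrite sizeY_polyC => /(_ _ (sYn j)) H.
apply: (leq_trans (H _)); first by apply: leq_trans sYP; apply: max_size_coefXY.
have := leq_trans (ltn_ord j) sP; nia.
Qed.

Lemma comp_shiftB e (a : 'rV[K]_e) :
  ('X - (low_poly a)%:P) \Po shift a = ('X^e)%:P * 'X.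
Proof. by rewrite comp_polyB comp_polyX comp_polyC /shift addrAC subrr add0r. Qed.

(** A polynomial in T becomes, up to a power of x, a polynomial in
    f0 + x^e T. *)
Lemma shift_clear e (a : 'rV[K]_e) P : exists N A, ('X^N)%:P * P = A \Po shift a.
Proof.
elim/poly_ind: P => [|P c [N [A E]]].
  by exists 0%N, 0; rewrite mulr0 comp_poly0.
exists (N + e)%N, (A * ('X - (low_poly a)%:P) + ('X^(N + e) * c)%:P).
rewrite comp_polyD comp_polyM comp_polyC comp_shiftB -E.
by rewrite exprD !polyCM; ring.
Qed.

Lemma horner_eval0_neq0 P i : P`_i`_0 != 0 -> map_poly (horner_eval 0) P != 0.
Proof.
move=> c0; apply/eqP => /(congr1 (fun p : {poly K} => p`_i)).
by rewrite coef_map coef0 /= /horner_eval horner_coef0; apply/eqP.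
Qed.

Lemma cancel_Xn m P Q A : map_poly (horner_eval 0) P != 0 ->
  ('X^m)%:P * Q = A * P -> exists A', Q = A' * P.
Proof.
move=> P0; elim: m A => [|m IH] A E.
  by exists A; rewrite -E expr0 mul1r.
have [|A' [_ E']] := @cancel_inner K 0 P (('X^m)%:P * Q) A P0.
  by rewrite subr0 mulrA -polyCM -exprS.
exact: IH E'.
Qed.

(** The substitution maps the minimal polynomial of f0 + x^e f1 to that of
    f1, because x does not divide Q and is prime. *)
Lemma is_minpoly_shift e (a : 'rV[K]_e) f1 P Q m i :
  is_minpoly (fps_of_poly (low_poly a) + fps_of_poly 'X^e * f1) P ->
  P \Po shift a = ('X^m)%:P * Q -> Q`_i`_0 != 0 -> is_minpoly f1 Q.
Proof.
move=> fP E Q0; have fE := subst_shift a f1.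
have Qf1 : subst Q f1 = 0.
  have : subst P (subst (shift a) f1) = 0.
    by rewrite fE; apply/fP; exists 1; rewrite mul1r.
  rewrite -subst_comp E substM substC => H; apply: (@fpsXn_inj _ m).
  by rewrite H mulr0.
move=> G; split=> [Gf1|[A ->]]; last by rewrite substM Qf1 mulr0.
have [N [A EA]] := shift_clear a G.
have : subst A (subst (shift a) f1) = 0.
  by rewrite -subst_comp -EA substM Gf1 mulr0.
rewrite fE => /fP[B EB].
apply: (@cancel_Xn N Q G ((B \Po shift a) * ('X^m)%:P)).
  exact: horner_eval0_neq0 Q0.
by rewrite EA EB comp_polyM E mulrA.
Qed.

Lemma poly_divXn m (p : {poly K}) : (forall i, (i < m)%N -> p`_i = 0) ->
  exists q, p = 'X^m * q.
Proof.
move=> p0; exists (\poly_(i < size p) p`_(i + m)).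
apply/polyP => i; rewrite coefXnM; case: ltnP => [/p0//|le_mi].
rewrite coef_poly subnK //; case: ltnP => // le.
by rewrite nth_default // (leq_trans le) // leq_subr.
Qed.

(** Taylor expansion at f0: as P'(f0) has order e and P(f0) order at least
    2e + 1, exactly x^(2e) can be factored out. *)
Lemma shift_factor e f P :
  fps_coef f 0 = 0 -> subst P f = 0 -> has_order (subst P^`() f) e ->
  exists Q, [/\ P \Po shift (phi0 e f) = ('X^(2 * e))%:P * Q,
                Q`_0`_0 = 0 & Q`_1`_0 != 0].
Proof.
move=> f0 Pf [oe o0]; set a := phi0 e f; set g := phi1 e f.
have [S E] := taylor2 P (low_poly a).
have [S1 E1] := taylor1 P^`() (low_poly a).
have [g' Eg] : exists g', g = fps_of_poly 'X * g'.
  exists (Fps (fun n => fps_coef g (n + 1))).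
  by rewrite -['X]expr1; apply: fps_divXn => [[|//]].
have fB : subst ('X - (low_poly a)%:P) f = fps_of_poly 'X^e * g.
  by rewrite substB substX substC {1}(phi_decomp e f0) low_polyE addrC addKr.
have P'E : subst P^`() f = fps_of_poly P^`().[low_poly a]
    + fps_of_poly 'X^(e.+1) * (g' * subst S1 f).
  rewrite {1}E1 substD substC substM fB Eg exprSr rmorphM /=.
  by congr (_ + _); rewrite !mulrA.
have coefP' i : (i <= e)%N -> (P^`().[low_poly a])`_i = fps_coef (subst P^`() f) i.
  by move=> le; rewrite P'E fps_coefD fps_coefXnM ltnS le addr0.
have [B EB] : exists B : {poly K}, P^`().[low_poly a] = 'X^e * B.
  by apply: poly_divXn => i lt; rewrite coefP' ?o0 // ltnW.
have B0 : B`_0 != 0.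
  by move: oe; rewrite -coefP' // EB coefXnM ltnn subnn.
have X2e : 'X^((2 * e).+1) = 'X * ('X^e * 'X^e) :> {poly K}.
  by rewrite exprS mul2n -addnn exprD.
(* P(f0) = - P'(f0) x^e f1 - x^(2e) f1^2 S(f), and x divides f1. *)
have [A EA] : exists A : {poly K}, P.[low_poly a] = 'X^((2 * e).+1) * A.
  apply: poly_divXn => i lt; move: Pf.
  rewrite {1}E 2!substD 2!substM substXn 2!substC fB EB Eg.
  set s := subst S f; rewrite !rmorphM /= => /eqP.
  rewrite -addrA addr_eq0 => /eqP H.
  rewrite -fps_coef_poly H.
  have -> : fps_of_poly 'X^e * fps_of_poly B * (fps_of_poly 'X^e * (fps_of_poly 'X * g'))
     + (fps_of_poly 'X^e * (fps_of_poly 'X * g')) ^+ 2 * s =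
     fps_of_poly 'X^((2 * e).+1) * (fps_of_poly B * g' + fps_of_poly 'X * g' ^+ 2 * s).
    by rewrite X2e !rmorphM /=; ring.
  by rewrite fps_coefN fps_coefXnM lt oppr0.
exists (('X * A)%:P + B%:P * 'X + 'X ^+ 2 * (S \Po shift a)); split.
- rewrite {1}E 2!comp_polyD 2!comp_polyM 2!comp_polyC rmorphXn /= comp_shiftB.
  by rewrite EA EB X2e mul2n -addnn exprD !polyCM; ring.
- by rewrite !(coefD, coefXnM, coefC, coefMX, coefXM) /= ?coef0 !addr0.
- by rewrite !(coefD, coefXnM, coefC, coefMX, coefXM) /= ?coef0 add0r addr0.
Qed.

End Shift.

(** * The strata in terms of coefficients *)

Section Strata.
Variable K : closedFieldType.
Implicit Types (f : fps K) (P Q A B : {poly {poly K}}).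

Lemma is_minpoly_minpoly f P : P != 0 -> is_minpoly f P ->
  exists2 u, u != 0 & minpoly f = u%:P%:P * P.
Proof.
move=> P0 fP; have fa := is_minpoly_algebraic P0 fP.
exact: is_minpoly_uniq fa fP (minpolyP fa).
Qed.

Lemma constXYM_size u P : u != 0 -> size (u%:P%:P * P) = size P.
Proof. by move=> u0; rewrite mul_polyC size_scale ?polyC_eq0. Qed.

Lemma constXYM_sizeY u P : u != 0 -> P != 0 -> sizeY (u%:P%:P * P) = sizeY P.
Proof.
by move=> u0 P0; rewrite sizeYM ?polyC_eq0 // sizeY_polyC size_polyC u0.
Qed.

Lemma coef_constXYM (u : K) P i j : (u%:P%:P * P)`_j`_i = u * P`_j`_i.
Proof. by rewrite mul_polyC coefZ coefCM. Qed.

Lemma normal_minpolyE f P : is_minpoly f P -> P`_1`_0 = 1 -> normal_minpoly f = P.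
Proof.
move=> fP P1; have P0 : P != 0.
  by apply: contra_eq_neq P1 => ->; rewrite !coef0 eq_sym oner_eq0.
have [u u0 E] := is_minpoly_minpoly P0 fP.
rewrite /normal_minpoly E coef_constXYM P1 mulr1 -mul_polyC mulrA -!rmorphM /=.
by rewrite mulVf // mul1r.
Qed.

Lemma has_order_scale (u : K) (g : fps K) e : u != 0 ->
  has_order (fps_of_poly u%:P * g) e <-> has_order g e.
Proof.
move=> u0; split=> -[oe o0]; split.
- by move: oe; rewrite fps_coefCM mulf_eq0 (negPf u0).
- move=> i /o0; rewrite fps_coefCM => /eqP; rewrite mulf_eq0 (negPf u0) /=.
  by move/eqP.
- by rewrite fps_coefCM mulf_neq0.
- by move=> i /o0; rewrite fps_coefCM => ->; rewrite mulr0.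
Qed.

(** The conditions that define A(d,h,e) can be tested on any generator of the
    kernel. *)
Lemma algAP d h e f P : P != 0 -> is_minpoly f P ->
  algA K d (Posz h) e f <->
  [/\ fps_coef f 0 = 0, (size P <= d.+1)%N, (sizeY P <= h.+1)%N &
      has_order (subst P^`() f) e].
Proof.
move=> P0 fP; have fa := is_minpoly_algebraic P0 fP.
have [u u0 E] := is_minpoly_minpoly P0 fP.
have oE : has_order (subst (minpoly f)^`() f) e <-> has_order (subst P^`() f) e.
  by rewrite E mul_polyC derivZ substZ has_order_scale.
have sE (m n : nat) : (0 < m)%N -> (m.-1 <= n)%N = (m <= n.+1)%N by case: m.
have dE : (adegree f <= d)%N = (size P <= d.+1)%N.
  by rewrite /adegree E constXYM_size // sE // size_poly_gt0.
have hE : (Posz (aheight f) <= Posz h :> int)%R = (sizeY P <= h.+1)%N.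
  by rewrite lez_nat /aheight E constXYM_sizeY // sE // sizeY_gt0.
rewrite /algA /algA0 /= dE hE.
by split=> [[[_ f0 sP sYP] /oE]|[f0 sP sYP /oE]]; split.
Qed.

(** The minimal polynomials P of f and Q of f1, scaled so that Q is normalized.
    As x^(2e) Q has degree at most h + ed in x, the integer h + e(d-2) cannot be
    negative. *)
Lemma algA_data d h e f : algA K d (Posz h) e f -> exists n P Q,
  [/\ newH d h e = Posz n,
      [/\ is_minpoly f P, (size P <= d.+1)%N & (sizeY P <= h.+1)%N],
      P \Po shift (phi0 e f) = ('X^(2 * e))%:P * Q,
      [/\ is_minpoly (phi1 e f) Q, (size Q <= d.+1)%N & (sizeY Q <= n.+1)%N] &
      Q`_0`_0 = 0 /\ Q`_1`_0 = 1].
Proof.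
move=> fA; have [[fa f0 _ _] _] := fA.
have fM := minpolyP fa; have M0 := is_minpoly_neq0 fa fM.
have /(algAP _ _ _ M0 fM)[_ sM sYM oM] := fA.
have [Q [EQ Q00 Q10]] := shift_factor f0 (is_minpoly_root fM) oM.
pose b := (Q`_1`_0)^-1; have b0 : b != 0 by rewrite invr_eq0.
pose P := b%:P%:P * minpoly f; pose Q2 := b%:P%:P * Q.
have fP : is_minpoly f P by apply: is_minpoly_scale.
have E : P \Po shift (phi0 e f) = ('X^(2 * e))%:P * Q2.
  by rewrite comp_polyM comp_polyC EQ mulrCA.
have Q210 : Q2`_1`_0 = 1 by rewrite coef_constXYM mulVf.
have Q20 : Q2 != 0.
  by apply: contra_eq_neq Q210 => ->; rewrite !coef0 eq_sym oner_eq0.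
have fQ : is_minpoly (phi1 e f) Q2.
  apply: (@is_minpoly_shift K e (phi0 e f) (phi1 e f) P Q2 (2 * e) 1) => //.
    by have := phi_decomp e f0; rewrite low_polyE => <-.
  by rewrite Q210 oner_eq0.
have sP : (size P <= d.+1)%N by rewrite constXYM_size.
have sYP : (sizeY P <= h.+1)%N by rewrite constXYM_sizeY.
have X0 : ('X^(2 * e))%:P != 0 :> {poly {poly K}}.
  by rewrite polyC_eq0 monic_neq0 ?monicXn.
have := sizeY_comp_shift (phi0 e f) sP sYP.
rewrite E sizeYM // sizeY_polyC size_polyXn addSn /=.
have s0 := sizeY_gt0 Q20 => le.
have He : (2 * e <= h + e * d)%N by move: le s0; move: (sizeY Q2) => s; lia.
exists (h + e * d - 2 * e)%N, P, Q2; split=> //.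
- by rewrite /newH -subzn // PoszD !PoszM; ring.
- have sYQ2 : (sizeY Q2 <= (h + e * d - 2 * e).+1)%N.
    by move: le s0; move: (sizeY Q2) => s; lia.
  split=> //.
  rewrite -(constXYM_size Q2 (oner_neq0 K)).
  have <- : size (('X^(2 * e))%:P * Q2) = size (1%:P%:P * Q2).
    by rewrite constXYM_size ?oner_neq0 // mul_polyC size_scale // -polyC_eq0.
  by rewrite -E size_comp_poly2 ?size_shift.
- by split=> //; rewrite coef_constXYM Q00 mulr0.
Qed.

(** The image C_{d,h,e}, without mention of power series; n is h + e(d-2). *)
Definition stratum d h e n (a : 'rV[K]_e) (c : 'rV[K]_(dimI d (Posz n))) :=
  exists p : 'rV[K]_(num_bip d h),
    irred (bipoly p) /\ bipoly p \Po shift a = ('X^(2 * e))%:P * nform c.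

Definition stratumH d h e H : 'rV[K]_e -> 'rV[K]_(dimI d H) -> Prop :=
  match H with Posz n => fun a c => stratum h a c | Negz _ => fun _ _ => False end.

(** Hensel's lemma gives the root f1 of Q, and f = f0 + x^e f1 is a root of P,
    which is its minimal polynomial because it is irreducible. Differentiating
    P(x, f0 + x^e T) = x^(2e) Q shows that P_T(x,f) has order e. *)
Lemma stratum_series d h e n (a : 'rV[K]_e) (c : 'rV[K]_(dimI d (Posz n))) :
  (0 < d)%N -> stratum h a c -> exists f,
  [/\ algA K d (Posz h) e f, phi0 e f = a & psi d (Posz n) (phi1 e f) = c].
Proof.
move=> d0 [p [irrP E]]; set P := bipoly p in irrP E; set Q := nform c in E.
have [P0 _ _] := irrP.
have Q10 : Q`_1`_0 = 1 by apply: nform10.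
have [|g g0 Qg] := @hensel_exists K Q (nform00 c).
  by rewrite Q10 oner_neq0.
have [ea eg] := phi_decomp_unique a g0.
set f := _ + _ in ea eg.
have fE : f = subst (shift a) g by rewrite subst_shift.
have Pf : subst P f = 0 by rewrite fE -subst_comp E substM Qg mulr0.
have fP : is_minpoly f P := irred_is_minpoly irrP Pf.
have f0 : fps_coef f 0 = 0.
  rewrite fps_coefD fps_coef_poly low_polyE coef0_low_poly add0r.
  by rewrite fps_coef0M g0 mulr0.
have gQ : is_minpoly g Q.
  by apply: (is_minpoly_shift (i := 1) fP E); rewrite Q10 oner_neq0.
exists f; split=> //.
  apply/(algAP _ _ _ P0 fP); split=> //; rewrite ?size_bipoly ?sizeY_bipoly //.
  have EP' : P^`() \Po shift a = ('X^e)%:P * Q^`().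
    have Xe0 : ('X^e)%:P != 0 :> {poly {poly K}}.
      by rewrite polyC_eq0 monic_neq0 ?monicXn.
    have Ds : (shift a)^`() = ('X^e)%:P.
      by rewrite derivD derivC add0r derivM derivC mul0r add0r derivX mulr1.
    apply: (mulIf Xe0); have := congr1 (@deriv {poly K}) E.
    rewrite deriv_comp Ds derivM derivC mul0r add0r mul2n -addnn exprD polyCM.
    by move=> ->; rewrite mulrAC.
  rewrite fE -subst_comp EP' substM substC.
  split=> [|i lt]; rewrite fps_coefXnM ?lt // ltnn subnn.
  by rewrite subst_coef0 // coef_deriv mulr1n Q10 oner_neq0.
by rewrite eg /psi (normal_minpolyE gQ Q10) poly_coords_nform.
Qed.

Lemma imgAP d h e (v : 'rV[K]_(dimA d h e)) : (0 < d)%N ->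
  imgA K d h e v <-> stratumH h (lsubmx v) (rsubmx v).
Proof.
move=> d0; split=> [[f fA <-]|].
  rewrite /theta row_mxKl row_mxKr.
  have [n [P [Q [EH [fP sP sYP] E [fQ sQ sYQ] [Q0 Q1]]]]] := algA_data fA.
  rewrite EH /=; exists (bicoords d h P); rewrite bicoordsK //; split.
    by case: fA => [[fa _ _ _] _]; apply: is_minpoly_irred fP.
  by rewrite /psi (normal_minpolyE fQ Q1) nform_coords.
rewrite -[v in imgA _ _ _ _ v]hsubmxK /imgA /theta.
move: (lsubmx v) (rsubmx v) => a; rewrite /dimA; case: (newH d h e) => n //= c.
move=> /(stratum_series d0)[f [fA fa fc]]; exists f => //.
by rewrite fa fc.
Qed.

Lemma phi1_algI d h e : 
  set_fun (algA K d (Posz h) e) (algI K d (newH d h e)) (phi1 e).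
Proof.
move=> f fA; have [n [P [Q [EH _ _ [fQ sQ sYQ] [Q0 Q1]]]]] := algA_data fA.
have Q20 : Q != 0.
  by apply: contra_eq_neq Q1 => ->; rewrite !coef0 eq_sym oner_eq0.
rewrite EH /algI; apply/(algAP _ _ _ Q20 fQ); split=> //; split=> //.
by rewrite subst_coef0 // coef_deriv mulr1n Q1 oner_neq0.
Qed.

Lemma theta_prodC d h e :
  set_fun (algA K d (Posz h) e) (prodC K d h e) (theta d h e).
Proof.
move=> f fA; rewrite /prodC /= /theta row_mxKr; exists (phi1 e f) => //.
exact: phi1_algI fA.
Qed.

(** The two components determine f0 and the minimal polynomial of f1, of which
    f1 is the only root that vanishes at 0. *)
Lemma theta_inj d h e : (0 < d)%N ->
  set_inj (algA K d (Posz h) e) (theta d h e).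
Proof.
move=> d0 f g; rewrite !inE => fA gA /eq_row_mx[E0 E1].
have [[_ f0 _ _] _] := fA; have [[_ g0 _ _] _] := gA.
rewrite (phi_decomp e f0) (phi_decomp e g0) E0; congr (_ + _ * _).
have [n [P [Q [EH _ _ [fQ sQ sYQ] [Q0 Q1]]]]] := algA_data fA.
have [n' [P' [Q' [EH' _ _ [gQ' sQ' sYQ'] [Q0' Q1']]]]] := algA_data gA.
move: E1; rewrite EH in EH' *; case: EH' => En; rewrite -En in sYQ'.
rewrite /psi (normal_minpolyE fQ Q1) (normal_minpolyE gQ' Q1') => EQ.
have {EQ} EQ : Q = Q' by rewrite -(nform_coords d0 sQ sYQ) // EQ nform_coords.
apply: (@hensel_unique K Q) => //; rewrite ?Q1 ?oner_neq0 //.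
  exact: is_minpoly_root.
by rewrite EQ; apply: is_minpoly_root.
Qed.

Lemma algA_ex d h f : algA0 K d (Posz h) f ->
  exists2 e, (e <= 2 * d * h)%N & algA K d (Posz h) e f.
Proof.
move=> fA; have [fa f0 _ _] := fA; have fM := minpolyP fa.
have M0 := is_minpoly_neq0 fa fM.
have [e oe] := has_order_ex (minpoly_separable fa fM).
have fAe : algA K d (Posz h) e f by split.
exists e => //; have /(algAP _ _ _ M0 fM)[_ sM sYM _] := fAe.
exact: (minpoly_order_bound fa fM sM sYM oe).
Qed.

Lemma algA_uniq d h f e e' :
  algA K d (Posz h) e f -> algA K d (Posz h) e' f -> e = e'.
Proof. by move=> [_ oe] [_ oe']; apply: has_order_uniq oe oe'. Qed.

End Strata.

(** * Definable sets are constructible *)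

Section Definable.
Variable K : closedFieldType.

Definition env_row n (e : seq K) : 'rV[K]_n := \row_i e`_i.

(** Variables beyond the n first ones are ignored, so that further variables
    can be quantified in the same formula. *)
Definition definable n (X : set 'rV[K]_n) :=
  exists f : GRing.formula K, forall e, GRing.holds e f <-> X (env_row n e).

Definition row_env n (v : 'rV[K]_n) : seq K := [seq v 0 i | i <- enum 'I_n].

Lemma nth_row_env n (v : 'rV[K]_n) (i : 'I_n) : (row_env v)`_i = v 0 i.
Proof. by rewrite (nth_map i) ?size_enum_ord // nth_ord_enum. Qed.

Lemma row_envK n (v : 'rV[K]_n) : env_row n (row_env v) = v.
Proof. by apply/rowP => i; rewrite mxE nth_row_env. Qed.

(** Finite unions of sets of the form p_1 = ... = p_k = 0, q <> 0. *)
Definition clause n := (seq {mpoly K[n]} * {mpoly K[n]})%type.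
Definition sat n (v : 'rV[K]_n) (c : clause n) : bool :=
  all (fun p => p.@[v 0] == 0) c.1 && (c.2.@[v 0] != 0).

Definition clausal n (X : set 'rV[K]_n) :=
  exists s : seq (clause n), forall v, X v <-> has (sat v) s.

Fixpoint mpoly_of_term n (t : GRing.term K) : {mpoly K[n]} :=
  match t with
  | GRing.Var i => if insub i is Some j then 'X_j else 0
  | GRing.Const c => c%:MP
  | GRing.NatConst m => m%:R
  | GRing.Add t1 t2 => mpoly_of_term n t1 + mpoly_of_term n t2
  | GRing.Opp t1 => - mpoly_of_term n t1
  | GRing.NatMul t1 m => mpoly_of_term n t1 *+ m
  | GRing.Mul t1 t2 => mpoly_of_term n t1 * mpoly_of_term n t2
  | GRing.Inv _ => 0
  | GRing.Exp t1 m => mpoly_of_term n t1 ^+ m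
  end.

Lemma eval_mpoly_of_term n (v : 'rV[K]_n) t : GRing.rterm t ->
  GRing.eval (row_env v) t = (mpoly_of_term n t).@[v 0].
Proof.
elim: t => //= [i|c|m|t1 IH1 t2 IH2 /andP[r1 r2]|t IH r|t IH m r|t1 IH1 t2 IH2 /andP[r1 r2]|t IH m r].
- case: insubP => [j _ <-|ni]; first by rewrite mevalXU nth_row_env.
  by rewrite meval0 nth_default // size_map size_enum_ord leqNgt.
- by rewrite mevalC.
- by rewrite rmorph_nat.
- by rewrite mevalD IH1 ?IH2.
- by rewrite mevalN IH.
- by rewrite mevalMn IH.
- by rewrite mevalM IH1 ?IH2.
- by rewrite rmorphXn /= IH.
Qed.

Lemma term_of_mpoly n (p : {mpoly K[n]}) :
  exists t, forall e, GRing.eval e t = p.@[env_row n e 0].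
Proof.
pose P (p : {mpoly K[n]}) := exists t, forall e, GRing.eval e t = p.@[env_row n e 0].
have PX m : P 'X_[m].
  suff [t Et] : exists t, forall e : seq K, GRing.eval e t = \prod_(i < n) (env_row n e 0 i) ^+ m i.
    by exists t => e; rewrite Et mevalX.
  elim: (index_enum _) => [|i r [t IH]].
    by exists (GRing.Const 1) => e; rewrite big_nil.
  exists (GRing.Mul (GRing.Exp (GRing.Var K i) (m i)) t) => e.
  by rewrite big_cons /= IH mxE.
elim/mpolyind: p => [|c m p _ _ [t Et]].
  by exists (GRing.Const 0) => e; rewrite meval0.
have [u Eu] := PX m; exists (GRing.Add (GRing.Mul (GRing.Const c) u) t) => e.
by rewrite mevalD mevalZ /= Eu Et.
Qed.

Lemma definableC n (X : set 'rV[K]_n) : definable X -> definable (~` X).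
Proof.
move=> [f Ef]; exists (GRing.Not f) => e /=.
by split=> H; [move/Ef | move=> /Ef].
Qed.

Lemma definableI n (X Y : set 'rV[K]_n) :
  definable X -> definable Y -> definable (X `&` Y).
Proof.
move=> [f Ef] [g Eg]; exists (GRing.And f g) => e /=.
by split=> [[/Ef ? /Eg ?]|[/Ef ? /Eg ?]].
Qed.

Lemma definableU n (X Y : set 'rV[K]_n) :
  definable X -> definable Y -> definable (X `|` Y).
Proof.
move=> [f Ef] [g Eg]; exists (GRing.Or f g) => e /=.
by split=> [[/Ef ?|/Eg ?]|[/Ef ?|/Eg ?]]; tauto.
Qed.

Lemma definable_zeros n (s : seq {mpoly K[n]}) :
  definable [set v : 'rV[K]_n | forall p, p \in s -> p.@[v 0] = 0].
Proof.
elim: s => [|p s [f Ef]]; first by exists (GRing.Bool true) => e.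
have [t Et] := term_of_mpoly p.
exists (GRing.And (GRing.Equal t (GRing.Const 0)) f) => e /=; rewrite Et.
split=> [[p0 /Ef H] q|H].
  by rewrite inE => /predU1P[->|/H].
split; first by apply: H; rewrite inE eqxx.
by apply/Ef => q qs; apply: H; rewrite inE qs orbT.
Qed.

(** The projection along the last m coordinates is an existential
    quantification over the variables n, ..., n + m - 1. *)
Lemma definable_ex n m (X : set 'rV[K]_(n + m)) : definable X ->
  definable [set v : 'rV[K]_n | exists w, X (row_mx v w)].
Proof.
move=> [f Ef]; exists (foldr GRing.Exists f (iota n m)) => e.
have rowE (e' : seq K) : {in [predC iota n m], GRing.same_env e e'} ->
    env_row (n + m) e' = row_mx (env_row n e) (\row_j e'`_(n + j)).
  move=> E; apply/rowP => i; rewrite !mxE.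
  case: (fintype.splitP i) => j Ej; rewrite mxE Ej // -E //.
  by rewrite !inE mem_iota; have := ltn_ord j; lia.
split=> [/GRing.foldExistsP[e' E /Ef]|[w Xw]].
  by rewrite (rowE _ E) => XE; exists (\row_j e'`_(n + j)).
apply/GRing.foldExistsP.
pose e' := mkseq (fun i => if (n <= i < n + m)%N then (rVpoly w)`_(i - n) else e`_i)
  (maxn (size e) (n + m)).
have e'E i : e'`_i = if (n <= i < n + m)%N then (rVpoly w)`_(i - n) else e`_i.
  have [lt|le] := ltnP i (maxn (size e) (n + m)); first by rewrite nth_mkseq.
  rewrite nth_default ?size_mkseq //.
  move: le; rewrite geq_max => /andP[le1 le2].
  by case: ifP => [/andP[_]|_]; [rewrite ltnNge le2|rewrite nth_default].
have same : {in [predC iota n m], GRing.same_env e e'}.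
  by move=> i; rewrite inE /= mem_iota e'E => /negPf ->.
exists e' => //; apply/Ef; rewrite (rowE _ same).
congr (X (row_mx _ _)) : Xw; apply/rowP => j.
rewrite mxE e'E leq_addr ltn_add2l ltn_ord /= addKn.
by rewrite coef_rVpoly_ord.
Qed.

(** Quantifier elimination, followed by disjunctive normal form. *)
Lemma definable_clausal n (X : set 'rV[K]_n) : definable X -> clausal X.
Proof.
move=> [f Ef]; pose proj := @ClosedFieldQE.ex_elim K.
have wf := @ClosedFieldQE.wf_ex_elim K.
have ok : GRing.valid_QE_proj proj.
  by apply: ClosedFieldQE.holds_ex_elim; exact: solve_monicpoly.
pose g := GRing.quantifier_elim proj (GRing.to_rform f).
have rg : GRing.qf_form g && GRing.rformula g.
  exact: (GRing.quantifier_elim_wf wf (GRing.to_rform_rformula f)).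
pose dnf := GRing.qf_to_dnf g false.
have rdnf : all GRing.dnf_rterm dnf.
  by case/andP: rg => _ /GRing.qf_to_dnf_rterm; apply.
have XE v : X v <-> GRing.qf_eval (row_env v) (GRing.dnf_to_form dnf).
  rewrite (GRing.qf_to_dnfP (row_env v) rg).
  rewrite -[X in X v]/(X) -{1}(row_envK v) -Ef -GRing.to_rformP.
  split=> /(GRing.quantifier_elim_rformP wf ok _ (GRing.to_rform_rformula f)) //.
pose cl (bc : seq (GRing.term K) * seq (GRing.term K)) : clause n :=
  ([seq mpoly_of_term n t | t <- bc.1], \prod_(t <- bc.2) mpoly_of_term n t).
exists (map cl dnf) => v; rewrite XE {XE}.
elim: dnf rdnf => [|[b c] s IH] //= /andP[/andP[rb rc] rs].
rewrite /= in rb rc; set A := (X in X || _ <-> _); set B := sat _ _.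
have -> : A = B.
  rewrite /A /B /sat /=; congr (_ && _).
    elim: b rb {A B} => //= t b IHb /andP[rt rb].
    by rewrite IHb // eval_mpoly_of_term.
  elim: c rc {A B} => /= [|t c IHc /andP[rt rc]].
    by rewrite big_nil rmorph1 oner_eq0.
  by rewrite big_cons mevalM mulf_eq0 negb_or IHc // eval_mpoly_of_term.
by split=> /orP[->//|/(IH rs) ->]; rewrite orbT.
Qed.

Lemma clausal_definable n (X : set 'rV[K]_n) : clausal X -> definable X.
Proof.
move=> [s Es]; have -> : X = [set v : 'rV[K]_n | has (sat v) s].
  by apply/funext => v; apply/propext; apply: Es.
elim: s {Es} => [|c s IH]; first by exists (GRing.Bool false) => e.
have -> : [set v : 'rV[K]_n | has (sat v) (c :: s)] =
   ([set v : 'rV[K]_n | forall p, p \in c.1 -> p.@[v 0] = 0] `&`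
    ~` [set v : 'rV[K]_n | forall p, p \in [:: c.2] -> p.@[v 0] = 0])
   `|` [set v : 'rV[K]_n | has (sat v) s].
  apply/funext => v; apply/propext; rewrite /= /sat; split.
    move=> /orP[/andP[/allP H c2]|]; last by right.
    left; split=> [p pc|/(_ c.2)]; first exact/eqP/H.
    by rewrite inE eqxx => /(_ isT) E; rewrite E eqxx in c2.
  case=> [[H1 H2]|->]; last by rewrite orbT.
  apply/orP; left; apply/andP; split; first by apply/allP => p /H1/eqP.
  apply/eqP => E; apply: H2 => p; rewrite inE => /eqP->.
  exact: E.
apply: definableU => //; apply: definableI; first exact: definable_zeros.
exact/definableC/definable_zeros.
Qed.

Definition mpoly_map m n (phi : 'rV[{mpoly K[m]}]_n) (v : 'rV[K]_m) : 'rV[K]_n :=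
  map_mx (meval (v 0)) phi.

Lemma mpoly_mapE m n (phi : 'rV[{mpoly K[m]}]_n) v (p : {mpoly K[n]}) :
  p.@[mpoly_map phi v 0] = (p \mPo [tuple phi 0 i | i < n]).@[v 0].
Proof.
rewrite comp_mpoly_meval; apply: meval_eq => i.
by rewrite tnth_mktuple mxE.
Qed.

Lemma clausal_preim m n (phi : 'rV[{mpoly K[m]}]_n) (X : set 'rV[K]_n) :
  clausal X -> clausal (mpoly_map phi @^-1` X).
Proof.
move=> [s Es]; pose co (p : {mpoly K[n]}) := p \mPo [tuple phi 0 i | i < n].
exists [seq (map co c.1, co c.2) | c <- s] => v.
rewrite /preimage /= Es has_map.
rewrite (@eq_has _ (preim _ _) (sat (mpoly_map phi v))) // => c /=.
rewrite /sat /= all_map mpoly_mapE; congr (_ && _).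
by apply: eq_all => p /=; rewrite mpoly_mapE.
Qed.

(** The detour by clauses is there because these compose with polynomial maps. *)
Lemma definable_preim m n (phi : 'rV[{mpoly K[m]}]_n) (X : set 'rV[K]_n) :
  definable X -> definable (mpoly_map phi @^-1` X).
Proof.
by move=> /definable_clausal/(clausal_preim phi)/clausal_definable.
Qed.

Lemma clausal_constructible n (X Z : set 'rV[K]_n) :
  clausal Z -> Z `<=` X -> constructible_in X Z.
Proof.
move=> [s Es] ZX; exists (size s).
pose c0 : clause n := ([::], 0).
exists (fun i => X `&` ~` [set v : 'rV[K]_n | forall p, [set (nth c0 s i).2] p -> p.@[v 0] = 0]).
exists (fun i => X `&` [set v : 'rV[K]_n | forall p, [set` (nth c0 s i).1] p -> p.@[v 0] = 0]).
split.
- by move=> i; eexists; last by []; eexists.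
- by move=> i; eexists; last by []; eexists.
apply/seteqP; split=> [v Zv|v [i _] [[Xv H2] [_ H1]]].
  have /Es /hasP[c cs /andP[/allP c1 c2]] := Zv.
  have lt : (index c s < size s)%N by rewrite index_mem.
  exists (Ordinal lt) => //=; rewrite nth_index //; split; split; try exact: ZX.
    by move=> /(_ c.2 erefl) E; rewrite E eqxx in c2.
  by move=> p /c1/eqP.
apply/Es/hasP; exists (nth c0 s i); first exact: mem_nth.
apply/andP; split; first by apply/allP => p /H1/eqP.
by apply/eqP => E; apply: H2 => p ->.
Qed.

End Definable.

(** * Constructibility of the strata *)

Section StrataDefinable.
Variable K : closedFieldType.

(** The generic point: polynomials in its coordinates specialize to those of
    any row, by naturality of the constructions in the coefficient ring. *)
Definition gen_row n : 'rV[{mpoly K[n]}]_n := \row_i 'X_i.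

Lemma eval_gen_row n (v : 'rV[K]_n) : map_mx (meval (v 0)) (gen_row n) = v.
Proof. by apply/rowP => i; rewrite !mxE mevalXU. Qed.

Definition eval2 n (v : 'rV[K]_n) (E : {poly {poly {mpoly K[n]}}}) :
  {poly {poly K}} := map_poly (map_poly (meval (v 0))) E.

(** A polynomial identity in x and T whose coefficients are polynomials in v is
    a closed condition on v. *)
Lemma definable_poly_eq0 n (E : {poly {poly {mpoly K[n]}}}) :
  definable [set v : 'rV[K]_n | eval2 v E = 0].
Proof.
have := definable_zeros (flatten [seq (q : seq _) | q : {poly _} <- E]).
congr definable; apply/funext => v; apply/propext; split=> [H|H p] /=.
  apply: poly2P => i j; rewrite !coef_map /= !coef0.
  have [le|lt] := leqP (size E`_j) i; first by rewrite nth_default // meval0.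
  apply: H; apply/flatten_mapP; exists E`_j; last exact: mem_nth.
  have [le|] := leqP (size E) j; last exact: mem_nth.
  by rewrite [E`_j]nth_default // size_poly0 in lt.
move=> /flatten_mapP[q /(nthP 0)[j _ <-] /(nthP 0)[i _ <-]].
have := congr1 (fun A : {poly {poly K}} => A`_j`_i) H.
by rewrite !coef_map /= !coef0.
Qed.

Lemma definable_const d h :
  definable [set p : 'rV[K]_(num_bip d h) | constXY (bipoly p)].
Proof.
pose G := bipoly (gen_row (num_bip d h)).
have := definable_poly_eq0 (G - (G`_0`_0)%:P%:P).
congr definable; apply/funext => v; apply/propext.
have GE : eval2 v G = bipoly v by rewrite /eval2 map_bipoly eval_gen_row.
rewrite /= /eval2 rmorphB /= -/(eval2 v G) GE !map_polyC /=.
have -> : map_poly (meval (v 0)) (G`_0`_0)%:P = ((bipoly v)`_0`_0)%:P.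
  by rewrite map_polyC -GE !coef_map.
split=> [/subr0_eq E|[c E]]; first by exists (bipoly v)`_0`_0.
by rewrite E !coefC subrr.
Qed.

(** Factors of a polynomial of bidegree at most (d,h) also have bidegree at most
    (d,h). *)
Lemma irred_bipolyP d h (p : 'rV[K]_(num_bip d h)) : irred (bipoly p) <->
  [/\ bipoly p <> 0, ~ constXY (bipoly p) &
   ~ exists w : 'rV[K]_(num_bip d h + num_bip d h),
     bipoly p = bipoly (lsubmx w) * bipoly (rsubmx w) /\
     (~ constXY (bipoly (lsubmx w)) /\ ~ constXY (bipoly (rsubmx w)))].
Proof.
split=> [[/eqP p0 pc H]|[/eqP p0 pc H]]; split=> //.
  by move=> [w [/H[Ac|Bc] [nA nB]]]; [apply: nA|apply: nB].
move=> A B E; apply: contrapT => /not_orP[nA nB]; apply: H.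
have bA : bipoly (bicoords d h A) = A.
  rewrite mulrC in E; apply: bicoordsK.
    exact: leq_trans (size_dvd_le E p0) (size_bipoly _).
  exact: leq_trans (sizeY_dvd_le E p0) (sizeY_bipoly _).
have bB : bipoly (bicoords d h B) = B.
  apply: bicoordsK.
    exact: leq_trans (size_dvd_le E p0) (size_bipoly _).
  exact: leq_trans (sizeY_dvd_le E p0) (sizeY_bipoly _).
by exists (row_mx (bicoords d h A) (bicoords d h B)); rewrite row_mxKl row_mxKr bA bB.
Qed.

Lemma definable_irred d h :
  definable [set p : 'rV[K]_(num_bip d h) | irred (bipoly p)].
Proof.
set N := num_bip d h.
pose G := gen_row (N + (N + N)).
pose GP := bipoly (lsubmx G : 'rV_(num_bip d h)).
pose GA := bipoly (lsubmx (rsubmx G) : 'rV_(num_bip d h)).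
pose GB := bipoly (rsubmx (rsubmx G) : 'rV_(num_bip d h)).
have D0 : definable [set p : 'rV[K]_N | bipoly p = 0].
  have := definable_poly_eq0 (bipoly (gen_row N)); congr definable.
  by apply/funext => v; rewrite /= /eval2 map_bipoly eval_gen_row.
have DE := definable_poly_eq0 (GP - GA * GB).
have Dc := definable_const d h.
have := definableI (definableI (definableC D0) (definableC Dc)) (definableC (definable_ex
  (definableI DE (definableI
   (definable_preim (lsubmx (rsubmx G)) (definableC Dc))
   (definable_preim (rsubmx (rsubmx G)) (definableC Dc)))))).
congr definable; apply/funext => p; apply/propext; apply: iff_trans (iff_sym (irred_bipolyP p)).
have inner (w : 'rV_(N + N)) : (eval2 (row_mx p w) (GP - GA * GB) = 0) =
   (bipoly p = bipoly (lsubmx w) * bipoly (rsubmx w)).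
  rewrite /eval2 rmorphB rmorphM /= !map_bipoly !map_lsubmx !map_rsubmx.
  rewrite eval_gen_row row_mxKl row_mxKr.
  by apply/propext; split=> [/subr0_eq//|->]; rewrite subrr.
have prl (w : 'rV_(N + N)) : mpoly_map (lsubmx (rsubmx G)) (row_mx p w) = lsubmx w.
  by rewrite /mpoly_map map_lsubmx map_rsubmx eval_gen_row row_mxKr.
have prr (w : 'rV_(N + N)) : mpoly_map (rsubmx (rsubmx G)) (row_mx p w) = rsubmx w.
  by rewrite /mpoly_map !map_rsubmx eval_gen_row row_mxKr.
split=> [[[H0 H1] H2]|[H0 H1 H2]].
  split=> // -[w [E [nA nB]]]; apply: H2; exists w; split; first by rewrite /= inner.
  by split; rewrite /preimage /= ?prl ?prr.
split=> // -[w [E [nA nB]]]; apply: H2; exists w.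
move: E nA nB; rewrite /preimage /= inner prl prr => E nA nB.
by split.
Qed.

Lemma definable_stratum d h e n : definable
  [set v : 'rV[K]_(e + dimI d (Posz n)) |
    @stratum K d h e n (lsubmx v) (rsubmx v)].
Proof.
set N := num_bip d h; set D := (e + dimI d (Posz n))%N.
pose G := gen_row (D + N).
pose Gv : 'rV_(e + dimI d (Posz n)) := lsubmx G.
pose Gp : 'rV_(num_bip d h) := rsubmx G.
have := definable_ex (definableI (definable_preim Gp (definable_irred d h))
  (definable_poly_eq0 (reparam_eq Gp Gv))).
congr definable; apply/funext => v; apply/propext.
have inner (p : 'rV_N) : (eval2 (row_mx v p) (reparam_eq Gp Gv) = 0) =
    (bipoly p \Po shift (lsubmx v) = ('X^(2 * e))%:P * nform (rsubmx v)).
  rewrite /eval2 map_reparam_eq /Gv /Gp map_lsubmx map_rsubmx eval_gen_row.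
  rewrite row_mxKl row_mxKr /reparam_eq.
  by apply/propext; split=> [/subr0_eq//|->]; rewrite subrr.
have pr (p : 'rV_N) : mpoly_map Gp (row_mx v p) = p.
  by rewrite /mpoly_map map_rsubmx eval_gen_row row_mxKr.
split=> -[p [Ip Ep]]; exists p.
  by move: Ip Ep; rewrite /preimage /= inner pr.
by split; rewrite /preimage /= ?inner ?pr.
Qed.

Lemma clausal_imgA d h e : (0 < d)%N -> clausal (imgA K d h e).
Proof.
move=> d0; have -> : imgA K d h e =
   [set v : 'rV[K]_(dimA d h e) | stratumH h (lsubmx v) (rsubmx v)].
  by apply/funext => v; apply/propext; apply: imgAP.
rewrite /dimA; case: (newH d h e) => n; last by exists [::] => v.
exact/definable_clausal/definable_stratum.
Qed.

Lemma imgA_sub_prodC d h e : imgA K d h e `<=` prodC K d h e.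
Proof. by move=> _ [f fA <-]; apply: theta_prodC. Qed.

End StrataDefinable.

(** * Relative algebraic closure and Steinitz exchange *)

Section SubfieldType.
Variables (L : fieldType) (C : {pred L}) (divC : divring_closed C).

Definition subfield_pred : divring_closed C -> pred L := fun _ => mem C.
HB.instance Definition _ := GRing.isDivringClosed.Build L (subfield_pred divC) divC.

(** A subset closed under the field operations, as a field: the theory of
    algebraic elements is about morphisms of fields. *)
Record subfield_type := SubfieldElt
  { subfield_val : L; subfield_valP : subfield_val \in subfield_pred divC }.
HB.instance Definition _ := [isSub for subfield_val].
HB.instance Definition _ := [Choice of subfield_type by <:].
HB.instance Definition _ := [SubChoice_isSubIntegralDomain of subfield_type by <:].
HB.instance Definition _ := [SubIntegralDomain_isSubField of subfield_type by <:].

End SubfieldType.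

Section Subring.
Variable L : comNzRingType.
Implicit Types (B : set L) (x y : L).

Definition poly_in B (p : {poly L}) := forall i, B p`_i.

Definition subring B :=
  [/\ B 1, forall x y, B x -> B y -> B (x - y) & forall x y, B x -> B y -> B (x * y)].

Section SubringTheory.
Variables (B : set L) (ringB : subring B).
Lemma subring1 : B 1. Proof. by case: ringB. Qed.
Lemma subringB x y : B x -> B y -> B (x - y). Proof. by case: ringB => _ H _; apply: H. Qed.
Lemma subringM x y : B x -> B y -> B (x * y). Proof. by case: ringB => _ _ H; apply: H. Qed.
Lemma subring0 : B 0. Proof. by rewrite -(subrr 1); apply: subringB; exact: subring1. Qed.
Lemma subringN x : B x -> B (- x).
Proof. by rewrite -sub0r => /(subringB subring0). Qed.
Lemma subringD x y : B x -> B y -> B (x + y).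
Proof. by move=> Bx /subringN By; rewrite -[y]opprK; apply: subringB. Qed.
Lemma subringX x n : B x -> B (x ^+ n).
Proof.
by move=> Bx; elim: n => [|n IH]; rewrite ?expr0 ?exprS; [exact: subring1|apply: subringM].
Qed.
Lemma subring_sum I (r : seq I) (P : pred I) (F : I -> L) :
  (forall i, P i -> B (F i)) -> B (\sum_(i <- r | P i) F i).
Proof. by move=> BF; apply: big_ind => //; [exact: subring0|exact: subringD]. Qed.
Lemma subring_prod I (r : seq I) (P : pred I) (F : I -> L) :
  (forall i, P i -> B (F i)) -> B (\prod_(i <- r | P i) F i).
Proof. by move=> BF; apply: big_ind => //; [exact: subring1|exact: subringM]. Qed.
Lemma subring_horner p x : poly_in B p -> B x -> B p.[x].
Proof.
move=> Bp Bx; rewrite horner_coef; apply: subring_sum => i _.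
by apply: subringM => //; apply: subringX.
Qed.
Lemma poly_inC c : B c -> poly_in B c%:P.
Proof. by move=> Bc i; rewrite coefC; case: eqP => _ //; exact: subring0. Qed.
Lemma poly_inX : poly_in B 'X.
Proof. by move=> i; rewrite coefX; case: eqP => _; [exact: subring1|exact: subring0]. Qed.
Lemma poly_inB p q : poly_in B p -> poly_in B q -> poly_in B (p - q).
Proof. by move=> Bp Bq i; rewrite coefB; apply: subringB. Qed.
Lemma poly_inM p q : poly_in B p -> poly_in B q -> poly_in B (p * q).
Proof. by move=> Bp Bq i; rewrite coefM; apply: subring_sum => j _; apply: subringM. Qed.
End SubringTheory.

Definition adjoin B y : set L := [set x | exists2 p, poly_in B p & x = p.[y]].

Lemma adjoin_subring B y : subring B -> subring (adjoin B y).
Proof.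
move=> rB; split=> [|_ _ [p Bp ->] [q Bq ->]|_ _ [p Bp ->] [q Bq ->]].
- by exists 1; rewrite ?hornerC //; apply: poly_inC => //; apply: subring1.
- by exists (p - q); rewrite ?hornerE //; apply: poly_inB.
- by exists (p * q); rewrite ?hornerM //; apply: poly_inM.
Qed.

Lemma adjoin_sub B y : subring B -> B `<=` adjoin B y.
Proof. by move=> rB x Bx; exists x%:P; rewrite ?hornerC //; apply: poly_inC. Qed.

Lemma adjoin_gen B y : subring B -> adjoin B y y.
Proof. by move=> rB; exists 'X; rewrite ?hornerX //; apply: poly_inX. Qed.

End Subring.

Section Algebraic.
Variable L : fieldType.
Implicit Types (B C : set L) (x y : L).

Definition subfield C := subring C /\ forall x, C x -> C x^-1.

Definition alg_over B : set L := [set x | exists p, [/\ p != 0, poly_in B p & root p x]].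

Definition alg_closed_in C := alg_over C `<=` C.

Lemma sub_alg_over B C : B `<=` C -> alg_over B `<=` alg_over C.
Proof. by move=> BC x [p [p0 Bp px]]; exists p; split=> // i; apply: BC. Qed.

Lemma alg_over_id B : subring B -> B `<=` alg_over B.
Proof.
move=> rB x Bx; exists ('X - x%:P); split; rewrite ?polyXsubC_eq0 ?root_XsubC //.
by apply: poly_inB => //; [exact: poly_inX|exact: poly_inC].
Qed.

Section OverSubfield.
Variables (C : set L) (fC : subfield C).

Definition setpred : {pred L} := fun x => `[< C x >].

Lemma setpred_divring : divring_closed setpred.
Proof.
have [rC iC] := fC; split=> [|x y|x y]; rewrite /setpred !unfold_in.
- exact/asboolP/(subring1 rC).
- by move=> /asboolP Cx /asboolP Cy; apply/asboolP/(subringB rC).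
- by move=> /asboolP Cx /asboolP Cy; apply/asboolP/(subringM rC) => //; apply: iC.
Qed.

Local Notation F := (subfield_type setpred_divring).
Local Notation phi := (\val : F -> L).

Lemma alg_overP x : alg_over C x <-> algebraicOver phi x.
Proof.
split=> [[p [p0 Cp px]]|[p p0 px]].
  pose q : {poly F} := \poly_(i < size p) insubd 0 p`_i.
  have Eq : map_poly phi q = p.
    apply/polyP => i; rewrite coef_map coef_poly; case: ltnP => [_|le].
      by rewrite /= insubdK //; apply/asboolP.
    by rewrite nth_default // raddf0.
  exists q; last by rewrite Eq.
  by apply: contraNneq p0 => q0; rewrite -Eq q0 map_poly0.
exists (map_poly phi p); split=> //; first by rewrite map_poly_eq0.
by move=> i; rewrite coef_map; apply/asboolP; apply: (subfield_valP p`_i).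
Qed.

Lemma alg_over_subfield : subfield (alg_over C).
Proof.
split; first split.
- exact/alg_overP/algebraic1.
- by move=> x y /alg_overP ax /alg_overP ay; apply/alg_overP/algebraic_sub.
- by move=> x y /alg_overP ax /alg_overP ay; apply/alg_overP/algebraic_mul.
- by move=> x /alg_overP ax; apply/alg_overP/algebraic_inv.
Qed.

(** Transitivity of algebraicity. *)
Lemma alg_over_closed : alg_closed_in (alg_over C).
Proof.
move=> x [p [p0 Cp px]]; apply/alg_overP/integral_algebraic.
have [rA iA] := alg_over_subfield.
have lc : lead_coef p != 0 by rewrite lead_coef_eq0.
apply: (@integral_root_monic _ _ _ x ((lead_coef p)^-1 *: p)).
- by rewrite monicE lead_coefZ mulVf.
- by rewrite rootZ ?invr_eq0.
apply/integral_poly => i; apply/integral_algebraic/alg_overP.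
by rewrite coefZ; apply: subringM => //; apply: iA; apply: Cp.
Qed.

End OverSubfield.

Definition fractions B : set L :=
  [set x | exists a b, [/\ B a, B b, b != 0 & x = a / b]].

Lemma fractions_subfield B : subring B -> subfield (fractions B).
Proof.
move=> rB; split; first split.
- by exists 1, 1; rewrite divr1 oner_neq0; split=> //; exact: subring1.
- move=> _ _ [a [b [Ba Bb b0 ->]]] [c [d [Bc Bd d0 ->]]].
  exists (a * d - c * b), (b * d); split; rewrite ?mulf_neq0 //.
  + by apply: (subringB rB); apply: (subringM rB).
  + exact: subringM.
  + by rewrite mulrBl -mulf_div divff // mulr1 [b * d]mulrC -mulf_div divff // mulr1.
- move=> _ _ [a [b [Ba Bb b0 ->]]] [c [d [Bc Bd d0 ->]]].
  exists (a * c), (b * d); split; rewrite ?mulf_neq0 ?mulf_div //; exact: subringM.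
move=> _ [a [b [Ba Bb b0 ->]]]; have [->|a0] := eqVneq a 0.
  exists 0, 1; rewrite mul0r invr0 oner_neq0 mul0r.
  by split=> //; [exact: subring0|exact: subring1].
by exists b, a; rewrite invf_div.
Qed.

Lemma fractions_id B : subring B -> B `<=` fractions B.
Proof.
by move=> rB x Bx; exists x, 1; rewrite divr1 oner_neq0; split=> //; exact: subring1.
Qed.

(** Denominators can be cleared in an equation. *)
Lemma alg_over_fractions B : subring B -> alg_over (fractions B) `<=` alg_over B.
Proof.
move=> rB x [p [p0 Fp px]].
suff [d [Bd d0 Hd]] : exists d, [/\ B d, d != 0 & poly_in B (d *: p)].
  by exists (d *: p); rewrite scale_poly_eq0 (negPf d0) (negPf p0) rootZ.
have [d [Bd d0 Hd]] : exists d, [/\ B d, d != 0 &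
    forall i, (i < size p)%N -> B (d * p`_i)].
  elim: (size p) => [|n [d [Bd d0 IH]]].
    by exists 1; rewrite oner_neq0; split=> //; exact: subring1.
  have [a [b [Ba Bb b0 E]]] := Fp n.
  exists (d * b); split; rewrite ?mulf_neq0 //; first exact: subringM.
  move=> i; rewrite ltnS leq_eqVlt => /predU1P[->|/IH Bi].
    by rewrite E mulrA -[d * b * a]mulrA [b * a]mulrC mulrA mulfK //; apply: subringM.
  by rewrite mulrAC; apply: subringM.
exists d; split=> // i; rewrite coefZ; have [/Hd//|le] := ltnP i (size p).
by rewrite nth_default // mulr0; apply: subring0.
Qed.

(** Let G(x,y) = 0 be an equation of x over C[y]. As a polynomial in y with
    coefficients in C[x] it is not zero, since otherwise its coefficients would
    be equations of x over C. *)
Lemma alg_exchange C x y : subfield C -> alg_closed_in C ->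
  alg_over (adjoin C y) x -> ~ C x -> alg_over (adjoin C x) y.
Proof.
move=> [rC iC] clC [g [g0 Bg gx]] nCx.
have /choice[P HP] : forall i, exists p, poly_in C p /\ g`_i = p.[y].
  by move=> i; have [p Cp Ep] := Bg i; exists p.
pose G : {poly {poly L}} := \poly_(i < size g) P i.
have GC i j : C G`_i`_j.
  rewrite coef_poly; case: ltnP => _; first exact: (HP i).1.
  by rewrite coef0; apply: subring0.
have Gy : map_poly (horner_eval y) G = g.
  apply/polyP => i; rewrite coef_map coef_poly /= /horner_eval.
  case: ltnP => [_|le]; first by rewrite (HP i).2.
  by rewrite horner0 nth_default.
have Gxy : (map_poly (horner_eval x) (swapXY G)).[y] = 0.
  rewrite -horner_swapXY swapXYK.
  have -> : G.[x%:P].[y] = (map_poly (horner_eval y) G).[x].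
    by have := horner_map (horner_eval y) G x%:P; rewrite /= /horner_eval hornerC.
  by rewrite Gy; exact/eqP.
have [H0|H0] := eqVneq (map_poly (horner_eval x) (swapXY G)) 0; last first.
  exists (map_poly (horner_eval x) (swapXY G)); split=> //; last exact/eqP.
  move=> j; rewrite coef_map /= /horner_eval; exists (swapXY G)`_j => //.
  by move=> i; rewrite coef_swapXY.
have Gn0 : swapXY G != 0.
  rewrite swapXY_eq0; apply: contraNneq g0 => G0.
  by rewrite -Gy G0 map_poly0.
case: nCx; apply: clC; exists (lead_coef (swapXY G)); split.
- by rewrite lead_coef_eq0.
- by move=> i; rewrite /lead_coef coef_swapXY.
have := congr1 (fun p : {poly L} => p`_(size (swapXY G)).-1) H0.
by rewrite coef_map coef0 /= /horner_eval => /eqP.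
Qed.

End Algebraic.

Section Steinitz.
Variable L : fieldType.
Implicit Types (S T C : set L) (x y : L) (s t : seq L).

(** The smallest relatively algebraically closed subfield containing S. *)
Definition acl S : set L := [set x | forall C, subfield C -> alg_closed_in C ->
  S `<=` C -> C x].

Lemma sub_acl S : S `<=` acl S.
Proof. by move=> x Sx C _ _; apply. Qed.

Lemma acl_min S C : subfield C -> alg_closed_in C -> S `<=` C -> acl S `<=` C.
Proof. by move=> fC cC SC x; apply. Qed.

Lemma acl_subfield S : subfield (acl S).
Proof.
split; first split.
- by move=> C [rC _] _ _; apply: subring1.
- by move=> x y ax ay C fC cC SC; have [rC _] := fC;
    apply: (subringB rC); [apply: ax|apply: ay].
- by move=> x y ax ay C fC cC SC; have [rC _] := fC;
    apply: (subringM rC); [apply: ax|apply: ay].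
- by move=> x ax C fC cC SC; have [_ iC] := fC; apply: iC; apply: ax.
Qed.

Lemma acl_closed S : alg_closed_in (acl S).
Proof.
move=> x ax C fC cC SC; apply: (cC); apply: sub_alg_over ax.
exact: (acl_min fC cC SC).
Qed.

Lemma acl_sub S T : S `<=` acl T -> acl S `<=` acl T.
Proof. by move=> ST; apply: acl_min ST; [apply: acl_subfield|apply: acl_closed]. Qed.

Lemma acl_mono S T : S `<=` T -> acl S `<=` acl T.
Proof. by move=> ST; apply: acl_sub => x /ST; apply: sub_acl. Qed.

Lemma acl_exchange S x y : acl (S `|` [set y]) x -> ~ acl S x ->
  acl (S `|` [set x]) y.
Proof.
move=> ax nax; have [rC iC] := acl_subfield S; have rA := adjoin_subring y rC.
have fF := fractions_subfield rA.
have Dx : alg_over (fractions (adjoin (acl S) y)) x.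
  apply: ax; [exact: alg_over_subfield|exact: alg_over_closed|].
  move=> z Sz; apply: (alg_over_id (proj1 fF)); apply: (fractions_id rA).
  case: Sz => [Sz|->]; last exact: adjoin_gen.
  by apply: adjoin_sub => //; apply: sub_acl.
have := alg_exchange (acl_subfield S) (@acl_closed S) (alg_over_fractions rA Dx) nax.
move=> H; apply: acl_closed; apply: sub_alg_over H => _ [p Sp ->].
have [rC' _] := acl_subfield (S `|` [set x]).
apply: (subring_horner rC'); last by apply: sub_acl; right.
by move=> i; apply: acl_mono (Sp i) => z; left.
Qed.

Fixpoint acl_free S s :=
  if s is x :: s' then ~ acl (S `|` [set` s']) x /\ acl_free S s' else True.

Lemma acl_seq1 S s x : S `|` [set` x :: s] = S `|` [set` s] `|` [set x].
Proof.
apply/seteqP; split=> y /=; rewrite inE.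
  by move=> [Sy|/predU1P[->|sy]]; [left; left|right|left; right].
by move=> [[Sy|sy]|->]; [left|right; rewrite sy orbT|right; rewrite eqxx].
Qed.

(** The elements of s replace elements of t one at a time, without changing
    the closure. *)
Lemma steinitz S s t : acl_free S s -> (forall x, x \in s -> acl (S `|` [set` t]) x) ->
  (size s <= size t)%N.
Proof.
move=> free st.
suff [t' [sz _]] : exists t', (size t' + size s = size t)%N /\
    [set` t] `<=` acl (S `|` [set` s] `|` [set` t']).
  by rewrite -sz leq_addl.
elim: s free st => [_ _|x s IH [nx free] st].
  by exists t; rewrite addn0; split=> // y ty; apply: sub_acl; right.
have [|t' [sz tt']] := IH free.
  by move=> y ys; apply: st; rewrite inE ys orbT.
have ax : acl (S `|` [set` s] `|` [set` t']) x.
  have := st x; rewrite inE eqxx => /(_ isT); apply: acl_sub.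
  by move=> y [Sy|/tt'//]; apply: sub_acl; left; left.
(* the first element of t' whose addition makes x dependent *)
have [t1 [y [t2 [Et ay nay]]]] : exists t1 y t2, [/\ t' = t1 ++ y :: t2,
    acl (S `|` [set` s] `|` [set` t1] `|` [set y]) x &
    ~ acl (S `|` [set` s] `|` [set` t1]) x].
  elim/last_ind: t' ax {sz tt'} => [|t' y IHt] ax.
    by case: nx; apply: acl_mono ax => y [//|].
  have [ax'|nax] := pselect (acl (S `|` [set` s] `|` [set` t']) x).
    have [t1 [z [t2 [-> az naz]]]] := IHt ax'.
    by exists t1, z, (rcons t2 y); rewrite rcons_cat.
  exists t', y, [::]; rewrite cats1; split=> //.
  apply: acl_mono ax => z [Sz|/=]; first by left; left.
  by rewrite mem_rcons inE => /predU1P[->|zt]; [right|left; right].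
have axy := acl_exchange ay nay.
exists (t1 ++ t2); split.
  by rewrite -sz Et !size_cat /= !addnS addSn.
move=> z /tt'; apply: acl_sub => {}z [Sz|/=].
  by apply: sub_acl; left; rewrite acl_seq1; left.
have t12 w : w \in t1 ++ t2 -> acl (S `|` [set` x :: s] `|` [set` t1 ++ t2]) w.
  by move=> wt; apply: sub_acl; right.
rewrite Et mem_cat inE => /or3P[zt|/eqP->|zt].
- by apply: t12; rewrite mem_cat zt.
- apply: acl_mono axy => w; rewrite acl_seq1 => -[[Sw|wt]|->].
  + by left; left.
  + by right; rewrite /= mem_cat wt.
  + by left; right.
- by apply: t12; rewrite mem_cat zt orbT.
Qed.

End Steinitz.

(** * Ultrapowers of a field *)

Section Ultraproduct.
Local Open Scope quotient_scope.
Variables (T : pointedType) (K : fieldType) (U : set_system T) (UU : UltraFilter U).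

(** Functions that vanish on a set of the ultrafilter; the proof argument is the
    one that makes them an ideal. *)
Definition ae_zero (_ : UltraFilter U) : pred (T -> K) :=
  fun f => `[< U [set t | f t = 0] >].

Lemma ultra_filter : Filter U.
Proof. exact: (@filter_filter _ _ (ultra_proper)). Qed.

Lemma ae_zero_idealr : idealr_closed (ae_zero UU).
Proof.
have FU := ultra_filter.
split.
- by apply/asboolP; apply: filterS filterT => t _.
- apply/negP => /asboolP U0; apply: (@filter_not_empty _ _ (ultra_proper)).
  by apply: filterS U0 => t /= /eqP; rewrite oner_eq0.
move=> a u v /asboolP Uu /asboolP Uv; apply/asboolP.
apply: filterS2 Uu Uv => t /= u0 v0.
by have -> : (a * u + v) t = a t * u t + v t by []; rewrite u0 v0 mulr0 addr0.
Qed.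

HB.instance Definition _ := isIdealr.Build (T -> K) (ae_zero UU) ae_zero_idealr.

Local Notation R := (T -> K : comNzRingType).
Definition ultra_ideal : idealr R := ae_zero UU.
Definition ultrapower := {ideal_quot ultra_ideal}.
HB.instance Definition _ := GRing.ComNzRing.on ultrapower.

Definition ultra_class : (T -> K) -> ultrapower := \pi_ultrapower.
HB.instance Definition _ := GRing.RMorphism.on ultra_class.

Lemma ultra_eq0 (f : T -> K) : ultra_class f = 0 <-> U [set t | f t = 0].
Proof.
rewrite -(rmorph0 ultra_class).
have -> : (ultra_class f = ultra_class 0) <-> (f - 0) \in ultra_ideal.
  by rewrite Quotient.idealrBE; split=> [/eqP|/eqP].
by rewrite subr0 unfold_in; split=> /asboolP.
Qed.

Lemma ultra_repr (x : ultrapower) : ultra_class (repr x) = x.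
Proof. exact: reprK. Qed.

Definition ultra_inv (x : ultrapower) : ultrapower :=
  ultra_class (fun t => (repr x t)^-1).

(** A function that is not zero in the quotient is invertible on a set of the
    ultrafilter. *)
Lemma ultra_mulVf (x : ultrapower) : x != 0 -> ultra_inv x * x = 1.
Proof.
move=> /eqP x0; rewrite -{2}(ultra_repr x) -rmorphM -(rmorph1 ultra_class).
apply/eqP; rewrite -subr_eq0 -rmorphB; apply/eqP/ultra_eq0.
have [U0|] := in_ultra_setVsetC [set t | repr x t = 0] UU.
  by case: x0; rewrite -(ultra_repr x); apply/ultra_eq0.
apply: (@filterS _ _ ultra_filter) => t /= /eqP rt.
have -> : forall g : T -> K, (g * repr x - 1) t = g t * repr x t - 1 by [].
by rewrite mulVf // subrr.
Qed.

Lemma ultra_inv0 : ultra_inv 0 = 0.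
Proof.
have : U [set t | repr (0 : ultrapower) t = 0] by apply/ultra_eq0; rewrite ultra_repr.
move=> U0; apply/ultra_eq0; apply: (@filterS _ _ ultra_filter) U0 => t /= ->.
by rewrite invr0.
Qed.

HB.instance Definition _ :=
  GRing.ComNzRing_isField.Build ultrapower ultra_mulVf ultra_inv0.

End Ultraproduct.

(** * Chains of irreducible sets and algebraic independence *)

Definition affine_space (K : fieldType) N := 'rV[K]_N.
HB.instance Definition _ K N := Choice.on (affine_space K N).
HB.instance Definition _ K N := isPointed.Build (affine_space K N) (0 : 'rV[K]_N).

Section Vanish.
Variables (K : fieldType) (N : nat).
Implicit Types (Z S V : set 'rV[K]_N) (p q f g : {mpoly K[N]}).

Definition vanish p Z := forall v, Z v -> p.@[v 0] = 0.

Definition prime_set Z := forall f g, vanish (f * g) Z -> vanish f Z \/ vanish g Z.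

Lemma zclosed_vanish p : zclosed [set v : 'rV[K]_N | p.@[v 0] = 0].
Proof. by exists [set p]; apply/seteqP; split=> [v /= pv _ -> //|v /= /(_ p erefl)]. Qed.

(** An irreducible set is not covered by two proper closed subsets f = 0, g = 0. *)
Lemma irreducible_prime Z : irreducible Z -> prime_set Z.
Proof.
move=> [_ H] f g fg.
have [//|Zf|Zg] := H _ _ (zclosed_vanish f) (zclosed_vanish g).
- move=> v Zv /=; have /eqP := fg v Zv; rewrite mevalM mulf_eq0.
  by move=> /orP[/eqP|/eqP]; [left|right].
- by left=> v /Zf.
- by right=> v /Zg.
Qed.

(** A strictly increasing chain of irreducible sets, with polynomials that
    witness the strictness. *)
Definition poly_chain (Z : nat -> set 'rV[K]_N) (q : nat -> {mpoly K[N]}) m :=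
  [/\ Z 0%N !=set0, forall i, (i <= m)%N -> prime_set (Z i) &
      forall i, (i < m)%N -> [/\ Z i `<=` Z i.+1, vanish (q i) (Z i) & ~ vanish (q i) (Z i.+1)]].

(** As Z_i is closed in X, an equation of Z_i separates it from a point of
    Z_(i+1). *)
Lemma irr_chain_poly (X : set 'rV[K]_N) m : irr_chain X m ->
  exists (Z : nat -> set 'rV[K]_N) (q : nat -> {mpoly K[N]}),
    poly_chain Z q m /\ Z m `<=` X.
Proof.
move=> [Z [cZ ltZ]].
have : forall i, exists p, (i < m)%N -> vanish p (Z i) /\ ~ vanish p (Z i.+1).
  move=> i; have [lt|_] := ltnP i m; last by exists 0.
  have [[F [E ->] EZ] _] := cZ i (ltnW lt).
  have [sub nsub] := ltZ i lt.
  have [v [Zv nZv]] : exists v, Z i.+1 v /\ ~ Z i v.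
    apply: contrapT => H; apply: nsub => v Zv; apply: contrapT => nZ.
    by apply: H; exists v.
  have Xv : X v by have [[F' _ E'] _] := cZ i.+1 lt; move: Zv; rewrite E' => -[].
  have [p [Ep pv]] : exists p, E p /\ p.@[v 0] <> 0.
    apply: contrapT => H; apply: nZv; rewrite EZ; split=> // p Ep.
    by apply: contrapT => pv; apply: H; exists p.
  exists p => _; split=> [w|/(_ v Zv)//].
  by rewrite EZ => -[_ /(_ p Ep)].
move=> /choice[q Hq]; exists Z, q; split; last first.
  by have [[F _ ->] _] := cZ m (leqnn m); move=> v [].
split=> [|i le|i lt].
- by have [_ []] := cZ 0%N (leq0n m).
- by have [_ /irreducible_prime] := cZ i le.
- by have [? ?] := Hq i lt; have [? _] := ltZ i lt.
Qed.

End Vanish.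

Section ChainFree.
Variables (K : fieldType) (N : nat).
Implicit Types (S V : set 'rV[K]_N) (p f g : {mpoly K[N]}).
Variables (Z : nat -> set 'rV[K]_N) (q : nat -> {mpoly K[N]}) (m : nat).
Hypothesis chain : poly_chain Z q m.

(** The ring K[q_0, ..., q_(i-1)]. *)
Fixpoint tower i : set {mpoly K[N]} :=
  if i is j.+1 then adjoin (tower j) (q j) else [set p | exists c, p = c%:MP].

Lemma tower_subring i : subring (tower i).
Proof.
elim: i => [|i IH] /=; last exact: adjoin_subring.
split=> [|_ _ [c ->] [d ->]|_ _ [c ->] [d ->]].
- by exists 1.
- by exists (c - d); rewrite mpolyCB.
- by exists (c * d); rewrite mpolyCM.
Qed.

Lemma chain_sub i j : (i <= j <= m)%N -> Z i `<=` Z j.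
Proof.
move=> /andP[]; elim: j => [|j IH]; first by rewrite leqn0 => /eqP-> _.
rewrite leq_eqVlt => /predU1P[-> _ //|le lt].
have [_ _ /(_ j lt)[sub _ _]] := chain.
exact: subset_trans (IH le (ltnW lt)) sub.
Qed.

(** An element of K[q_0, ..., q_(i-1)] that vanishes on Z_i vanishes on Z_m:
    this is how algebraic independence propagates along the chain. *)
Definition coef_rigid i :=
  forall b, tower i b -> vanish b (Z i) -> vanish b (Z m).

(** By induction on k, the terms of degree less than k in q_i vanish, and q_i^k
    can be cancelled since Z_(i+1) is irreducible; on Z_i, where q_i is zero,
    what remains is the coefficient of degree k. *)
Lemma tower_coef i (p : {poly {mpoly K[N]}}) : (i < m)%N -> coef_rigid i ->
  poly_in (tower i) p -> vanish p.[q i] (Z i.+1) -> forall k, vanish p`_k (Z m).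
Proof.
move=> lt rig Bp pq; have [_ prZ /(_ i lt)[sub qZ nqZ]] := chain.
move=> k; elim/ltn_ind: k => k IH; apply: rig => // v Zv.
have prime := prZ i.+1 lt.
have E : p.[q i] = (take_poly k p).[q i] + (drop_poly k p).[q i] * q i ^+ k.
  by rewrite -{1}(poly_take_drop k p) hornerD hornerM hornerXn.
have : vanish ((drop_poly k p).[q i] * q i ^+ k) (Z i.+1).
  move=> w Zw; have := pq w Zw; rewrite E mevalD => <-.
  rewrite [X in _ = X + _](_ : _ = 0) ?add0r //.
  rewrite horner_coef raddf_sum big1 // => l _.
  rewrite /= mevalM coef_take_poly; case: ltnP => lk; last by rewrite meval0 mul0r.
  by rewrite (IH l lk) ?mul0r //; apply: (@chain_sub i.+1); rewrite ?lt ?leqnn.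
case/prime => [dv|qk]; last first.
  case: nqZ => w Zw; apply/eqP; have := qk w Zw; rewrite rmorphXn /=.
  by move/eqP; rewrite expf_eq0 => /andP[].
have := dv v (sub v Zv).
rewrite -[drop_poly k p](poly_take_drop 1) hornerD hornerM hornerXn expr1.
rewrite mevalD mevalM (qZ v Zv) mulr0 addr0.
rewrite (size1_polyC (size_take_poly _ _)) hornerC coef_take_poly /= coef_drop_poly.
by rewrite add0n.
Qed.

Lemma tower_rigid i : (i <= m)%N -> coef_rigid i.
Proof.
elim: i => [|i IH] le.
  move=> _ [c ->] H v _; have [[w Zw] _ _] := chain.
  by have := H w Zw; rewrite !mevalC.
move=> _ [p Bp ->] H v Zv; rewrite horner_coef raddf_sum big1 // => l _.
by rewrite /= mevalM (tower_coef le (IH (ltnW le)) Bp H _ Zv) mul0r.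
Qed.

End ChainFree.

Section UltraCoordinates.
Variables (K : fieldType) (N : nat).
Implicit Types (S V : set 'rV[K]_N) (p f g : {mpoly K[N]}).
Variables (U : set_system (affine_space K N)) (UU : UltraFilter U).

(** The value of p at the generic point. *)
Definition mclass p : ultrapower K UU := ultra_class UU (fun v : affine_space K N => p.@[(v : 'rV_N) 0]).

Lemma mclass_is_zmod : zmod_morphism mclass.
Proof.
move=> p r; rewrite /mclass -rmorphB; congr ultra_class.
by apply/funext => v; rewrite mevalB.
Qed.
HB.instance Definition _ := GRing.isZmodMorphism.Build _ _ mclass mclass_is_zmod.
Lemma mclass_is_monoid : monoid_morphism mclass.
Proof.
split=> [|p r].
  by rewrite /mclass -(rmorph1 (ultra_class UU)); congr ultra_class;
    apply/funext => v; rewrite meval1.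
rewrite /mclass -rmorphM; congr ultra_class.
by apply/funext => v; rewrite mevalM.
Qed.
HB.instance Definition _ := GRing.isMonoidMorphism.Build _ _ mclass mclass_is_monoid.

Definition base : set (ultrapower K UU) := [set x | exists c, x = mclass c%:MP].

Lemma mclass_eq0 p : mclass p = 0 <-> U [set v : 'rV[K]_N | p.@[v 0] = 0].
Proof. exact: ultra_eq0. Qed.

Lemma base_subring : subring base.
Proof.
split=> [|_ _ [c ->] [d ->]|_ _ [c ->] [d ->]].
- by exists 1; rewrite rmorph1.
- by exists (c - d); rewrite mpolyCB rmorphB.
- by exists (c * d); rewrite mpolyCM rmorphM.
Qed.

Lemma mclass_in (C : set (ultrapower K UU)) p : subring C -> base `<=` C ->
  (forall i, C (mclass 'X_i)) -> C (mclass p).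
Proof.
move=> rC bC XC; elim/mpolyind: p => [|c mm p _ _ IH].
  by rewrite rmorph0; apply: subring0.
rewrite rmorphD -mul_mpolyC rmorphM; apply: subringD => //.
apply: subringM => //; first by apply: bC; exists c.
rewrite mpolyXE_id rmorph_prod /=; apply: subring_prod => // i _.
by rewrite rmorphXn; apply: subringX.
Qed.

Lemma ultra_bigcup k (V : nat -> set 'rV[K]_N) S :
  U S -> (forall v, S v -> exists2 i, (i < k)%N & V i v) ->
  exists2 i, (i < k)%N & U (V i).
Proof.
move=> US cover; apply: contrapT => H.
have FU := ultra_filter UU.
have UC i : (i < k)%N -> U (~` V i).
  move=> lt; case: (in_ultra_setVsetC (V i) UU) => // UV.
  by case: H; exists i.
have : forall j, (j <= k)%N -> U [set v | forall i, (i < j)%N -> ~ V i v].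
  elim=> [|j IH] le; first by apply: filterS filterT.
  apply: filterS2 (IH (ltnW le)) (UC j le) => v H1 H2 i.
  by rewrite ltnS leq_eqVlt => /predU1P[->|/H1].
move=> /(_ k (leqnn k)) Uk; apply: (@filter_not_empty _ _ (ultra_proper)).
by apply: filterS2 US Uk => v /cover[i lt Vi] /(_ i lt).
Qed.

Section Generic.
Variables (Z : nat -> set 'rV[K]_N) (q : nat -> {mpoly K[N]}) (m : nat).
Hypothesis chain : poly_chain Z q m.
Hypothesis generic : forall p, mclass p = 0 <-> vanish p (Z m).

Fixpoint chain_seq i : seq (ultrapower K UU) :=
  if i is j.+1 then mclass (q j) :: chain_seq j else [::].

Fixpoint chain_ring i : set (ultrapower K UU) :=
  if i is j.+1 then adjoin (chain_ring j) (mclass (q j)) else base.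

Lemma chain_ring_subring i : subring (chain_ring i).
Proof. by elim: i => [|i IH] /=; [exact: base_subring|exact: adjoin_subring]. Qed.

Lemma chain_ring_poly i x : chain_ring i x -> exists2 b, tower q i b & x = mclass b.
Proof.
elim: i x => [_ [c ->]|i IH _ [p Bp ->]] /=; first by exists c%:MP => //; exists c.
have /choice[b Hb] : forall k, exists b, tower q i b /\ p`_k = mclass b.
  by move=> k; have [b ? ?] := IH _ (Bp k); exists b.
have rT := tower_subring q i.
exists (\poly_(k < size p) b k).[q i].
  exists (\poly_(k < size p) b k) => // k; rewrite coef_poly.
  by case: ltnP => _; [exact: (Hb k).1|exact: (subring0 rT)].
rewrite -horner_map; congr horner; apply/polyP => k.
rewrite coef_map coef_poly; case: ltnP => [_|le]; first exact: (Hb k).2.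
by rewrite nth_default // raddf0.
Qed.

Lemma chain_ring_base i : base `<=` chain_ring i.
Proof.
elim: i => //= i IH x /IH; apply: adjoin_sub; exact: chain_ring_subring.
Qed.

Lemma chain_ring_seq i x : x \in chain_seq i -> chain_ring i x.
Proof.
elim: i => //= i IH; rewrite inE => /predU1P[->|/IH].
  by apply: adjoin_gen; apply: chain_ring_subring.
by apply: adjoin_sub; apply: chain_ring_subring.
Qed.

(** An equation of q_i over K[q_0, ..., q_(i-1)] lifts to a polynomial relation
    that holds on Z_m, hence on Z_(i+1), so all its coefficients vanish. *)
Lemma chain_seq_free i : (i <= m)%N -> acl_free base (chain_seq i).
Proof.
elim: i => //= i IH lt; split; last exact: IH (ltnW lt).
have rB := chain_ring_subring i => ai.
have fF := fractions_subfield rB.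
have : alg_over (fractions (chain_ring i)) (mclass (q i)).
  apply: ai; [exact: alg_over_subfield|exact: alg_over_closed|].
  move=> x Sx; apply: (alg_over_id (proj1 fF)); apply: (fractions_id rB).
  by case: Sx => [/chain_ring_base//|/chain_ring_seq].
move=> /(alg_over_fractions rB)[p [p0 Bp px]].
have /choice[b Hb] : forall k, exists b, tower q i b /\ p`_k = mclass b.
  by move=> k; have [b ? ?] := chain_ring_poly (Bp k); exists b.
pose P := \poly_(k < size p) b k.
have rT := tower_subring q i.
have BP : poly_in (tower q i) P.
  by move=> k; rewrite coef_poly; case: ltnP => _; [exact: (Hb k).1|exact: (subring0 rT)].
have Pp : map_poly mclass P = p.
  apply/polyP => k; rewrite coef_map coef_poly; case: ltnP => [_|le].
    by rewrite (Hb k).2.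
  by rewrite nth_default // raddf0.
have Pq : vanish P.[q i] (Z i.+1).
  have : vanish P.[q i] (Z m).
    by apply/generic; rewrite -horner_map Pp; apply/eqP.
  by move=> H v Zv; apply: H; apply: (chain_sub chain _ Zv); rewrite lt leqnn.
have Pk := tower_coef chain lt (tower_rigid chain (ltnW lt)) BP Pq.
case/eqP: p0; apply/polyP => k; rewrite -Pp coef_map coef0.
exact/generic/Pk.
Qed.

Lemma size_chain_seq i : size (chain_seq i) = i.
Proof. by elim: i => //= i ->. Qed.

Lemma chain_seq_in (C : set (ultrapower K UU)) i : subring C -> base `<=` C ->
  (forall i, C (mclass 'X_i)) -> forall x, x \in chain_seq i -> C x.
Proof.
move=> rC bC XC; elim: i => //= i IH x; rewrite inE => /predU1P[->|/IH//].
exact: mclass_in.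
Qed.

End Generic.

End UltraCoordinates.

(** The dimension of V is at most D, in the sense that at every generic point
    of V the coordinates are algebraic over D elements. *)
Definition param_dim (K : fieldType) N (V : set 'rV[K]_N) (D : nat) :=
  forall (U : set_system (affine_space K N)) (UU : UltraFilter U), U V ->
  exists2 t : seq (ultrapower K UU), (size t <= D)%N &
    forall i, acl (@base K N U UU `|` [set` t]) (mclass UU 'X_i).

(** Only a dense subset S of Z_m has to be covered by sets of dimension at most
    D: the nonempty open subsets of S have the finite intersection property,
    since Z_m is irreducible. *)
Lemma dim_bound (K : fieldType) N (Z : nat -> set 'rV[K]_N) q m (S : set 'rV[K]_N)
    k (V : nat -> set 'rV[K]_N) D :
  poly_chain Z q m -> S `<=` Z m -> (forall p, vanish p S -> vanish p (Z m)) ->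
  (forall v, S v -> exists2 i, (i < k)%N & V i v) ->
  (forall i, (i < k)%N -> param_dim (V i) D) -> (m <= D)%N.
Proof.
move=> chain SZ dense cover Vdim.
pose F : set_system (affine_space K N) :=
  [set A | exists2 p : {mpoly K[N]}, ~ vanish p (Z m) & forall v, S v -> p.@[v 0] <> 0 -> A v].
have [Z0 prZ _] := chain.
have FF : ProperFilter F.
  split; last split.
  - case=> p nv H; apply: nv; apply: dense => v Sv; apply: contrapT => pv.
    exact: (H v Sv pv).
  - exists 1 => // H; have [v Zv] : Z m !=set0.
      by have [v Zv] := Z0; exists v; apply: (chain_sub chain _ Zv); rewrite leqnn.
    by have := H v Zv; rewrite meval1; apply/eqP; rewrite oner_eq0.
  - move=> A B [p np HA] [r nr HB]; exists (p * r).
      by move=> /(prZ m (leqnn m))[].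
    move=> v Sv; rewrite mevalM => /eqP; rewrite mulf_eq0 negb_or => /andP[/eqP p0 /eqP r0].
    by split; [apply: HA|apply: HB].
  - by move=> A B AB [p np HA]; exists p => // v Sv pv; apply: AB; apply: HA.
have [U [UU FU]] := ultraFilterLemma FF.
have US : U S.
  apply: FU; exists 1 => // H; have [v Zv] : Z m !=set0.
    by have [v Zv] := Z0; exists v; apply: (chain_sub chain _ Zv); rewrite leqnn.
  by have := H v Zv; rewrite meval1; apply/eqP; rewrite oner_eq0.
have generic p : mclass UU p = 0 <-> vanish p (Z m).
  split=> [/mclass_eq0 Up|pZ]; last first.
    apply/mclass_eq0; apply: (@filterS _ _ (ultra_filter UU)) US => v /SZ.
    exact: pZ.
  apply: contrapT => np; apply: (@filter_not_empty _ _ (ultra_proper)).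
  have Unp : U [set v | S v /\ p.@[v 0] <> 0] by apply: FU; exists p.
  by apply: (@filterS2 _ _ (ultra_filter UU)) Up Unp => v /= p0 [].
have [i lt UV] := ultra_bigcup UU US cover.
have [t st Xt] := Vdim i lt U UU UV.
apply: leq_trans st; rewrite -{1}(size_chain_seq UU q m).
apply: (steinitz (chain_seq_free chain generic (leqnn m))).
have [rC _] := acl_subfield (@base K N U UU `|` [set` t]).
apply: chain_seq_in => //.
by move=> x bx; apply: sub_acl; left.
Qed.

(** * Coefficients of the roots of a polynomial *)

Lemma poly_in_subring (R : comNzRingType) (B : set R) :
  subring B -> subring (poly_in B : set {poly R}).
Proof.
move=> rB; split=> [|p q|p q].
- by rewrite -(@polyC1 R); apply: poly_inC => //; apply: subring1.
- exact: poly_inB.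
- exact: poly_inM.
Qed.

Section RootCoefficients.
Variables (L : fieldType) (C : set L).
Hypotheses (fC : subfield C) (closedC : alg_closed_in C).
Let rC : subring C := proj1 fC.

Definition poly2_in (P : {poly {poly L}}) := poly_in (poly_in C) P.

Lemma poly2_in_comp P G : poly2_in P -> poly2_in G -> poly2_in (P \Po G).
Proof.
move=> CP CG; have r1 := poly_in_subring rC.
have r2 := poly_in_subring r1.
rewrite comp_polyE; apply: (subring_sum r2) => i _.
rewrite -mul_polyC; apply: (subringM r2); last exact: (subringX r2).
exact: (poly_inC r1 (CP i)).
Qed.

Lemma poly_in_Xn n : poly_in C 'X^n.
Proof.
exact: (subringX (poly_in_subring rC) n (poly_inX rC)).
Qed.

(** The largest power of x that divides W. *)
Lemma divide_inner (W : {poly {poly L}}) : W != 0 -> exists m S,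
  W = ('X^m)%:P * S /\ map_poly (horner_eval 0) S != 0.
Proof.
have [s] := ubnP (sizeY W); elim: s W => // s IH W; rewrite ltnS => sW W0.
have [E|] := eqVneq (map_poly (horner_eval 0) W) 0; last first.
  by exists 0%N, W; rewrite expr0 mul1r.
have [W' EW] := factor_inner E; rewrite subr0 in EW.
have W'0 : W' != 0 by apply: contraNneq W0 => W'0; rewrite EW W'0 mulr0.
have [|m [S [ES S0]]] := IH W' _ W'0.
  move: sW; rewrite EW sizeYM //; last by rewrite polyC_eq0 polyX_eq0.
  by rewrite sizeY_polyC size_polyX.
exists m.+1, S; split=> //.
by rewrite EW ES mulrA -polyCM -exprS.
Qed.

(** The coefficients of f are found one after the other as roots of nonzero
    polynomials over the field generated by the previous ones. *)
Lemma root_coef_in P f : P != 0 -> poly2_in P -> subst P f = 0 ->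
  forall n, C (fps_coef f n).
Proof.
move=> P0 CP Pf; elim/ltn_ind => n IH.
pose g := \poly_(i < n) fps_coef f i.
pose t : fps L := Fps (fun i => fps_coef f (i + n)).
pose G := g%:P + ('X^n)%:P * 'X : {poly {poly L}}.
have ft : f = subst G t.
  rewrite substD substM !substC substX; apply: fpsP => i.
  rewrite fps_coefD fps_coefXnM fps_coef_poly coef_poly.
  by case: ltnP => [_|le]; rewrite ?addr0 // add0r /= subnK.
have sG : size G = 2 by apply: size_linear.
have W0 : P \Po G != 0 by rewrite -size_poly_gt0 size_comp_poly2 // size_poly_gt0.
have CG : poly2_in G.
  have r1 := poly_in_subring rC; have r2 := poly_in_subring r1.
  apply: (subringD r2).
    apply: (poly_inC r1) => i; rewrite coef_poly; case: ltnP => [/IH//|_].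
    exact: subring0.
  apply: (subringM r2); first by apply: (poly_inC r1); apply: poly_in_Xn.
  exact: poly_inX.
have CW := poly2_in_comp CP CG.
have [m [S [ES S0]]] := divide_inner W0.
have CS : poly2_in S.
  move=> j i; have := CW j (i + m)%N; rewrite ES coefCM coefXnM.
  by rewrite ltnNge leq_addl /= addnK.
have St : subst S t = 0.
  apply: (@fpsXn_inj _ m); rewrite mulr0.
  by rewrite -(substC 'X^m t) -substM -ES subst_comp -ft.
apply: closedC; exists (map_poly (horner_eval 0) S); split=> //.
  by move=> j; rewrite coef_map /= /horner_eval horner_coef0; apply: CS.
by rewrite /root -[fps_coef f n]/(fps_coef t 0) -fps_coef0_subst St.
Qed.

(** The series f = f0 + x^e f1 is a root of the multiple of P by 1/p_k, so the
    coefficients of f0 are in C. Then so are those of x^(-2e) P(x, f0 + x^e T) / p_k,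
    which is Q / p_k; as one coefficient of Q is 1, those of Q are in C too. *)
Lemma reparam_algebraic d h e n (pL : 'rV[L]_(num_bip d h))
    (wL : 'rV[L]_(e + dimI d (Posz n))) k : (0 < d)%N ->
  pL 0 k != 0 -> reparam_eq pL wL = 0 -> (forall j, C (pL 0 j / pL 0 k)) ->
  forall i, C (wL 0 i).
Proof.
move=> d0 pLk EL ratio.
pose u := (pL 0 k)^-1; have u0 : u != 0 by rewrite invr_eq0.
pose P := u%:P%:P * bipoly pL; pose a := lsubmx wL; pose c := rsubmx wL.
move/subr0_eq: EL => EL.
have CP : poly2_in P.
  move=> j i; rewrite /P mul_polyC coefZ coefCM coef_bipoly.
  case: ifP => _; last by rewrite mulr0; apply: subring0.
  set l := (i * d.+1 + j)%N; have [lt|le] := ltnP l (num_bip d h).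
    by rewrite -[l]/(val (Ordinal lt)) coef_rVpoly_ord mulrC; apply: ratio.
  by rewrite rVpoly_default // mulr0; apply: subring0.
have P0 : P != 0.
  rewrite mulf_neq0 // ?polyC_eq0 //; apply: contraNneq pLk => B0.
  have <- : (bipoly pL)`_(k %% d.+1)`_(k %/ d.+1) = pL 0 k.
    rewrite coef_bipoly ltn_pmod // ltn_divLR // -divn_eq coef_rVpoly_ord.
    by rewrite [(h.+1 * _)%N]mulnC ltn_ord.
  by rewrite B0 !coef0.
have EP : P \Po shift a = ('X^(2 * e))%:P * (u%:P%:P * nform c).
  by rewrite comp_polyM comp_polyC EL mulrCA.
have [|g g0 Qg] := @hensel_exists _ (nform c) (nform00 c).
  by rewrite nform10 // oner_neq0.
have Pf : subst P (subst (shift a) g) = 0.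
  by rewrite -subst_comp EP !substM Qg !mulr0.
have Cf := root_coef_in P0 CP Pf.
have Ca i : C (a 0 i).
  have [Ea _] := phi_decomp_unique a g0.
  have := Cf i.+1; rewrite subst_shift.
  by move: Ea => /rowP/(_ i); rewrite mxE => ->.
have CQ : poly2_in (u%:P%:P * nform c).
  have Cs : poly2_in (shift a).
    have r1 := poly_in_subring rC; have r2 := poly_in_subring r1.
    apply: (subringD r2).
      apply: (poly_inC r1); apply: (subring_sum r1) => i _.
      rewrite -mul_polyC; apply: (subringM r1); first exact: (poly_inC rC).
      exact: poly_in_Xn.
    apply: (subringM r2); first by apply: (poly_inC r1); apply: poly_in_Xn.
    exact: poly_inX.
  move=> j i; have := poly2_in_comp CP Cs j (i + 2 * e)%N.
  by rewrite EP coefCM coefXnM ltnNge leq_addl /= addnK.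
have Cu : C u.
  by have := CQ 1%N 0%N; rewrite mul_polyC coefZ coefCM nform10 // mulr1.
have Cc i : C (c 0 i).
  rewrite -(poly_coords_nform c d0) mxE.
  set x := (_ %% _)%N; set y := (_ %/ _)%N.
  have := CQ x y; rewrite mul_polyC coefZ coefCM => Cux.
  by rewrite -[_`_y](mulKf u0); apply: (subringM rC) => //; apply: (proj2 fC).
move=> i; rewrite -[wL]hsubmxK mxE; case: (fintype.split i) => l; [exact: Ca|exact: Cc].
Qed.

End RootCoefficients.


(** * The dimension of a stratum *)

(** Transfers to the generic point, where [cl] takes the values, an identity
    that is known at the points of a set of the ultrafilter. *)
Lemma ae_poly_eq0 (T : Type) (R S : comNzRingType) (F : fieldType)
    (ev : T -> {rmorphism R -> S}) (cl : {rmorphism R -> F})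
    (E : {poly {poly R}}) (V : set T) :
  (forall x, (forall t, V t -> ev t x = 0) -> cl x = 0) ->
  (forall t, V t -> map_poly (map_poly (ev t)) E = 0) ->
  map_poly (map_poly cl) E = 0.
Proof.
move=> Hcl H; apply: poly2P => i j; rewrite !coef_map /= !coef0.
apply: Hcl => t /H Et.
have := congr1 (fun P : {poly {poly S}} => P`_j`_i) Et.
by rewrite !coef_map /= !coef0.
Qed.

Section PointEvaluation.
Variables (T : pointedType) (K : fieldType).
Definition fun_ring : comNzRingType := (T -> K : comNzRingType).
Definition eval_at (t : T) (f : fun_ring) : K := (f : T -> K) t.
Lemma eval_at_is_zmod t : zmod_morphism (eval_at t). Proof. by []. Qed.
HB.instance Definition _ t := GRing.isZmodMorphism.Build fun_ring K (eval_at t)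
  (eval_at_is_zmod t).
Lemma eval_at_is_monoid t : monoid_morphism (eval_at t). Proof. by []. Qed.
HB.instance Definition _ t := GRing.isMonoidMorphism.Build fun_ring K (eval_at t)
  (eval_at_is_monoid t).

Definition row_fun n (w : T -> 'rV[K]_n) : 'rV[fun_ring]_n :=
  \row_i ((fun t => w t 0 i) : fun_ring).

Lemma eval_row_fun n (w : T -> 'rV[K]_n) t : map_mx (eval_at t) (row_fun w) = w t.
Proof. by apply/rowP => i; rewrite !mxE. Qed.

Variables (U : set_system T) (UU : UltraFilter U).

Definition generic_value (f : fun_ring) : ultrapower K UU := ultra_class UU f.
Lemma generic_value_is_zmod : zmod_morphism generic_value.
Proof. exact: (rmorphB (ultra_class UU)). Qed.
HB.instance Definition _ := GRing.isZmodMorphism.Build fun_ring (ultrapower K UU)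
  generic_value generic_value_is_zmod.
Lemma generic_value_is_monoid : monoid_morphism generic_value.
Proof. by split; [exact: (rmorph1 (ultra_class UU))|exact: (rmorphM (ultra_class UU))]. Qed.
HB.instance Definition _ := GRing.isMonoidMorphism.Build fun_ring (ultrapower K UU)
  generic_value generic_value_is_monoid.

Lemma generic_eq0 (f : fun_ring) : generic_value f = 0 <-> U [set t | eval_at t f = 0].
Proof. exact: ultra_eq0. Qed.

Lemma generic_eq0_in (V : set T) (f : fun_ring) : U V ->
  (forall t, V t -> eval_at t f = 0) -> generic_value f = 0.
Proof.
by move=> UV H; apply/generic_eq0; apply: (@filterS _ _ (ultra_filter UU)) UV.
Qed.

End PointEvaluation.

Lemma base_const (K : fieldType) N (U : set_system (affine_space K N))
    (UU : UltraFilter U) (x : K) : @base K N U UU (generic_value UU (fun=> x)).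
Proof. by exists x; congr ultra_class; apply/funext => v; rewrite mevalC. Qed.

Section StratumDim.
Variables (K : closedFieldType) (d h e n N : nat).
Hypothesis d0 : (0 < d)%N.

(** The equation P(0,0) = 0 is P(x,f) = 0 at x = 0. *)
Lemma stratum_data (a : 'rV[K]_e) (c : 'rV[K]_(dimI d (Posz n))) :
  stratum h a c -> exists p : 'rV[K]_(num_bip d h),
  [/\ bipoly p != 0, (bipoly p)`_0`_0 = 0 &
      bipoly p \Po shift a = ('X^(2 * e))%:P * nform c].
Proof.
move=> [p [[p0 _ _] E]]; exists p; split=> //.
have [|g g0 Qg] := @hensel_exists K (nform c) (nform00 c).
  by rewrite nform10 // oner_neq0.
have f0 : fps_coef (subst (shift a) g) 0 = 0.
  rewrite subst_shift fps_coefD fps_coef_poly coef0_low_poly add0r.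
  by rewrite fps_coef0M g0 mulr0.
rewrite -(subst_coef0 _ f0) -subst_comp E substM Qg mulr0.
by [].
Qed.

Variables (A : 'M[K]_(e + dimI d (Posz n), N)) (b : 'rV[K]_N).

(** On the stratum choose P as a function of the point. The classes of its
    coefficients satisfy the same equation as P at each point, and one of them,
    p_k, is not zero; p_0 is zero, and p_k / p_k = 1. *)
Lemma stratum_param_dim :
  param_dim [set v | exists2 w : 'rV[K]_(e + dimI d (Posz n)),
     @stratum K d h e n (lsubmx w) (rsubmx w) & v = w *m A + b]
   (d * h + d + h - 1).
Proof.
set V := (X in param_dim X); move=> U UU UV.
pose T : pointedType := affine_space K N.
have /choice[wp Hwp] : forall v : T, exists wp : 'rV[K]_(e + dimI d (Posz n)) * 'rV[K]_(num_bip d h),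
    V v -> [/\ v = wp.1 *m A + b, bipoly wp.2 != 0, (bipoly wp.2)`_0`_0 = 0 &
      bipoly wp.2 \Po shift (lsubmx wp.1) = ('X^(2 * e))%:P * nform (rsubmx wp.1)].
  move=> v; have [[w /stratum_data[p [p0 p00 E]] Ev]|nV] := pselect (V v).
    by exists (w, p).
  by exists (0, 0).
pose w (v : T) := (wp v).1; pose p (v : T) := (wp v).2.
pose phi : {rmorphism fun_ring T K -> ultrapower K UU} := @generic_value T K U UU.
pose wL := map_mx phi (row_fun w); pose pL := map_mx phi (row_fun p).
have EL : reparam_eq pL wL = 0.
  have := @ae_poly_eq0 T (fun_ring T K) K (ultrapower K UU) (@eval_at T K) phi
     (reparam_eq (row_fun p) (row_fun w)) V
     (fun x => @generic_eq0_in T K U UU V x UV).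
  rewrite map_reparam_eq => H; apply: H => v Vv.
  rewrite map_reparam_eq !eval_row_fun /reparam_eq.
  by have [_ _ _ ->] := Hwp v Vv; rewrite subrr.
have p0E (v : T) (i : 'I_(num_bip d h)) : p v 0 i = (rVpoly (p v))`_i.
  by rewrite coef_rVpoly_ord.
have pLE i : U [set v | p v 0 i = 0] <-> pL 0 i = 0.
  by rewrite /pL mxE /phi ultra_eq0 /=; split; apply: (@filterS _ _ (ultra_filter UU)) => v /=; rewrite mxE.
(* a coefficient of P that is almost never zero *)
have [k [k0 pLk]] : exists k : 'I_(num_bip d h), (val k <> 0%N) /\ pL 0 k != 0.
  have [|i lt Ui] := @ultra_bigcup K N U UU (num_bip d h)
     (fun i => [set v | V v /\ (rVpoly (p v))`_i != 0]) V UV _.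
    move=> v Vv; apply: contrapT => H; have [_ /eqP nz _ _] := Hwp v Vv; apply: nz.
    apply: poly2P => i j; rewrite coef_bipoly !coef0; case: ifP => // _.
    set l := (i * d.+1 + j)%N; have [lt|le] := ltnP l (num_bip d h); last first.
      by apply: rVpoly_default.
    by apply/eqP/negPn/negP => nz; apply: H; exists l => //; split.
  exists (Ordinal lt); split=> [/= i0|]; last first.
    apply/eqP => /pLE U0; apply: (@filter_not_empty _ _ (ultra_proper)).
    apply: (@filterS2 _ _ (ultra_filter UU)) Ui U0 => v /= [_ /eqP nz].
    by rewrite p0E.
  apply: (@filter_not_empty _ _ (ultra_proper)).
  apply: (@filterS _ _ (ultra_filter UU)) Ui => v /= [Vv /eqP]; apply.
  have [_ _ p00 _] := Hwp v Vv; rewrite i0.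
  by have := coef_bipoly (p v) 0 0; rewrite /= mul0n add0n => <-.
have num0 : (0 < num_bip d h)%N by [].
pose z : 'I_(num_bip d h) := Ordinal num0.
have pLz : pL 0 z = 0.
  apply/pLE; apply: (@filterS _ _ (ultra_filter UU)) UV => v /= Vv.
  have [_ _ p00 _] := Hwp v Vv; rewrite p0E.
  by have := coef_bipoly (p v) 0 0; rewrite /= mul0n add0n => <-.
pose t := [seq pL 0 j / pL 0 k | j <- enum (predC (pred2 z k))].
exists t.
  rewrite size_map -cardE; have := cardC (pred2 z k); rewrite card_ord card2.
  have -> : z != k by apply: contra_notN k0 => /eqP <-.
  by rewrite /num_bip; move: #|_| => x; nia.
set C := acl _; have fC : subfield C := acl_subfield _.
have [rC iC] := fC; have cC : alg_closed_in C := @acl_closed _ _.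
have bC x : C (phi (fun=> x)).
  by apply: sub_acl; left; exact: base_const.
have ratio j : C (pL 0 j / pL 0 k).
  have [->|jz] := eqVneq j z; first by rewrite pLz mul0r; apply: subring0.
  have [->|jk] := eqVneq j k; first by rewrite divff //; apply: subring1.
  apply: sub_acl; right; apply/mapP; exists j => //.
  by rewrite mem_enum !inE (negPf jz) (negPf jk).
have Cw := @reparam_algebraic _ C fC cC d h e n pL wL k d0 pLk EL ratio.
move=> l; pose cst x : fun_ring T K := fun=> x.
have E0 : phi ((fun v : T => ('X_l : {mpoly K[N]}).@[v 0]) -
    (\sum_j row_fun w 0 j * cst (A j l) + cst (b 0 l))) = 0.
  apply: (generic_eq0_in UU UV) => v Vv; have [Ev _ _ _] := Hwp v Vv.
  rewrite rmorphB rmorphD rmorph_sum /=; apply/eqP; rewrite subr_eq0; apply/eqP.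
  rewrite {1}/eval_at mevalXU [in LHS]Ev !mxE; congr (_ + _).
  by apply: eq_bigr => j _; rewrite rmorphM /= mxE.
have -> : mclass UU 'X_l = \sum_j wL 0 j * phi (cst (A j l)) + phi (cst (b 0 l)).
  apply: subr0_eq; rewrite -[RHS]E0 rmorphB rmorphD rmorph_sum; congr (_ - (_ + _)).
  by apply: eq_bigr => j _; rewrite rmorphM mxE.
apply: (subringD rC); last exact: bC.
apply: (subring_sum rC) => j _; apply: (subringM rC); first exact: Cw.
exact: bC.
Qed.

End StratumDim.

(** * The general normalized polynomial is irreducible *)

Section AffineFlag.
Variables (K : closedFieldType) (N : nat).
Implicit Types (v w p : 'rV[K]_N).

Lemma mpoly_on_line (f : {mpoly K[N]}) v w :
  exists F : {poly K}, forall t, F.[t] = f.@[(v + t *: (w - v)) 0].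
Proof.
elim/mpolyind: f => [|c m f _ _ [F EF]].
  by exists 0 => t; rewrite horner0 meval0.
pose G : {poly K} := \prod_(i < N) ((v 0 i)%:P + (w 0 i - v 0 i)%:P * 'X) ^+ m i.
exists (c%:P * G + F) => t.
rewrite mevalD mevalZ mevalX hornerD hornerM hornerC EF; congr (_ * _ + _).
rewrite horner_prod; apply: eq_bigr => i _.
by rewrite horner_exp !hornerE !mxE mulrC.
Qed.

(** K is infinite: if f is nonzero at v and g is nonzero at w, some point of the
    line through v and w is a zero of neither. *)
Lemma line_prime (Z : set 'rV[K]_N) :
  (forall v w t, Z v -> Z w -> Z (v + t *: (w - v))) -> prime_set Z.
Proof.
move=> lines f g fg; apply: contrapT => /not_orP[nf ng].
have [v [Zv fv]] : exists v, Z v /\ f.@[v 0] <> 0.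
  by apply: contrapT => H; apply: nf => v Zv; apply: contrapT => nz; apply: H; exists v.
have [w [Zw gw]] : exists w, Z w /\ g.@[w 0] <> 0.
  by apply: contrapT => H; apply: ng => w Zw; apply: contrapT => nz; apply: H; exists w.
have [F EF] := mpoly_on_line f v w; have [G EG] := mpoly_on_line g v w.
have F0 : F != 0.
  apply/eqP => F0; apply: fv; have := EF 0.
  by rewrite F0 horner0 scale0r addr0.
have G0 : G != 0.
  apply/eqP => G0; apply: gw; have := EG 1.
  by rewrite G0 horner0 scale1r addrC subrK.
have /closed_nonrootP[t] : F * G != 0 by rewrite mulf_neq0.
rewrite /root hornerM EF EG -mevalM => /eqP; apply; apply: fg.
exact: lines.
Qed.

Definition flag p (i : nat) : set 'rV[K]_N :=
  [set v | forall k : 'I_N, (i <= k)%N -> v 0 k = p 0 k].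

Definition flag_eq p (i : nat) : {mpoly K[N]} :=
  if insub i is Some k then 'X_k - (p 0 k)%:MP else 0.

Lemma flag_prime p i : prime_set (flag p i).
Proof.
apply: line_prime => v w t Zv Zw k le.
by rewrite !mxE Zv // Zw // subrr mulr0 addr0.
Qed.

Lemma flag_eqE p (k : 'I_N) v : (flag_eq p k).@[v 0] = v 0 k - p 0 k.
Proof. by rewrite /flag_eq valK mevalB mevalXU mevalC. Qed.

Lemma flag_full p : flag p N = setT.
Proof. by apply/seteqP; split=> // v _ k; rewrite leqNgt ltn_ord. Qed.

Lemma flag_base p i : flag p i p. Proof. by []. Qed.

Lemma flagS p i : flag p i `<=` flag p i.+1.
Proof. by move=> v H k le; apply: H; apply: ltnW. Qed.

Lemma flag_chain p : poly_chain (flag p) (flag_eq p) N.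
Proof.
split=> [|i _|i lt]; [by exists p|exact: flag_prime|].
pose k := Ordinal lt; split; first exact: flagS.
  by move=> v Zv; rewrite -[i]/(val k) flag_eqE Zv ?subrr.
pose v := p + delta_mx 0 k : 'rV[K]_N.
move=> /(_ v); rewrite -[i in flag_eq _ i]/(val k) flag_eqE !mxE !eqxx addrAC subrr add0r.
move=> H; have /eqP : (1 : K) = 0.
  apply: H => j lej; rewrite !mxE /= (_ : j == k = false) ?addr0 //.
  by apply/eqP => E; move: lej; rewrite E ltnn.
by rewrite oner_eq0.
Qed.

End AffineFlag.

Lemma nform_mul_bipoly_in (R : comNzRingType) (B : set R) d n d2 h2
    (a : 'rV[R]_(dimI d (Posz n))) (b : 'rV[R]_(num_bip d2 h2)) : subring B ->
  (forall i, B (a 0 i)) -> (forall i, B (b 0 i)) ->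
  forall i j, B (nform a * bipoly b)`_j`_i.
Proof.
move=> rB Ba Bb i j; have rP := poly_in_subring (poly_in_subring rB).
have BrV m (v : 'rV[R]_m) x : (forall i, B (v 0 i)) -> B (rVpoly v)`_x.
  move=> Bv; rewrite coef_rVpoly; case: insub => [y|]; first exact: Bv.
  exact: subring0.
apply: (subringM rP) => y x; rewrite (coef_nform, coef_bipoly).
  case: ifP => _; last exact: subring0.
  rewrite /=; case: ifP => _; first exact: subring0.
  by case: ifP => _; [exact: subring1|exact: BrV].
by case: ifP => _; [exact: BrV|exact: subring0].
Qed.

Section Reducible.
Variables (K : closedFieldType) (d h : nat).
Hypotheses (d0 : (0 < d)%N) (h0 : (0 < h)%N).
Let D := (d * h + d + h - 1)%N.

(** The reducible normal forms, sorted by the degrees of the factor that does not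
    vanish at the origin. *)
Definition splits d2 h2 : set 'rV[K]_(dimI d (Posz h)) :=
  [set c | [/\ (d2 < d)%N, (h2 <= h)%N & (0 < d2 + h2)%N] /\
   exists (a : 'rV[K]_(dimI (d - d2) (Posz (h - h2)))) (b : 'rV[K]_(num_bip d2 h2)),
   (bipoly b)`_0`_0 = 1 /\ nform c = nform a * bipoly b].

(** One factor A vanishes at the origin and the other one, B, does not, because
    P_T(0,0) = A_T(0,0) B(0,0) = 1; rescaling makes both values 1. *)
Lemma nform_red c : ~ irred (@nform K d h c) ->
  exists2 ij, (ij.1 <= d)%N && (ij.2 <= h)%N & splits ij.1 ij.2 c.
Proof.
set P := nform c => nirr.
have P10 : P`_1`_0 = 1 by apply: nform10.
have P00 : P`_0`_0 = 0 by apply: nform00.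
have P0 : P != 0.
  by apply: contra_eq_neq P10 => ->; rewrite !coef0 eq_sym oner_eq0.
have Pc : ~ constXY P.
  by move=> [x E]; move/eqP: P10; rewrite E coefC coef0 eq_sym oner_eq0.
have [A [B [E nB A00]]] : exists A B, [/\ P = A * B, ~ constXY B & A`_0`_0 = 0].
  have [A [B [E nA nB]]] : exists A B,
      [/\ P = A * B, ~ constXY A & ~ constXY B].
    apply: contrapT => H; apply: nirr; split=> // A B E; apply: contrapT => /not_orP[nA nB].
    by apply: H; exists A, B.
  move: P00; rewrite E coefM big_ord1 subnn coefM big_ord1 subnn => /eqP.
  rewrite mulf_eq0 => /orP[/eqP A0|/eqP B0]; first by exists A, B.
  by exists B, A; rewrite mulrC.
have A0 : A != 0 by apply: contraNneq P0 => A0; rewrite E A0 mul0r.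
have B0 : B != 0 by apply: contraNneq P0 => B0; rewrite E B0 mulr0.
have AB1 : A`_1`_0 * B`_0`_0 = 1.
  move: P10; rewrite E coefM big_ord_recl big_ord1 /= coefD !coefM !big_ord1 /=.
  by rewrite A00 mul0r add0r.
have A10 : A`_1`_0 != 0.
  by apply: contra_eq_neq AB1 => ->; rewrite mul0r eq_sym oner_eq0.
pose u := (A`_1`_0)^-1; have u0 : u != 0 by rewrite invr_eq0.
pose A' := u%:P%:P * A; pose B' := (A`_1`_0)%:P%:P * B.
have E' : P = A' * B'.
  by rewrite E /A' /B' mulrACA -!rmorphM /= mulVf // mul1r.
have sAB : (size A + size B <= d.+2)%N.
  have := size_nform c; rewrite -/P E size_mul //.
  by move: (size A) (size B) => x y; lia.
have sYAB : (sizeY A + sizeY B <= h.+2)%N.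
  have := sizeY_nform c; rewrite -/P E sizeYM //.
  by move: (sizeY A) (sizeY B) => x y; lia.
have sA2 : (1 < size A)%N.
  rewrite ltnNge; apply: contra A10 => le.
  by rewrite [A`_1]nth_default ?coef0.
have sB1 : (0 < size B)%N by rewrite size_poly_gt0.
have sYA1 : (0 < sizeY A)%N by apply: sizeY_gt0.
have sYB1 : (0 < sizeY B)%N by apply: sizeY_gt0.
pose d2 := (size B).-1; pose h2 := (sizeY B).-1.
have Ed2 : size B = d2.+1 by rewrite prednK.
have Eh2 : sizeY B = h2.+1 by rewrite prednK.
have lt_d2 : (d2 < d)%N by move: sAB sA2; rewrite Ed2; move: (size A) => x; lia.
have le_h2 : (h2 <= h)%N by move: sYAB sYA1; rewrite Eh2; move: (sizeY A) => x; lia.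
have nz : (0 < d2 + h2)%N.
  rewrite lt0n addn_eq0; apply/negP => /andP[/eqP d20 /eqP h20]; apply: nB.
  exists B`_0`_0; rewrite -size1_polyC -?size1_polyC ?Ed2 ?d20 //.
  by rewrite (leq_trans (max_size_coefXY _ _)) // Eh2 h20.
exists (d2, h2); first by rewrite /= le_h2 ltnW.
split=> //=; exists (poly_coords (d - d2) (Posz (h - h2)) A'), (bicoords d2 h2 B').
have sA' : (size A' <= (d - d2).+1)%N.
  by rewrite /A' constXYM_size //; move: sAB; rewrite Ed2; move: (size A) => x; lia.
have sYA' : (sizeY A' <= (h - h2).+1)%N.
  by rewrite /A' constXYM_sizeY //; move: sYAB; rewrite Eh2; move: (sizeY A) => x; lia.
rewrite bicoordsK ?nform_coords ?subn_gt0 //.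
- by rewrite /B' coef_constXYM AB1.
- by rewrite /A' coef_constXYM A00 mulr0.
- by rewrite /A' coef_constXYM mulVf.
- by rewrite /B' constXYM_size // Ed2.
- by rewrite /B' constXYM_sizeY // Eh2.
Qed.

(** With d1 = d - d2 and h1 = h - h2, the factors have
    (d1+1)(h1+1) - 2 + (d2+1)(h2+1) - 1 = (dh+d+h-1) - (d1 h2 + d2 h1) free
    coefficients, and d1 h2 + d2 h1 > 0. *)
Lemma splits_param_dim d2 h2 : param_dim (splits d2 h2) (D - 1).
Proof.
move=> U UU UV.
have [[lt_d2 le_h2 nz] | bad] := pselect [/\ (d2 < d)%N, (h2 <= h)%N & (0 < d2 + h2)%N];
    last first.
  exfalso; apply: (@filter_not_empty _ _ (ultra_proper)).
  by apply: (@filterS _ _ (ultra_filter UU)) UV => v [].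
set d1 := (d - d2)%N; set h1 := (h - h2)%N.
pose V := splits d2 h2.
pose T : pointedType := affine_space K (dimI d (Posz h)).
have /choice[ab Hab] : forall v : T,
    exists ab : 'rV[K]_(dimI d1 (Posz h1)) * 'rV[K]_(num_bip d2 h2),
    V v -> (bipoly ab.2)`_0`_0 = 1 /\ nform v = nform ab.1 * bipoly ab.2.
  move=> v; have [[_ [a [b H]]]|nV] := pselect (V v).
    by exists (a, b).
  by exists (0, 0).
pose a (v : T) := (ab v).1; pose b (v : T) := (ab v).2.
pose phi : {rmorphism fun_ring T K -> ultrapower K UU} := @generic_value T K U UU.
pose aL := map_mx phi (row_fun a); pose bL := map_mx phi (row_fun b).
have num0 : (0 < num_bip d2 h2)%N by [].
pose z : 'I_(num_bip d2 h2) := Ordinal num0.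
exists (codom (aL 0) ++ [seq bL 0 i | i in predC1 z]).
  rewrite size_cat size_codom size_image cardC1 !card_ord.
  rewrite /D /num_bip /dimI; move: lt_d2 le_h2 nz; rewrite /d1 /h1 => lt_d2 le_h2 nz.
  have [x [Ex x0]] : exists x, d = (d2 + x)%N /\ (0 < x)%N.
    by exists (d - d2)%N; lia.
  have [y Ey] : exists y, h = (h2 + y)%N by exists (h - h2)%N; lia.
  have pos : (0 < d2 * y + x * h2)%N.
    rewrite addn_gt0 !muln_gt0 x0 /=; case: (posnP h2) => [h20|_]; last by rewrite orbT.
    by move: h0 nz; rewrite Ey h20 addn0 add0n orbF => -> ->.
  rewrite Ex Ey !addKn; move: pos x0; lia.
move=> l; set C := acl _; have [rC iC] : subfield C := acl_subfield _.
have bC x : C (phi (fun=> x)).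
  by apply: sub_acl; left; exact: base_const.
have Ca i : C (aL 0 i).
  by apply: sub_acl; right; rewrite /= mem_cat; apply/orP; left; exact: codom_f.
have Cb i : C (bL 0 i).
  have [->|iz] := eqVneq i z; last first.
    by apply: sub_acl; right; rewrite /= mem_cat; apply/orP; right; apply/fintype.imageP; exists i.
  suff -> : bL 0 z = 1 by apply: subring1.
  apply: subr0_eq; rewrite mxE -(rmorph1 phi) -rmorphB.
  apply: (generic_eq0_in UU UV) => v Vv; have [b1 _] := Hab v Vv.
  rewrite rmorphB rmorph1 mxE; apply/eqP; rewrite subr_eq0; apply/eqP.
  rewrite /eval_at -b1 coef_bipoly /= mul0n add0n.
  by rewrite -[0%N]/(val z) coef_rVpoly_ord.
set i := ((l + 2) %/ d.+1)%N; set j := ((l + 2) %% d.+1)%N.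
have E0 : phi ((fun v : T => ('X_l : {mpoly K[_]}).@[v 0]) -
    (nform (row_fun a) * bipoly (row_fun b))`_j`_i) = 0.
  apply: (generic_eq0_in UU UV) => v Vv; have [_ E] := Hab v Vv.
  rewrite rmorphB; apply/eqP; rewrite subr_eq0; apply/eqP.
  transitivity (v 0 l); first exact: mevalXU.
  rewrite -[v in LHS](poly_coords_nform v d0) mxE E -/(a v) -/(b v).
  rewrite -(eval_row_fun a v) -(eval_row_fun b v) -map_nform -map_bipoly -rmorphM.
  by rewrite coef_map coef_map.
have -> : mclass UU 'X_l = (nform aL * bipoly bL)`_j`_i.
  apply: subr0_eq; rewrite -[RHS]E0 rmorphB -map_nform -map_bipoly -rmorphM.
  by rewrite coef_map coef_map.
exact: (nform_mul_bipoly_in rC Ca Cb).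
Qed.

(** If the reducible normal forms were dense, the flag of coordinate subspaces of
    the whole space would be too long for [dim_bound]. *)
Lemma irred_generic : exists g : {mpoly K[dimI d (Posz h)]},
  ~ vanish g setT /\ forall c : 'rV[K]_(dimI d (Posz h)), g.@[c 0] <> 0 -> irred (nform c).
Proof.
pose S := [set c | ~ irred (@nform K d h c)].
apply: contrapT => H.
have dense p : vanish p S -> vanish p (flag (0 : 'rV[K]_(dimI d (Posz h))) (dimI d (Posz h))).
  rewrite flag_full => pS; apply: contrapT => np; apply: H; exists p; split=> // c pc.
  by apply: contrapT => nirr; apply: pc; apply: pS.
pose V (x : nat) := splits (x %/ h.+1) (x %% h.+1).
have := dim_bound (k := (d.+1 * h.+1)%N) (V := V) (D := (D - 1)%N)
   (flag_chain 0) _ dense.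
rewrite flag_full => /(_ (fun _ _ => I)) B.
have : (dimI d (Posz h) <= D - 1)%N.
  apply: B => [c /nform_red[[i j] /andP[/= ile jle] sp]|x _].
    exists (i * h.+1 + j)%N; first by nia.
    by rewrite /V divnMDl // modnMDl divn_small // addn0 modn_small.
  exact: splits_param_dim.
by rewrite /dimI -/D => le; have : (0 < D)%N by [rewrite /D; lia]; lia.
Qed.

End Reducible.

(** * Affine embeddings and a chain in the stratum e = 0 *)

Section AffineImage.
Variables (K : closedFieldType) (m N : nat).
Variables (A : 'M[K]_(m, N)) (B : 'M[K]_(N, m)) (b : 'rV[K]_N).
Hypothesis AB : A *m B = 1%:M.

Definition aff (v : 'rV[K]_m) : 'rV[K]_N := v *m A + b.
Definition aff_inv (v : 'rV[K]_N) : 'rV[K]_m := (v - b) *m B.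

Lemma affK : cancel aff aff_inv.
Proof. by move=> v; rewrite /aff_inv /aff addrK -mulmxA AB mulmx1. Qed.

Definition aff_mpoly : 'rV[{mpoly K[m]}]_N :=
  gen_row K m *m map_mx (@mpolyC m K) A + map_mx (@mpolyC m K) b.
Definition aff_inv_mpoly : 'rV[{mpoly K[N]}]_m :=
  (gen_row K N - map_mx (@mpolyC N K) b) *m map_mx (@mpolyC N K) B.

Lemma map_mpolyCK p q n (v : 'I_n -> K) (M : 'M[K]_(p, q)) :
  map_mx (meval v) (map_mx (@mpolyC n K) M) = M.
Proof. by apply/matrixP => i j; rewrite !mxE mevalC. Qed.

Lemma aff_mpolyE v : mpoly_map aff_mpoly v = aff v.
Proof.
by rewrite /mpoly_map /aff_mpoly map_mxD map_mxM /= !map_mpolyCK eval_gen_row.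
Qed.

Lemma aff_inv_mpolyE v : mpoly_map aff_inv_mpoly v = aff_inv v.
Proof.
by rewrite /mpoly_map /aff_inv_mpoly map_mxM map_mxB /= !map_mpolyCK eval_gen_row.
Qed.

(** The equations of the image of [aff]. *)
Definition aff_range_eqs : seq {mpoly K[N]} :=
  [seq (aff_inv_mpoly *m map_mx (@mpolyC N K) A + map_mx (@mpolyC N K) b - gen_row K N) 0 i
  | i <- enum 'I_N].

Lemma aff_range_eqsP (v : 'rV[K]_N) :
  (forall p, p \in aff_range_eqs -> p.@[v 0] = 0) <-> aff (aff_inv v) = v.
Proof.
pose r := aff_inv_mpoly *m map_mx (@mpolyC N K) A + map_mx (@mpolyC N K) b - gen_row K N.
have E : map_mx (meval (v 0)) r = aff (aff_inv v) - v.
  rewrite /r map_mxB map_mxD map_mxM /= !map_mpolyCK eval_gen_row.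
  by rewrite -/(mpoly_map aff_inv_mpoly v) aff_inv_mpolyE.
have Ei i : (r 0 i).@[v 0] = (aff (aff_inv v) - v) 0 i by rewrite -E [RHS]mxE.
split=> [H|H p /mapP[i _ ->]].
  apply: subr0_eq; apply/rowP => i; rewrite -Ei [RHS]mxE; apply: H.
  by apply/mapP; exists i; rewrite ?mem_enum.
by rewrite -/r Ei H subrr mxE.
Qed.

Lemma aff_imageE (X : set 'rV[K]_m) :
  aff @` X = [set v | aff (aff_inv v) = v /\ X (aff_inv v)].
Proof.
apply/seteqP; split=> [_ [w Xw <-]|v [E Xv]]; first by rewrite /= affK.
by exists (aff_inv v).
Qed.

Lemma clausal_aff_image (X : set 'rV[K]_m) : clausal X -> clausal (aff @` X).
Proof.
move=> /clausal_definable dX; apply: definable_clausal; rewrite aff_imageE.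
have := definableI (definable_zeros aff_range_eqs) (definable_preim aff_inv_mpoly dX).
congr definable; apply/funext => v; apply/propext; rewrite /= aff_inv_mpolyE.
by split=> -[/aff_range_eqsP ? ?].
Qed.

End AffineImage.

Lemma clausal_bigU (K : closedFieldType) n (X : nat -> set 'rV[K]_n) k :
  (forall i, clausal (X i)) ->
  clausal [set v | exists2 i, (i < k)%N & X i v].
Proof.
move=> cX; apply: definable_clausal; elim: k => [|k IH].
  by exists (GRing.Bool false) => e /=; split=> // -[].
have := definableU IH (clausal_definable (cX k)).
congr definable; apply/seteqP; split=> v.
  by move=> [[i lt Xi]|Xk]; [exists i => //; apply: ltnW|exists k].
move=> [i]; rewrite ltnS leq_eqVlt => /predU1P[->|lt] Xi; first by right.
by left; exists i.
Qed.

Section ZariskiClosed.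
Variables (K : closedFieldType) (m N : nat).

Lemma zclosed_preim (phi : 'rV[{mpoly K[m]}]_N) (F : set 'rV[K]_N) :
  zclosed F -> zclosed (mpoly_map phi @^-1` F).
Proof.
move=> [S ->]; exists [set p \mPo [tuple phi 0 i | i < N] | p in S].
apply/seteqP; split=> v /= H.
  by move=> _ [p Sp <-]; rewrite -mpoly_mapE; apply: H.
by move=> p Sp; rewrite mpoly_mapE; apply: H; exists p.
Qed.

Lemma zclosedI (F G : set 'rV[K]_N) : zclosed F -> zclosed G -> zclosed (F `&` G).
Proof.
move=> [S ->] [T ->]; exists (S `|` T); apply/seteqP; split=> v /=.
  by move=> [HS HT] p [/HS|/HT].
by move=> H; split=> p ?; apply: H; [left|right].
Qed.

Lemma flag_closed (p : 'rV[K]_N) i : zclosed (flag p i).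
Proof.
exists [set q | exists2 k : 'I_N, (i <= k)%N & q = flag_eq p k].
apply/seteqP; split=> v /= H.
  by move=> _ [k le ->]; rewrite flag_eqE H // subrr.
move=> k le; apply: subr0_eq; rewrite -flag_eqE; apply: H.
by exists k.
Qed.

End ZariskiClosed.

Section StrataChain.
Variables (K : closedFieldType) (d h : nat).
Hypotheses (d0 : (0 < d)%N) (h0 : (0 < h)%N).

(** For e = 0 the substitution is the identity, so that every irreducible normal
    form is in the stratum. Its space of coordinates is that of the normal forms
    only up to the equality of the integers newH d h 0 and h, hence the second
    pair of matrices. *)
Lemma stratum0_embedding N (A : 'M[K]_(dimA d h 0, N)) (B : 'M[K]_(N, dimA d h 0)) :
  A *m B = 1%:M ->
  exists (A' : 'M[K]_(dimI d (Posz h), N)) (B' : 'M[K]_(N, dimI d (Posz h))),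
    A' *m B' = 1%:M /\
    forall c, irred (nform c) -> exists2 v, imgA K d h 0 v & v *m A = c *m A'.
Proof.
have EH : newH d h 0 = Posz h by rewrite /newH mul0r addr0.
have imgE : imgA K d h 0 =
   [set v : 'rV[K]_(dimA d h 0) | stratumH h (lsubmx v) (rsubmx v)].
  by apply/funext => v; apply/propext; apply: imgAP.
rewrite imgE /dimA in A B *; clear imgE.
move: A B; rewrite EH => A B AB.
exists (dsubmx A), (rsubmx B); split.
  have : dsubmx (A *m B) = dsubmx (1%:M : 'M_(0 + dimI d (Posz h))) by rewrite AB.
  rewrite -[in LHS](vsubmxK A) mul_col_mx col_mxKd => /(congr1 rsubmx).
  rewrite -{1}(hsubmxK B) mul_mx_row row_mxKr => ->.
  apply/matrixP => i j; rewrite !mxE; congr (_%:R); rewrite -val_eqE /=.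
move=> c irrc; exists (row_mx 0 c); last first.
  by rewrite -{1}(vsubmxK A) mul_row_col mul0mx add0r.
rewrite /= row_mxKl row_mxKr; exists (bicoords d h (nform c)).
rewrite bicoordsK ?size_nform ?sizeY_nform //; split=> //.
by rewrite /shift /low_poly big_ord0 muln0 !expr0 polyC0 add0r polyC1 !mul1r comp_polyXr.
Qed.

Variables (N : nat) (U : set 'rV[K]_N).
Variables (A : 'M[K]_(dimI d (Posz h), N)) (B : 'M[K]_(N, dimI d (Posz h))).
Variable b : 'rV[K]_N.
Hypothesis AB : A *m B = 1%:M.
Hypothesis irrU : forall c, irred (nform c) -> U (aff A b c).

(** The i-th set lies between the i-th subspace L_i of the flag and its
    open subset g <> 0, which is not empty. A product of two polynomials that
    vanishes on it vanishes on L_i after multiplication by g. *)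
Lemma strata_irr_chain : irr_chain U (dimI d (Posz h)).
Proof.
have [g [ng irrg]] := irred_generic K d0 h0.
have [p gp] : exists p : 'rV[K]_(dimI d (Posz h)), g.@[p 0] <> 0.
  by apply: contrapT => H; apply: ng => v _; apply: contrapT => nz; apply: H; exists v.
have AK := affK b AB.
have gU (c : 'rV[K]_(dimI d (Posz h))) : g.@[c 0] <> 0 -> U (aff A b c) by move=> /irrg/irrU.
pose Z i := U `&` (aff A b @` flag p i).
exists Z; split=> [i le|i lt].
  split.
    exists (aff A b @` flag p i) => //; rewrite (aff_imageE b AB).
    have -> : [set v | aff A b (aff_inv B b v) = v /\ flag p i (aff_inv B b v)] =
       [set v : 'rV[K]_N | forall q, [set` aff_range_eqs A B b] q -> q.@[v 0] = 0] `&`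
       (mpoly_map (aff_inv_mpoly B b) @^-1` flag p i).
      apply/funext => v; apply/propext; rewrite /= aff_inv_mpolyE.
      by split=> -[/aff_range_eqsP ? ?].
    apply: zclosedI; first by eexists.
    exact/zclosed_preim/flag_closed.
  split; first by exists (aff A b p); split; [apply: gU|exists p].
  move=> F G [S ->] [T ->] cover.
  apply: contrapT => /not_orP[nF nG].
  have out (Q : set {mpoly K[N]}) :
     ~ Z i `<=` [set v : 'rV[K]_N | forall q, Q q -> q.@[v 0] = 0] ->
     exists2 q, Q q & ~ vanish (q \mPo [tuple aff_mpoly A b 0 i | i < N]) (flag p i).
    move=> H; apply: contrapT => H'; apply: H => _ [_ [x Lx <-]] q Qq.
    apply: contrapT => nz; apply: H'; exists q => // /(_ x Lx).
    by rewrite -mpoly_mapE aff_mpolyE.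
  have [f Sf nf] := out S nF; have [f' Tf' nf'] := out T nG.
  have prime := @flag_prime K _ p i.
  have ng' : ~ vanish g (flag p i) by move=> /(_ p (@flag_base _ _ p i)).
  have : vanish ((f \mPo [tuple aff_mpoly A b 0 i | i < N]) *
                 (f' \mPo [tuple aff_mpoly A b 0 i | i < N]) * g) (flag p i).
    move=> x Lx; rewrite !mevalM -!mpoly_mapE !aff_mpolyE.
    have [->|/eqP gx] := eqVneq g.@[x 0] 0; first by rewrite mulr0.
    have [|H|H] := cover (aff A b x); first by split; [apply: gU|exists x].
    - by rewrite (H f Sf) !mul0r.
    - by rewrite (H f' Tf') mulr0 mul0r.
  by move=> /prime[/prime[]|].
pose k := Ordinal lt.
have [x [Lx gx nx]] : exists x, [/\ flag p i.+1 x, g.@[x 0] <> 0 & x 0 k <> p 0 k].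
  apply: contrapT => H.
  have : vanish (g * flag_eq p k) (flag p i.+1).
    move=> x Lx; rewrite mevalM flag_eqE; apply/eqP; apply/negPn/negP.
    rewrite mulf_eq0 negb_or subr_eq0 => /andP[/eqP gx /eqP nx].
    by apply: H; exists x.
  case/(@flag_prime K _ p i.+1) => [/(_ p (@flag_base _ _ p i.+1))//|].
  by have [_ _ /(_ i lt)[_ _]] := flag_chain p.
rewrite /Z; split; first by move=> v [Uv [y Ly E]]; split=> //; exists y => //; apply: flagS.
move=> sub; have [] := sub (aff A b x); first by split; [apply: gU|exists x].
by move=> _ [y Ly /(can_inj AK) E]; apply: nx; rewrite -E; apply: Ly.
Qed.

End StrataChain.

(** * The union of the strata *)

Section Embeddings.
Variables (K : closedFieldType) (d h : nat).
Hypotheses (d0 : (0 < d)%N) (h0 : (0 < h)%N).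

Definition max_dim := (\max_(e < (2 * d * h).+1) dimA d h e)%N.

Definition emb_mx e : 'M[K]_(dimA d h e, max_dim + (2 * d * h).+1) :=
  row_mx (pid_mx (dimA d h e)) 0.
Definition emb_inv e : 'M[K]_(max_dim + (2 * d * h).+1, dimA d h e) :=
  col_mx (pid_mx (dimA d h e)) 0.

(** The last coordinates are a label that keeps the strata apart. *)
Definition emb_label e : 'rV[K]_(max_dim + (2 * d * h).+1) :=
  row_mx 0 (delta_mx 0 (inord e)).

Definition emb e := aff (emb_mx e) (emb_label e).
Arguments emb : clear implicits.

Lemma emb_mxK e : (e <= 2 * d * h)%N -> emb_mx e *m emb_inv e = 1%:M.
Proof.
move=> le; rewrite mul_row_col mul0mx addr0 pid_mx_id ?pid_mx_1 //.
have lt : (e < (2 * d * h).+1)%N by [].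
exact: (leq_bigmax (Ordinal lt)).
Qed.

Lemma emb_inj e v w : (e <= 2 * d * h)%N -> emb e v = emb e w -> v = w.
Proof.
by move=> le; exact: (can_inj (affK (emb_label e) (emb_mxK le))).
Qed.

Lemma emb_affine e : (e <= 2 * d * h)%N -> affine_embedding (emb e).
Proof.
move=> le; exists (emb_mx e), (emb_label e); split=> //.
by apply/row_freeP; exists (emb_inv e); apply: emb_mxK.
Qed.

Lemma emb_disjoint e e' v w : (e <= 2 * d * h)%N -> (e' <= 2 * d * h)%N ->
  emb e v = emb e' w -> e = e'.
Proof.
move=> le le' /(congr1 rsubmx); rewrite /emb /aff !mul_mx_row !add_row_mx.
rewrite !row_mxKr !mulmx0 !add0r => /rowP/(_ (inord e)).
rewrite !mxE !eqxx /=; case: (inord e =P inord e') => [Ee _|_ /eqP].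
  by have := f_equal (@nat_of_ord _) Ee; rewrite !inordK.
by rewrite oner_eq0.
Qed.

Definition strata : set 'rV[K]_(max_dim + (2 * d * h).+1) :=
  \bigcup_(e in [set e : nat | (e <= 2 * d * h)%N]) (emb e @` imgA K d h e).

Lemma strataE : strata =
  [set v | exists2 e, (e < (2 * d * h).+1)%N & (emb e @` imgA K d h e) v].
Proof. by []. Qed.

Lemma strata_constructible : constructible_in [set: 'rV[K]_(max_dim + (2 * d * h).+1)] strata.
Proof.
apply: clausal_constructible => //; rewrite strataE.
pose X e := if (e <= 2 * d * h)%N then emb e @` imgA K d h e else set0.
have := @clausal_bigU K _ X (2 * d * h).+1; have -> :
  [set v | exists2 e, (e < (2 * d * h).+1)%N & X e v] =
  [set v | exists2 e, (e < (2 * d * h).+1)%N & (emb e @` imgA K d h e) v].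
  apply/seteqP; split=> v [e lt Xv]; exists e => //; move: Xv;
    by rewrite /X (_ : (e <= 2 * d * h)%N = true).
apply=> e; rewrite /X; case: leqP => [le|_]; last by exists [::] => v.
exact: (clausal_aff_image (emb_label e) (emb_mxK le) (clausal_imgA K h e d0)).
Qed.

Lemma stratum_image_dim e : param_dim (emb e @` imgA K d h e) (d * h + d + h - 1).
Proof.
have imgE : imgA K d h e =
   [set v : 'rV[K]_(dimA d h e) | stratumH h (lsubmx v) (rsubmx v)].
  by apply/funext => v; apply/propext; apply: imgAP.
rewrite imgE /emb /aff /=; move: (emb_mx e) (emb_label e); clear imgE.
rewrite /dimA; case: (newH d h e) => n A b.
  have := @stratum_param_dim K d h e n _ d0 A b; congr param_dim.
  by apply/seteqP; split=> [v [w sw ->]|_ [w sw <-]]; exists w.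
move=> U UU UV; exfalso; apply: (@filter.filter_not_empty _ _ (filter.ultra_proper)).
by apply: (@filter.filterS _ _ (ultra_filter UU)) UV => v [].
Qed.

Lemma strata_dim : has_dim strata (d * h + d + h - 1).
Proof.
split.
  have le0 : (0 <= 2 * d * h)%N by [].
  have [A' [B' [AB irr]]] := stratum0_embedding d0 (emb_mxK le0).
  apply: (strata_irr_chain d0 h0 (A := A') (B := B') (b := emb_label 0) AB) => c irrc.
  have [v vI Ev] := irr c irrc.
  by exists 0%N => //; exists v => //; rewrite /emb /aff Ev.
move=> m /irr_chain_poly[Z [q [chain ZU]]].
apply: (dim_bound (k := (2 * d * h).+1) (V := fun e => emb e @` imgA K d h e)
   chain (S := Z m)) => //.
by move=> e _; apply: stratum_image_dim.
Qed.

End Embeddings.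
Arguments emb : clear implicits.

Theorem theorem2p8 (K : closedFieldType) (d h : nat)
    (hd : (1 <= d)%N) (hh : (1 <= h)%N) :
  (forall e : nat,
     [/\ set_fun (algA K d h e) (algI K d (newH d h e)) (phi1 e),
         set_fun (algA K d h e) (prodC K d h e) (theta d h e),
         set_inj (algA K d h e) (theta d h e) &
         constructible_in (prodC K d h e) (imgA K d h e)])
  /\
  exists (N : nat) (iota : forall e : nat, 'rV[K]_(dimA d h e) -> 'rV[K]_N),
    let E := [set e : nat | (e <= 2 * d * h)%N] in
    let U := \bigcup_(e in E) (iota e @` imgA K d h e) in
    [/\ forall e, E e -> algA K d h e !=set0 -> affine_embedding (iota e),
        trivIset E (fun e => iota e @` imgA K d h e),
        constructible_in [set: 'rV[K]_N] U,
        exists F : fps K -> 'rV[K]_N,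
          set_bij (algA0 K d h) U F /\
          forall e f, E e -> algA K d h e f -> F f = iota e (theta d h e f) &
        has_dim U (d * h + d + h - 1)%N].
Proof.
split=> [e|].
  split; [exact: phi1_algI|exact: theta_prodC|exact: theta_inj|].
  apply: clausal_constructible; first exact: clausal_imgA.
  exact: imgA_sub_prodC.
exists (max_dim d h + (2 * d * h).+1)%N, (emb K d h) => E U.
split.
- by move=> e Ee _; apply: emb_affine.
- by move=> e e' Ee Ee' [_ [[v _ <-] [w _ /esym]]]; apply: emb_disjoint.
- exact: strata_constructible.
- pose ord f := xget 0%N [set e | algA K d h e f].
  have ordE e f : algA K d h e f -> ord f = e.
    by move=> fA; apply: xget_unique => // e' fA'; apply: algA_uniq fA' fA.
  exists (fun f => emb K d h (ord f) (theta d h (ord f) f)); split; last first.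
    by move=> e f _ fA; rewrite (ordE e f fA).
  split.
  + move=> f /algA_ex[e le fA]; rewrite (ordE e f fA).
    by exists e => //; exists (theta d h e f) => //; exists f.
  + move=> f g; rewrite !inE => /algA_ex[e le fA] /algA_ex[e' le' gA].
    rewrite (ordE e f fA) (ordE e' g gA) => H.
    have E' := emb_disjoint le le' H; subst e'.
    have := emb_inj le H; apply: (theta_inj hd); exact/mem_set.
  + move=> _ [e le [_ [f fA <-] <-]]; exists f; first by case: fA.
    by rewrite (ordE e f fA).
- exact: strata_dim.
Qed.
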